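(* Assume that $H$ satisfies (H1)–(H4) and (H$^\infty$) listed in the context, and let $\lambda\in\mathbb{R}$. Suppose that the periodic linear Hamiltonian systems $$Jx'-A_\lambda^+(t)x=0\quad\text{and}\quad Jx'-A_\lambda^-(t)x=0$$ have no characteristic multipliers on the unit circle. Then $D_xF(\lambda,0)\in\Phi_0(H^1,L^2)$. Furthermore, $\ker D_xF(\lambda,0)=N(\lambda)$, where $$N(\lambda)=\{u\in C^1(\mathbb{R},\mathbb{R}^{2N}):\ Ju'(t)-A_\lambda(t)u(t)\equiv 0\ \text{ and }\ \lim_{|t|\to\infty}u(t)=0\}.$$
   Context: Let $N\ge 1$ be an integer and $J$ a real $2N\times 2N$ matrix with $J^T=J^{-1}=-J$. Write $L^2=L^2(\mathbb{R},\mathbb{R}^{2N})$ and $H^1=H^1(\mathbb{R},\mathbb{R}^{2N})$ with their usual norms; elements of $H^1$ are identified with their continuous representatives. $\|\cdot\|$ is also the Euclidean norm of vectors and matrices. $\Phi_0(X,Y)$ is the set of bounded linear Fredholm operators of index zero from $X$ to $Y$. Bundle maps: $f:\mathbb{R}\times\mathbb{R}^M\to\mathbb{R}$, $(t,\xi)\mapsto f(t,\xi)$, is an equicontinuous $C^0_\xi$-bundle map if $f$ is continuous and the family $\{f(t,\cdot)\}_{t\in\mathbb{R}}$ is equicontinuous at every point $\xi\in\mathbb{R}^M$; it is an equicontinuous $C^k_\xi$-bundle map if all partial derivatives $\partial^\kappa f/\partial\xi^\kappa$, $|\kappa|\le k$, exist and are equicontinuous $C^0_\xi$-bundle maps. For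 vector- or matrix-valued functions this is required of each component. Hypotheses on $H:\mathbb{R}\times\mathbb{R}^{2N}\times\mathbb{R}\to\mathbb{R}$, $(t,\xi,\lambda)\mapsto H(t,\xi,\lambda)$: (H1) $H$ is continuous, $H(t,\cdot,\lambda)\in C^2(\mathbb{R}^{2N})$ and $D_\xi H(t,0,\lambda)=0$ for all $t,\lambda\in\mathbb{R}$. (H2) The partial derivatives $D_\xi H$, $D_\xi^2H$, $D_\lambda D_\xi H$, $D_\lambda D_\xi^2H$ and $D_\xi D_\lambda D_\xi H$ exist and are continuous on $\mathbb{R}\times\mathbb{R}^{2N}\times\mathbb{R}$. (H3) For each $\lambda\in\mathbb{R}$, $D_\xi H(\cdot,\cdot,\lambda):\mathbb{R}\times\mathbb{R}^{2N}\to\mathbb{R}^{2N}$ is an equicontinuous $C^1_\xi$-bundle map, and $D_\lambda D_\xi^2H$, viewed as a matrix-valued function on $\mathbb{R}\times(\mathbb{R}^{2N}\times\mathbb{R})$, is an equicontinuous $C^0_{(\xi,\lambda)}$-bundle map. (H4) $D_\xi^2H(\cdot,0,0)$ and $D_\lambda D_\xi^2H(\cdot,0,0)$ belong to $L^\infty(\mathbb{R})$. (H$^\infty$) For every $\lambda\in\mathbb{R}$ there exist two equicontinuous $C^1_\xi$-bundle maps $g^+(\cdot,\cdot,\lambda),g^-(\cdot,\cdot,\lambda):\mathbb{R}\times\mathbb{R}^{2N}\to\mathbb{R}^{2N}$ such that: (1) $g^\pm(t,0,\lambda)=0$ for all $t,\lambda\in\mathbb{R}$; (2) $\lim_{t\to\infty}\{D_\xi^2H(t,\xi,\lambda)-D_\xi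 g^+(t,\xi,\lambda)\}=\lim_{t\to-\infty}\{D_\xi^2H(t,\xi,\lambda)-D_\xi g^-(t,\xi,\lambda)\}=0$ uniformly for $\xi$ in bounded subsets of $\mathbb{R}^{2N}$; (3) there are $T^+,T^->0$ (possibly depending on $\lambda$) with $g^\pm(t+T^\pm,\xi,\lambda)=g^\pm(t,\xi,\lambda)$ for all $(t,\xi)$. Define $F:\mathbb{R}\times H^1\to L^2$ by $F(\lambda,x)(t)=Jx'(t)-D_\xi H(t,x(t),\lambda)$; under (H1)–(H4) it is well defined and $C^1$, with $D_xF(\lambda,0)u=Ju'-D_\xi^2H(\cdot,0,\lambda)u$. Put $A_\lambda(t)=D_\xi^2H(t,0,\lambda)$ and $A_\lambda^\pm(t)=D_\xi g^\pm(t,0,\lambda)$; the matrices $A_\lambda(t),A^\pm_\lambda(t)$ are real symmetric and $A_\lambda^\pm$ is periodic in $t$ with period $T^\pm$. *)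

(* Defs.v *)
From HB Require Import structures.
From mathcomp Require Import all_boot all_order all_algebra.
From mathcomp Require Import all_classical all_reals all_analysis.
From mathcomp Require Import measurable_realfun.
From mathcomp Require Import complex ring lra.
Set Implicit Arguments.
Unset Strict Implicit.
Unset Printing Implicit Defensive.
Import Order.TTheory GRing.Theory Num.Theory.
Import numFieldNormedType.Exports.
Local Open Scope classical_set_scope.
Local Open Scope ring_scope.

Section EuclideanNorm.
Variables (R : realType) (n : nat).
Implicit Types u v : 'cV[R]_n.

Definition enorm v : R := Num.sqrt (\sum_i v i 0 ^+ 2).

Lemma enorm_ge0 v : 0 <= enorm v. Proof. exact: sqrtr_ge0. Qed.

Lemma sumsq_ge0 v : 0 <= \sum_i v i 0 ^+ 2.
Proof. by apply: sumr_ge0 => i _; exact: sqr_ge0. Qed.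

Lemma sqr_enorm v : enorm v ^+ 2 = \sum_i v i 0 ^+ 2.
Proof. by rewrite sqr_sqrtr// sumsq_ge0. Qed.

Lemma enorm_eq0 v : enorm v = 0 -> v = 0.
Proof.
move=> v0; have /eqP : \sum_i v i 0 ^+ 2 = 0 by rewrite -sqr_enorm v0 expr0n.
rewrite psumr_eq0 => [/allP h|i _]; last exact: sqr_ge0.
apply/colP => i; rewrite mxE; apply/eqP.
by move: (h i (mem_index_enum i)); rewrite sqrf_eq0.
Qed.

Lemma enormZ a v : enorm (a *: v) = `|a| * enorm v.
Proof.
rewrite /enorm -sqrtr_sqr -sqrtrM ?sqr_ge0// mulr_sumr.
by congr Num.sqrt; apply: eq_bigr => i _; rewrite mxE exprMn.
Qed.

Lemma enorm0 : enorm 0 = 0.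
Proof. by rewrite -(scale0r (0 : 'cV_n)) enormZ normr0 mul0r. Qed.

Lemma dot_le u v : \sum_i u i 0 * v i 0 <= enorm u * enorm v.
Proof.
have [/enorm_eq0 ->|u0] := eqVneq (enorm u) 0.
  by rewrite enorm0 mul0r big1// => i _; rewrite mxE mul0r.
have [/enorm_eq0 ->|v0] := eqVneq (enorm v) 0.
  by rewrite enorm0 mulr0 big1// => i _; rewrite mxE mulr0.
have up : 0 < enorm u by rewrite lt_neqAle eq_sym u0 enorm_ge0.
have vp : 0 < enorm v by rewrite lt_neqAle eq_sym v0 enorm_ge0.
rewrite -(ler_pM2l (mulr_gt0 up vp)) -(ler_pM2l (ltr0Sn R 1)).
have /sumr_ge0 h : forall i : 'I_n, true ->
    0 <= (enorm v * u i 0 - enorm u * v i 0) ^+ 2 by move=> i _; exact: sqr_ge0.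
have {h} := h (index_enum _).
have -> : \sum_i (enorm v * u i 0 - enorm u * v i 0) ^+ 2 =
    enorm v ^+ 2 * (\sum_i u i 0 ^+ 2) + enorm u ^+ 2 * (\sum_i v i 0 ^+ 2)
    - (2 * enorm u * enorm v) * \sum_i u i 0 * v i 0.
  rewrite !mulr_sumr -sumrN -!big_split/=; apply: eq_bigr => i _.
  ring.
rewrite -!sqr_enorm; nra.
Qed.

Lemma enormD u v : enorm (u + v) <= enorm u + enorm v.
Proof.
rewrite -[leRHS]ger0_norm ?addr_ge0 ?enorm_ge0// -sqrtr_sqr ler_sqrt ?sqr_ge0//.
have -> : \sum_i (u + v) i 0 ^+ 2 =
    \sum_i u i 0 ^+ 2 + \sum_i v i 0 ^+ 2 + 2 * \sum_i u i 0 * v i 0.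
  rewrite !mulr_sumr -!big_split/=; apply: eq_bigr => i _; rewrite mxE.
  ring.
rewrite -!sqr_enorm; have := dot_le u v; nra.
Qed.

Lemma enorm_le_sum v : enorm v <= \sum_i `|v i 0|.
Proof.
rewrite -[leRHS]ger0_norm ?sumr_ge0// -sqrtr_sqr ler_sqrt ?sqr_ge0//.
rewrite expr2 mulr_suml; apply: ler_sum => i _.
rewrite -real_normK ?num_real// expr2 ler_wpM2l// (bigD1 i)//= lerDl.
by rewrite sumr_ge0.
Qed.

End EuclideanNorm.

Section LebesgueAe.
Variable R : realType.
Local Notation mu := (@lebesgue_measure R).
Implicit Types P Q : R -> Prop.

Lemma leb_aeW P : (forall t, P t) -> {ae mu, forall t, P t}.
Proof. by move=> h; apply: (@filterE _ _ (ae_filter_ringOfSetsType mu)). Qed.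

Lemma leb_aeS P Q : (forall t, P t -> Q t) ->
  {ae mu, forall t, P t} -> {ae mu, forall t, Q t}.
Proof. exact: (@filterS _ _ (ae_filter_ringOfSetsType mu)). Qed.

Lemma leb_aeS2 P P' Q : (forall t, P t -> P' t -> Q t) ->
  {ae mu, forall t, P t} -> {ae mu, forall t, P' t} -> {ae mu, forall t, Q t}.
Proof. exact: (@filterS2 _ _ (ae_filter_ringOfSetsType mu)). Qed.

End LebesgueAe.

Section SquareIntegrable.
Variables (R : realType) (n : nat).
Local Notation mu := (@lebesgue_measure R).
Implicit Types f g : R -> 'cV[R]_n.

Definition sqint : {pred R -> 'cV[R]_n} :=
  mem [set f : R -> 'cV[R]_n | forall i, (fun t => f t i 0) \in Lfun mu 2%:E].

Lemma sqintP f : reflect (forall i, (fun t => f t i 0) \in Lfun mu 2%:E) (f \in sqint).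
Proof. by apply: (iffP idP); rewrite inE. Qed.

Lemma sqint_submod_closed : submod_closed sqint.
Proof.
have [L0 LD] := Lfun_submod_closed mu (lee1n 2 : (1 <= 2%:E :> \bar R)%E).
split=> [|a f g /sqintP hf /sqintP hg]; apply/sqintP => i.
  by rewrite (_ : (fun _ => _) = 0)//; apply/funext => t; rewrite mxE.
rewrite (_ : (fun _ => _) = a *: (fun t => f t i 0) + (fun t => g t i 0)).
  exact: LD.
by apply/funext => t; rewrite !mxE.
Qed.

HB.instance Definition _ :=
  GRing.isSubmodClosed.Build R (R -> 'cV[R]_n) sqint sqint_submod_closed.

Definition l2norm f : R := fine ('N[mu]_2%:E[EFin \o (@enorm R n \o f)])%E.

Lemma measurable_coord f i : f \in sqint ->
  measurable_fun [set: R] (fun t => f t i 0 : R).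
Proof. by move=> /sqintP/(_ i); rewrite inE => /andP[]; rewrite inE. Qed.

Lemma measurable_enorm f : f \in sqint ->
  measurable_fun [set: R] (@enorm R n \o f).
Proof.
move=> hf.
apply: (@measurableT_comp _ _ _ _ _ _ (@Num.sqrt R) _
  (fun t => \sum_i f t i 0 ^+ 2)).
  exact: (continuous_measurable_fun (@sqrt_continuous R)).
apply: measurable_sum => i; apply: measurable_funX; exact: measurable_coord.
Qed.

Lemma le_Lnorm2 (p q : R -> R) : measurable_fun [set: R] p ->
    measurable_fun [set: R] q -> (forall t, 0 <= p t <= q t) ->
  ('N[mu]_2%:E[EFin \o p] <= 'N[mu]_2%:E[EFin \o q])%E.
Proof.
move=> mp mq pq; rewrite unlock gt0_ler_poweR ?in_itv/= ?leey ?andbT//;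
  do ?by apply: integral_ge0 => t _; rewrite lee_fin powR_ge0.
have mpow (h : R -> R) : measurable_fun [set: R] h ->
    measurable_fun [set: R] (fun t => (`|(EFin \o h) t| `^ 2)%E).
  move=> mh; apply/measurable_EFinP.
  apply: (@measurableT_comp _ _ _ _ _ _ (fun x : R => x `^ 2)) => //.
  exact: measurableT_comp.
apply: ge0_le_integral => //.
- exact: mpow.
- exact: mpow.
- move=> t _; have /andP[p0 ptq] := pq t.
  rewrite /= lee_fin ge0_ler_powR ?nnegrE//.
  by rewrite !ger0_norm// (le_trans p0).
Qed.

Lemma enorm_Lfun f : f \in sqint -> @enorm R n \o f \in Lfun mu 2%:E.
Proof.
move=> hf; rewrite inE; apply/andP; split; rewrite inE/=.
  exact: measurable_enorm.
have hs : (fun t => \sum_i `|f t i 0|) \in Lfun mu 2%:E.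
  have [L0 LD] := Lfun_submod_closed mu (lee1n 2 : (1 <= 2%:E :> \bar R)%E).
  rewrite (_ : (fun _ => _) = \sum_i (fun t => `|f t i 0|)); last first.
    by apply/funext => t; rewrite fct_sumE.
  elim/big_ind : _ => // [p q hp hq|i _]; first by rewrite -[p]scale1r; exact: LD.
  move: hf => /sqintP/(_ i); rewrite !inE => /andP[]; rewrite !inE/= => mf ff.
  apply/andP; split; rewrite inE/=; first exact: measurableT_comp.
  by move: ff; rewrite /finite_norm -Lnorm_abse.
move: (hs); rewrite inE => /andP[]; rewrite !inE/= => ms.
rewrite /finite_norm; apply: le_lt_trans; apply: le_Lnorm2 => //.
  exact: measurable_enorm.
by move=> t; rewrite enorm_ge0 enorm_le_sum.
Qed.

Lemma l2normE f : f \in sqint ->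
  (l2norm f)%:E = ('N[mu]_2%:E[EFin \o (@enorm R n \o f)])%E.
Proof.
move=> /enorm_Lfun; rewrite inE => /andP[_]; rewrite inE/= /finite_norm => h.
by rewrite fineK// ge0_fin_numE// Lnorm_ge0.
Qed.

Lemma l2norm_ge0 f : 0 <= l2norm f.
Proof. by rewrite fine_ge0// Lnorm_ge0. Qed.

Lemma l2normD f g : f \in sqint -> g \in sqint ->
  l2norm (f + g) <= l2norm f + l2norm g.
Proof.
move=> hf hg; rewrite -lee_fin EFinD !l2normE ?rpredD//.
apply: le_trans (minkowski_EFin mu (measurable_enorm hf) (measurable_enorm hg) _).
  apply: le_Lnorm2.
  - by apply: measurable_enorm; rewrite rpredD.
  - by apply: measurable_funD; exact: measurable_enorm.
  - by move=> t; rewrite enorm_ge0/= enormD.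
by rewrite ler1n.
Qed.

Lemma l2normZ a f : f \in sqint -> l2norm (a *: f) = `|a| * l2norm f.
Proof.
move=> hf; apply: EFin_inj; rewrite EFinM !l2normE ?rpredZ//.
have p1 : (1 <= 2%:E :> \bar R)%E by rewrite lee_fin ler1n.
rewrite -[in RHS]normr_id.
rewrite -(LnormZ (Lfun_Sub p1 (enorm_Lfun hf))).
by apply: eq_Lnorm => t /=; rewrite enormZ.
Qed.

Definition ae_zero : {pred R -> 'cV[R]_n} :=
  mem [set f : R -> 'cV[R]_n | {ae mu, forall t, f t = 0}].

Lemma l2norm_ae f : f \in sqint -> (l2norm f == 0) = (f \in ae_zero).
Proof.
move=> hf; apply/idP/idP => [/eqP h|].
  rewrite inE/=.
  have : ('N[mu]_2%:E[EFin \o (@enorm R n \o f)] = 0)%E by rewrite -l2normE// h.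
  move/Lnorm_eq0_eq0 => h0.
  have {}h0 := h0 ((measurable_EFinP _ _).2 (measurable_enorm hf)) _.
  have := h0 ltac:(by rewrite lte_fin).
  by apply: filterS => t /(_ I) /= []; exact: enorm_eq0.
rewrite inE/= => h; apply/eqP; apply: EFin_inj; rewrite l2normE// unlock.
rewrite (ae_eq_integral (cst 0%E))//.
- by rewrite integral0 poweR0r// eqe invr_eq0.
- apply/measurable_EFinP.
  apply: (@measurableT_comp _ _ _ _ _ _ (fun x : R => x `^ 2)) => //.
  by apply: measurableT_comp => //; exact: measurable_enorm.
- by apply: leb_aeS h => t ft0 _ /=; rewrite ft0 enorm0 normr0 powR0.
Qed.

Lemma ae_zero_submod_closed : submod_closed ae_zero.
Proof.
split=> [|a f g]; rewrite !inE/=; first exact: leb_aeW.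
apply: leb_aeS2 => t f0 g0.
by rewrite -[LHS]/(a *: f t + g t) f0 g0 scaler0 addr0.
Qed.

End SquareIntegrable.

Section L2.
Variables (R : realType) (n : nat).
Local Notation mu := (@lebesgue_measure R).

Record sqfun := SqFun {
  sqfun_val :> R -> 'cV[R]_n ;
  sqfun_valP : sqfun_val \in @sqint R n }.

HB.instance Definition _ := [isSub for sqfun_val].
HB.instance Definition _ := [Choice of sqfun by <:].
HB.instance Definition _ := [SubChoice_isSubLmodule of sqfun by <:].

Definition sqnull : {pred sqfun} := [pred f : sqfun | sqfun_val f \in @ae_zero R n].

Lemma sqnull_submod_closed : submod_closed sqnull.
Proof.
have [h0 hD] := @ae_zero_submod_closed R n.
by split=> [|a f g]; [exact: h0|exact: (hD a f g)].
Qed.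

HB.instance Definition _ :=
  GRing.isSubmodClosed.Build R sqfun sqnull sqnull_submod_closed.

Local Open Scope quotient_scope.

Definition L2 : Type := {ideal_quot sqnull}.
HB.instance Definition _ := GRing.Zmodule.on L2.
HB.instance Definition _ := EqQuotient.on L2.

Definition L2_class (f : sqfun) : L2 := \pi_L2 f.
Definition L2_repr (v : L2) : sqfun := repr v.

Lemma L2_reprK : cancel L2_repr L2_class.
Proof. exact: reprK. Qed.

Lemma L2_classP f g :
  L2_class f = L2_class g <-> {ae mu, forall t, f t = g t}.
Proof.
have -> : (L2_class f = L2_class g) <-> (f - g \in sqnull).
  by rewrite Quotient.idealrBE; split => /eqP.
rewrite !inE/=; split; apply: leb_aeS => t; first by move/subr0_eq.
by move=> h; rewrite -[LHS]/(f t - g t) h subrr.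
Qed.

Lemma L2_classD f g : L2_class (f + g) = L2_class f + L2_class g.
Proof. exact: (raddfD \pi_L2). Qed.

Definition L2_scale (a : R) (v : L2) : L2 := L2_class (a *: L2_repr v).

Lemma L2_classZ a f : L2_class (a *: f) = L2_scale a (L2_class f).
Proof.
apply/L2_classP; have /L2_classP := L2_reprK (L2_class f).
by apply: leb_aeS => t h; rewrite -[LHS]/(a *: f t) -h.
Qed.

Lemma L2_scaleA a b v : L2_scale a (L2_scale b v) = L2_scale (a * b) v.
Proof. by rewrite -[v]L2_reprK -!L2_classZ scalerA. Qed.

Lemma L2_scale1 : left_id 1 L2_scale.
Proof. by move=> v; rewrite -[v]L2_reprK -!L2_classZ scale1r. Qed.

Lemma L2_scaleDr : right_distributive L2_scale +%R.
Proof.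
move=> a u v; rewrite -[u]L2_reprK -[v]L2_reprK.
by rewrite -L2_classD -!L2_classZ scalerDr L2_classD.
Qed.

Lemma L2_scaleDl v : {morph L2_scale^~ v : a b / a + b}.
Proof.
by move=> a b; rewrite -[v]L2_reprK -!L2_classZ scalerDl L2_classD.
Qed.

HB.instance Definition _ := GRing.Zmodule_isLmodule.Build R L2
  L2_scaleA L2_scale1 L2_scaleDr L2_scaleDl.

Definition L2_norm (v : L2) : R := l2norm (L2_repr v).

Lemma L2_norm_class f : L2_norm (L2_class f) = l2norm f.
Proof.
have hs (g h : sqfun) : L2_class g = L2_class h -> l2norm g <= l2norm h.
  move=> /L2_classP gh; rewrite -[X in l2norm X](subrK (sqfun_val h)).
  rewrite (le_trans (l2normD _ _))// ?rpredB ?sqfun_valP//.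
  have /eqP -> : l2norm (sqfun_val g - sqfun_val h) == 0.
    rewrite l2norm_ae ?rpredB ?sqfun_valP// inE/=; apply: leb_aeS gh => t e.
    by rewrite -[LHS]/(g t - h t) e subrr.
  by rewrite add0r.
by apply/eqP; rewrite eq_le !hs// L2_reprK.
Qed.

Lemma L2_normD u v : L2_norm (u + v) <= L2_norm u + L2_norm v.
Proof.
rewrite -[u]L2_reprK -[v]L2_reprK -L2_classD !L2_norm_class.
by apply: l2normD; exact: sqfun_valP.
Qed.

Lemma L2_normZ a v : L2_norm (a *: v) = `|a| * L2_norm v.
Proof.
rewrite -[v]L2_reprK -[a *: _]L2_classZ !L2_norm_class.
by apply: l2normZ; exact: sqfun_valP.
Qed.

Lemma L2_norm0_eq0 v : L2_norm v = 0 -> v = 0.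
Proof.
move=> /eqP; rewrite /L2_norm l2norm_ae ?sqfun_valP// inE/= => v0.
by rewrite -[v]L2_reprK -(raddf0 \pi_L2); exact/L2_classP.
Qed.

HB.instance Definition _ := Lmodule_isNormed.Build R L2
  L2_normD L2_normZ L2_norm0_eq0.

Lemma L2_normE v : `|v| = l2norm (L2_repr v).
Proof. by []. Qed.

End L2.

Section H1.
Variables (R : realType) (n : nat).
Local Notation mu := (@lebesgue_measure R).
Implicit Types (u v : R -> 'cV[R]_n) (phi g : R -> R).

Definition test_fun phi :=
  [/\ forall t, derivable phi t 1, continuous (derive1 phi) &
      compact (closure [set t | phi t != 0])].

(* Componentwise, tested against C^1 functions with compact support. *)
Definition weak_deriv u v := forall phi, test_fun phi -> forall i,
  \int[mu]_t (u t i 0 * derive1 phi t) = - \int[mu]_t (v t i 0 * phi t).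

Lemma Lfun2_csupp g (K : set R) : compact K -> continuous g ->
  (forall t, ~ K t -> g t = 0) -> g \in Lfun mu 2%:E.
Proof.
move=> cK cg g0; have mg := continuous_measurable_fun cg.
rewrite inE; apply/andP; split; rewrite inE//= /finite_norm unlock.
apply: poweR_lty.
have mK : measurable K by exact: compact_measurable.
have gE : (fun t => (`|g t| `^ 2)%:E) = ((fun t => (g t * g t)%:E) \_ K).
  apply/funext => t; rewrite patchE; case: ifPn => [_|].
    by rewrite -[2]/(2%:R) powR_mulrn// real_normK ?num_real// expr2.
  by rewrite notin_setE => /g0 ->; rewrite normr0 powR0.
have -> : (\int[mu]_x (`|g x| `^ 2)%:E = \int[mu]_(x in K) (g x * g x)%:E)%E.
  by rewrite gE -integral_mkcond.
have /integrableP[_] : mu.-integrable K (EFin \o (g * g)).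
  apply: continuous_compact_integrable => //.
  by apply: continuous_subspaceT => t; apply: continuousM; exact: cg.
apply: le_lt_trans.
rewrite le_eqVlt; apply/orP; left; apply/eqP; apply: eq_integral => t _.
by rewrite gee0_abs// lee_fin -expr2 sqr_ge0.
Qed.

Lemma test_fun_Lfun2 phi : test_fun phi ->
  phi \in Lfun mu 2%:E /\ derive1 phi \in Lfun mu 2%:E.
Proof.
move=> [dphi cphi' cK].
have phi0 t : ~ closure [set t | phi t != 0] t -> phi t = 0.
  move=> Kt; apply/eqP; apply: contrapT => /negP h; apply: Kt.
  exact: subset_closure.
split.
  apply: (Lfun2_csupp cK) => // t.
  by apply: differentiable_continuous; apply/derivable1_diffP.
apply: (Lfun2_csupp cK) => // t Kt.
have ot : \forall s \near t, phi s = cst 0 s.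
  have : open (~` closure [set t | phi t != 0]).
    by apply: closed_openC; exact: closed_closure.
  by rewrite openE => /(_ _ Kt); apply: filterS => s /phi0.
by rewrite derive1E (near_eq_derive _ ot) derive_cst.
Qed.

Lemma integrable_coordM u g i : u \in @sqint R n -> g \in Lfun mu 2%:E ->
  mu.-integrable setT (EFin \o (fun t => u t i 0 * g t)).
Proof.
by move=> /sqintP/(_ i) hu hg; apply/Lfun1_integrable; exact: Lfun2_mul_Lfun1.
Qed.

Lemma weak_deriv_ae u v w : v \in @sqint R n -> w \in @sqint R n ->
  {ae mu, forall t, v t = w t} -> weak_deriv u v -> weak_deriv u w.
Proof.
move=> hv hw vw uv phi tphi i; rewrite uv//; congr (- fine _).
have [l2phi _] := test_fun_Lfun2 tphi.
have mphi (z : R -> 'cV[R]_n) : z \in @sqint R n ->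
    measurable_fun [set: R] (fun t => (z t i 0 * phi t)%:E).
  by move=> hz; have /integrableP[] := integrable_coordM i hz l2phi.
apply: ae_eq_integral => //; [exact: mphi|exact: mphi|].
by apply: leb_aeS vw => t e _; rewrite e.
Qed.

Lemma weak_deriv_lin a u u' v v' :
  u \in @sqint R n -> u' \in @sqint R n ->
  v \in @sqint R n -> v' \in @sqint R n ->
  weak_deriv u v -> weak_deriv u' v' ->
  weak_deriv (a *: u + u') (a *: v + v').
Proof.
move=> hu hu' hv hv' uv uv' phi tphi i.
have [l2p l2p'] := test_fun_Lfun2 tphi.
have lin (z z' : R -> 'cV[R]_n) g : z \in @sqint R n -> z' \in @sqint R n ->
    g \in Lfun mu 2%:E ->
    \int[mu]_t ((a *: z + z') t i 0 * g t) =
    a * (\int[mu]_t (z t i 0 * g t)) + \int[mu]_t (z' t i 0 * g t).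
  move=> hz hz' hg.
  have ez : (fun t => (a *: z + z') t i 0 * g t) =
      (fun t => a * (z t i 0 * g t) + z' t i 0 * g t).
    by apply/funext => t; rewrite !mxE mulrDl mulrA.
  rewrite ez RintegralD//; last exact: integrable_coordM.
    by rewrite RintegralZl//; exact: integrable_coordM.
  rewrite (_ : EFin \o _ = (fun t => a%:E * (z t i 0 * g t)%:E)%E)//.
  by apply: integrableZl => //; exact: integrable_coordM.
by rewrite !lin// uv// uv'// mulrN -opprD.
Qed.

(* The first component is the continuous representative of an element of the
   Sobolev space, the second its weak derivative, which is uniquely determined
   in L2 by the first component. *)
Definition h1_pred : {pred (R -> 'cV[R]_n) * L2 R n} :=
  mem [set p : (R -> 'cV[R]_n) * L2 R n |
    [/\ p.1 \in @sqint R n, continuous p.1 & weak_deriv p.1 (L2_repr p.2)]].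

Lemma h1_submod_closed : submod_closed h1_pred.
Proof.
split=> [|a [u v] [u' v']]; rewrite !inE/=.
  split; [exact: rpred0|by move=> t; exact: cst_continuous|].
  apply: (@weak_deriv_ae _ 0); rewrite ?rpred0 ?sqfun_valP//.
    apply: (@L2_classP _ _ 0 (L2_repr 0)).1.
    by rewrite L2_reprK; exact: (raddf0 \pi_(L2 R n)%qT).
  move=> phi _ i; rewrite -[RHS]mulN1r.
  have e0 g : \int[mu]_t ((0 : R -> 'cV[R]_n) t i 0 * g t) = 0.
    under eq_Rintegral => t _ do rewrite mxE mul0r.
    by rewrite /Rintegral integral0.
  by rewrite !e0 mulr0.
move=> [su cu wu] [su' cu' wu']; split.
- by rewrite rpredD// rpredZ.
- by move=> t; apply: cvgD; [apply: cvgZr; exact: cu|exact: cu'].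
- apply: (@weak_deriv_ae _ (a *: L2_repr v + L2_repr v' : sqfun R n)).
  + exact: sqfun_valP.
  + exact: sqfun_valP.
  + apply: (@L2_classP _ _ (a *: L2_repr v + L2_repr v') _).1.
    by rewrite L2_reprK L2_classD L2_classZ !L2_reprK.
  + by apply: weak_deriv_lin => //; exact: sqfun_valP.
Qed.

HB.instance Definition _ :=
  GRing.isSubmodClosed.Build R ((R -> 'cV[R]_n) * L2 R n)%type h1_pred
    h1_submod_closed.

Record H1 := MkH1 {
  H1_val : (R -> 'cV[R]_n) * L2 R n ;
  H1_valP : H1_val \in h1_pred }.

HB.instance Definition _ := [isSub for H1_val].
HB.instance Definition _ := [Choice of H1 by <:].
HB.instance Definition _ := [SubChoice_isSubLmodule of H1 by <:].

Definition H1_fun (x : H1) : R -> 'cV[R]_n := (H1_val x).1.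
Coercion H1_fun : H1 >-> Funclass.

Definition H1_deriv (x : H1) : L2 R n := (H1_val x).2.

Definition H1_norm (x : H1) : R :=
  Num.sqrt (l2norm x ^+ 2 + `|H1_deriv x| ^+ 2).

Lemma H1_sqint (x : H1) : H1_fun x \in @sqint R n.
Proof. by have := H1_valP x; rewrite inE => -[]. Qed.

Lemma H1_continuous (x : H1) : continuous (H1_fun x).
Proof. by have := H1_valP x; rewrite inE => -[]. Qed.

Lemma H1_weak_deriv (x : H1) : weak_deriv (H1_fun x) (L2_repr (H1_deriv x)).
Proof. by have := H1_valP x; rewrite inE => -[]. Qed.

Lemma sqrt2D (a b c d : R) : 0 <= a -> 0 <= b -> 0 <= c -> 0 <= d ->
  Num.sqrt ((a + c) ^+ 2 + (b + d) ^+ 2) <=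
  Num.sqrt (a ^+ 2 + b ^+ 2) + Num.sqrt (c ^+ 2 + d ^+ 2).
Proof.
move=> a0 b0 c0 d0.
pose p (x y : R) : 'cV[R]_2 := \col_i (if i == 0 then x else y).
have e x y : enorm (p x y) = Num.sqrt (x ^+ 2 + y ^+ 2).
  by rewrite /enorm !big_ord_recl big_ord0 !mxE addr0.
have -> : Num.sqrt ((a + c) ^+ 2 + (b + d) ^+ 2) = enorm (p a b + p c d).
  by rewrite -e; congr enorm; apply/colP => i; rewrite !mxE; case: ifP.
by rewrite -!e enormD.
Qed.

Lemma H1_normD (x y : H1) : H1_norm (x + y) <= H1_norm x + H1_norm y.
Proof.
have h : 0 <= l2norm x /\ 0 <= l2norm y by split; exact: l2norm_ge0.
apply: le_trans (sqrt2D h.1 (normr_ge0 _) h.2 (normr_ge0 _)).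
rewrite ler_sqrt ?addr_ge0 ?sqr_ge0// lerD// ler_sqr ?nnegrE ?addr_ge0
  ?normr_ge0 ?l2norm_ge0//.
  by apply: l2normD; exact: H1_sqint.
exact: ler_normD.
Qed.

Lemma H1_normZ a (x : H1) : H1_norm (a *: x) = `|a| * H1_norm x.
Proof.
rewrite /H1_norm -sqrtr_sqr -[H1_fun _]/(a *: H1_fun x) l2normZ ?H1_sqint//.
rewrite -[H1_deriv _]/(a *: H1_deriv x) normrZ !exprMn -mulrDr sqrtrM ?sqr_ge0//.
by rewrite real_normK ?num_real.
Qed.

Lemma continuous_ae_zero u : continuous u -> u \in @ae_zero R n -> u = 0.
Proof.
move=> cu; rewrite inE/= => -[A [mA A0 hA]]; apply/funext => t.
apply: contrapT => ut.
have /nbhs_ballP[e /= e0 he] : \forall s \near t, u s != 0.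
  have : u s @[s --> t] --> u t by exact: cu.
  move=> /cvgr_neq0; apply; exact/eqP.
have : (mu (ball t e) <= mu A)%E.
  apply: le_measure; rewrite ?inE//; first exact: measurable_ball.
  by move=> s /he us; apply: hA => /= us0; rewrite us0 eqxx in us.
rewrite A0 (lebesgue_measure_ball _ (ltW e0)) lee_fin leNgt => /negP; apply.
by rewrite pmulrn_lgt0.
Qed.

Lemma H1_norm0_eq0 (x : H1) : H1_norm x = 0 -> x = 0.
Proof.
move=> /eqP; rewrite sqrtr_eq0 => h.
have /eqP : l2norm x ^+ 2 + `|H1_deriv x| ^+ 2 = 0.
  by apply/eqP; rewrite eq_le h addr_ge0 ?sqr_ge0.
rewrite paddr_eq0 ?sqr_ge0// !sqrf_eq0 normr_eq0 l2norm_ae ?H1_sqint//.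
move=> /andP[/(continuous_ae_zero (@H1_continuous x)) x0 /eqP dx0].
by apply: val_inj => /=; rewrite [LHS]surjective_pairing -/(H1_fun x)
  -/(H1_deriv x) x0 dx0.
Qed.

HB.instance Definition _ := Lmodule_isNormed.Build R H1
  H1_normD H1_normZ H1_norm0_eq0.

Lemma H1_normE (x : H1) : `|x| = H1_norm x.
Proof. by []. Qed.

End H1.

Section Fredholm.
Variable R : realType.

Definition lin_indep (V : lmodType R) m (e : 'I_m -> V) (K : set V) :=
  forall c : 'I_m -> R, K (\sum_i c i *: e i) -> forall i, c i = 0.

Definition has_dim (V : lmodType R) (K : set V) m := exists e : 'I_m -> V,
  lin_indep e [set 0] /\ K = [set \sum_i c i *: e i | c in [set: 'I_m -> R]].

(* The classes of the e i form a basis of the quotient V / K. *)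
Definition has_codim (V : lmodType R) (K : set V) m := exists e : 'I_m -> V,
  lin_indep e K /\ forall v, exists c : 'I_m -> R, K (v - \sum_i c i *: e i).

Definition Phi0 (X Y : normedModType R) (T : {linear X -> Y}) :=
  [/\ continuous T, closed (range T) &
      exists m, has_dim [set x | T x = 0] m /\ has_codim (range T) m].

End Fredholm.

Section Calculus.
Variables (R : realType) (n : nat).

Definition unitv (j : 'I_n) : 'cV[R]_n := delta_mx j 0.

Definition has_partials (W : normedModType R) (g : 'cV[R]_n -> W) :=
  forall x j, derivable g x (unitv j).

Definition grad (f : 'cV[R]_n -> R) x : 'cV[R]_n := \col_j 'D_(unitv j) f x.

Definition jac (g : 'cV[R]_n -> 'cV[R]_n) x : 'M[R]_n :=
  \matrix_(i, j) ('D_(unitv j) g x) i 0.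

Fixpoint Ck k (f : 'cV[R]_n -> R) : Prop :=
  continuous f /\
  if k is k'.+1 then has_partials f /\ forall j, Ck k' ('D_(unitv j) f)
  else True.

(* bundle k: all iterated partial derivatives in x of order at most k exist and
   are jointly continuous and equicontinuous in x, uniformly in t. *)
Definition bundle0 (V : topologicalType) (f : R -> V -> R) :=
  continuous (fun p : R * V => f p.1 p.2) /\ equicontinuous [set: R] f.

Fixpoint bundle k (f : R -> 'cV[R]_n -> R) : Prop :=
  bundle0 f /\
  if k is k'.+1 then
    (forall t, has_partials (f t)) /\
    forall j, bundle k' (fun t => 'D_(unitv j) (f t))
  else True.

End Calculus.

Section Hamiltonian.
Variables (R : realType) (n : nat).
Local Notation mu := (@lebesgue_measure R).
Local Notation V := ('cV[R]_n).
Variables (J : 'M[R]_n) (H : R -> V -> R -> R).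

Definition DxH t x l : V := grad (fun y => H t y l) x.
Definition D2xH t x l : 'M[R]_n := jac (fun y => DxH t y l) x.
Definition DlDxH t x l : V := derive1 (DxH t x) l.
Definition DlD2xH t x l : 'M[R]_n := derive1 (D2xH t x) l.
Definition DxDlDxH t x l : 'M[R]_n := jac (fun y => DlDxH t y l) x.

Definition continuous3 (W : topologicalType) (f : R -> V -> R -> W) :=
  continuous (fun p : R * V * R => f p.1.1 p.1.2 p.2).

Definition hypH1 := [/\ continuous3 H,
  forall t l, Ck 2 (fun x => H t x l) & forall t l, DxH t 0 l = 0].

Definition hypH2 :=
  [/\ (forall t l, has_partials (fun x => H t x l)) /\ continuous3 DxH,
      (forall t l, has_partials (fun x => DxH t x l)) /\ continuous3 D2xH,
      (forall t x l, derivable (DxH t x) l 1) /\ continuous3 DlDxH,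
      (forall t x l, derivable (D2xH t x) l 1) /\ continuous3 DlD2xH &
      (forall t l, has_partials (fun x => DlDxH t x l)) /\
        continuous3 DxDlDxH].

Definition hypH3 :=
  (forall l i, bundle 1 (fun t x => DxH t x l i 0)) /\
  (forall i j, bundle0 (fun t (p : V * R) => DlD2xH t p.1 p.2 i j)).

Definition hypH4 := forall i j,
  (fun t => D2xH t 0 0 i j) \in Lfun mu +oo%E /\
  (fun t => DlD2xH t 0 0 i j) \in Lfun mu +oo%E.

(* G is the filter of t -> +oo or of t -> -oo; the periodic limit g and its
   period T may depend on the parameter l. *)
Definition asymptotic (G : set_system R) (g : R -> V -> R -> V) (T : R -> R) :=
  forall l,
  [/\ forall i, bundle 1 (fun t x => g t x l i 0),
      forall t, g t 0 l = 0,
      forall B : set V, bounded_set B ->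
        {uniform B, (fun t x => D2xH t x l - jac (fun y => g t y l) x) @ G
          --> (fun=> 0 : 'M[R]_n)},
      0 < T l & forall t x, g (t + T l) x l = g t x l].

Definition hypHinf (gp gm : R -> V -> R -> V) (Tp Tm : R -> R) :=
  asymptotic +oo gp Tp /\ asymptotic -oo gm Tm.

Definition lin_coef (l t : R) : 'M[R]_n := D2xH t 0 l.
Definition lim_coef (g : R -> V -> R -> V) (l t : R) : 'M[R]_n :=
  jac (fun y => g t y l) 0.

Definition fundamental_matrix (A : R -> 'M[R]_n) (X : R -> 'M[R]_n) :=
  [/\ X 0 = 1%:M, forall t, derivable X t 1 &
      forall t, J *m derive1 X t - A t *m X t = 0].

(* X T is the monodromy matrix of the T-periodic system J x' - A x = 0. *)
Definition characteristic_multiplier (A : R -> 'M[R]_n) (T : R) (z : R[i]) :=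
  exists2 X, fundamental_matrix A X &
    eigenvalue (map_mx (real_complex R) (X T)) z.

(* Junk value 0 when f is not square integrable; the hypotheses on H exclude
   this case in hamF. *)
Definition L2_of (f : R -> V) : L2 R n := L2_class (insubd (0 : sqfun R n) f).

Definition hamF (l : R) (x : H1 R n) : L2 R n :=
  L2_of (fun t => J *m L2_repr (H1_deriv x) t - DxH t (x t) l).

Definition decaying_solutions (l : R) : set (R -> V) :=
  [set u : R -> V | [/\ forall t, derivable u t 1, continuous (derive1 u),
               forall t, J *m derive1 u t - lin_coef l t *m u t = 0,
               u t @[t --> +oo] --> (0 : V) & u t @[t --> -oo] --> (0 : V)]].

End Hamiltonian.

(* Main.v *)
From HB Require Import structures.
Require Import Defs.
From mathcomp Require Import all_boot all_order all_algebra.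
From mathcomp Require Import all_classical all_reals all_analysis.
From mathcomp Require Import measurable_realfun.
From mathcomp Require Import complex ring lra zify.
Set Implicit Arguments.
Unset Strict Implicit.
Unset Printing Implicit Defensive.
Import Order.TTheory GRing.Theory Num.Theory.
Import numFieldNormedType.Exports.
Local Open Scope classical_set_scope.
Local Open Scope ring_scope.

(** Since [H] has a critical point at the origin, [hamF] is to first order
the operator [L x = J x' - A x], where [A] is the bounded symmetric Hessian of [H]
along the zero solution. A function in [H1] is bounded by twice its norm, and the
second derivatives of [H] are equicontinuous at the origin, so the error
[D_x H (t, x) - A x] is at most [e |x|] in [L2] for small [x]: this is
[hamF_differentiable]. Everything else concerns the linear operator.

Green's identity [green] says that the symplectic pairing of a homogeneous solution
[p] with a solution [u] of [J u' - A u = f] changes exactly by the integral of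
[dot p f]. Let [S+] and [S-] be the initial values of the homogeneous solutions that
decay at plus and minus infinity. By Green's identity, [f] can be in the range of
[L] only if it is orthogonal to the solutions starting in the intersection of [S+]
and [S-] ([range_orthogonal]), and these span the kernel of [L] ([kernelE]). If this
condition is also sufficient, the range is closed, its codimension is the dimension
of the kernel, and the index is zero ([fredholm_alternative]). The kernel consists of
the decaying solutions because both are the solutions starting in that intersection
([decaying_solutionsE]).

For sufficiency one chooses the initial value of a solution of [L u = f] so that its
pairings with all solutions decaying at one end vanish in the limit at that end.
This prescribes a linear functional on [S+] and one on [S-], and orthogonality of [f]
is precisely their agreement on the intersection ([common_extension], [solvable]).
It remains to see that vanishing pairings force [u] to be square integrable on a
half-line ([half_line_bounded]), and here hyperbolicity enters.

The monodromy matrix of the periodic limit system is symplectic without eigenvalues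
on the unit circle. It therefore contracts one half of the space and expands the
other ([hyperbolic_splitting]), so the difference [qform] of the squared components
grows along its orbits. This growth persists for the original system far from the
origin, up to the energy of [f] ([asymptotic_expanding]). Consequently the space
[S+] is isotropic of at least half the dimension, that is Lagrangian, and it can be
transported along the flow. Splitting [u] along the transported space and its image
under [J], the second component is controlled by the pairings and the form is
negative on the first, so [qform] is bounded along [u]; its growth then bounds the
integral of the square of [u]. The end at minus infinity is treated by reversing
time, which changes the sign of [J] and inverts the monodromy matrix. *)

(** * Primitives of locally integrable functions *)

Section Primitives.
Variable R : realType.
Local Notation mu := (@lebesgue_measure R).
Implicit Types (u v g p : R -> R) (a b c t : R).

Definition locint v := forall a b, mu.-integrable `[a, b] (EFin \o v).

Definition prim u v := forall a b, a <= b ->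
  u b - u a = \int[mu]_(t in `[a, b]) v t.

Lemma continuous_locint v : continuous v -> locint v.
Proof.
move=> cv a b; apply: continuous_compact_integrable; first exact: segment_compact.
exact: continuous_subspaceT.
Qed.

Lemma Rintegral_itv_cat v a b c : locint v -> a <= b -> b <= c ->
  \int[mu]_(t in `[a, c]) v t =
  \int[mu]_(t in `[a, b]) v t + \int[mu]_(t in `[b, c]) v t.
Proof.
move=> iv ab bc.
have := @Rintegral_itvB _ v (BLeft a) (BRight c) b (iv a c).
rewrite !bnd_simp => /(_ ab bc) h.
rewrite -(@Rintegral_itv_obnd_cbnd _ b (BRight c)); first by rewrite -h addrC subrK.
by apply: integrableS (iv b c) => //; exact: subset_itv_oc_cc.
Qed.

Definition antider v t := if 0 <= t then \int[mu]_(s in `[0, t]) v s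
  else - \int[mu]_(s in `[t, 0]) v s.

Lemma antider0 v : antider v 0 = 0.
Proof. by rewrite /antider lexx set_itv1 Rintegral_set1. Qed.

Lemma antider_prim v : locint v -> prim (antider v) v.
Proof.
move=> iv a b ab; rewrite /antider.
case: (lerP 0 a) => a0.
  rewrite (le_trans a0 ab) (Rintegral_itv_cat iv a0 ab).
  by rewrite addrC addKr.
case: (lerP 0 b) => b0.
  by rewrite opprK (Rintegral_itv_cat iv (ltW a0) b0) addrC.
by rewrite opprK (Rintegral_itv_cat iv ab (ltW b0)) addrC addrK.
Qed.

Lemma prim_continuous u v : locint v -> prim u v -> continuous u.
Proof.
move=> iv uv t.
have ab : t - 1 < t + 1 by lra.
have := parameterized_integral_continuous (ltW ab) (iv (t - 1) (t + 1)).
move=> /(continuous_within_itvP _ ab)[+ _ _] => /(_ t).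
have ht : t \in `](t - 1), (t + 1)[ by rewrite in_itv/=; apply/andP; split; lra.
move=> /(_ ht) h.
have h2 : {for t, continuous (fun s => u (t - 1) + parameterized_integral mu (t - 1) s v)}.
  by apply: continuousD => //; exact: cst_continuous.
have e s : t - 1 <= s -> u (t - 1) + parameterized_integral mu (t - 1) s v = u s.
  by move=> ts; rewrite /parameterized_integral -uv// addrC subrK.
have te : t - 1 <= t by lra.
rewrite /prop_for /continuous_at (e t te) in h2.
rewrite /continuous_at; apply: cvg_trans h2; apply: near_eq_cvg.
near=> s; rewrite e//; apply: ltW; near: s; apply: lt_nbhsr; lra.
Unshelve. all: by end_near. Qed.

Lemma continuous_prim_derive u v : continuous v -> prim u v ->
  forall t, is_derive t 1 u (v t).
Proof.
move=> cv uv t.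
have iv := continuous_locint cv.
have [tu ta] : t < t + 1 /\ t - 1 < t by split; lra.
have [dF F'] := continuous_FTC1_closed tu (iv (t - 1) (t + 1)) ta (cv t).
have e : \forall s \near t, u (t - 1) + \int[mu]_(r in `[t - 1, s]) v r = u s.
  near=> s; rewrite -uv; first by rewrite addrC subrK.
  by apply: ltW; near: s; exact: lt_nbhsr.
apply: (near_eq_is_derive e); rewrite -F' derive1E.
rewrite -[X in is_derive _ _ _ X]add0r; apply: is_deriveD.
exact: derivableP.
Unshelve. all: by end_near. Qed.

Lemma derive_prim u v : continuous v -> (forall t, is_derive t 1 u (v t)) ->
  prim u v.
Proof.
move=> cv du a b; rewrite le_eqVlt => /predU1P[->|ab].
  by rewrite set_itv1 Rintegral_set1 subrr.
have cu : continuous u.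
  by move=> t; apply: differentiable_continuous; apply/derivable1_diffP; have [] := du t.
rewrite /Rintegral (continuous_FTC2 (F := u) ab)//.
- exact: continuous_subspaceT.
- split=> [t _||]; first by have [] := du t.
  + by apply: cvg_at_right_filter; exact: cu.
  + by apply: cvg_at_left_filter; exact: cu.
- by move=> t _; rewrite derive1E; exact: derive_val.
Qed.

Lemma integrable_restrictT v a b : locint v ->
  mu.-integrable setT (EFin \o (v \_ `[a, b])).
Proof.
move=> iv; rewrite -restrict_EFin; apply/integrable_restrict => //.
by rewrite setTI.
Qed.

(** Fubini on the triangle [a <= r <= q <= b]. *)
Lemma Rintegral_triangle g p a b : locint g -> locint p ->
  \int[mu]_(q in `[a, b]) (p q * \int[mu]_(r in `[a, q]) g r) =
  \int[mu]_(r in `[a, b]) (g r * \int[mu]_(q in `[r, b]) p q).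
Proof.
move=> ig ip.
pose G := g \_ `[a, b]; pose P := p \_ `[a, b].
have iG : mu.-integrable setT (EFin \o G) by exact: integrable_restrictT.
have iP : mu.-integrable setT (EFin \o P) by exact: integrable_restrictT.
have [mG mP] : measurable_fun setT G /\ measurable_fun setT P.
  by split; apply/measurable_EFinP; [case/integrableP: iG|case/integrableP: iP].
pose F (z : R * R) : R := G z.1 * P z.2 * (z.1 <= z.2)%R%:R.
have mF : measurable_fun setT F.
  apply: measurable_funM.
    by apply: measurable_funM; exact: measurableT_comp.
  apply: (measurableT_comp (f := fun x : bool => x%:R : R)) => //.
  exact: measurable_fun_ler.
have FE r q : F (r, q) = (G r * P q) * (r <= q)%R%:R by [].
have iF : (mu \x mu)%E.-integrable setT (EFin \o F).
  apply/integrable12ltyP; first exact/measurable_EFinP.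
  have /integrableP[_ iG'] := iG; have /integrableP[_ iP'] := iP.
  apply: (@le_lt_trans _ _ (\int[mu]_r (`|G r|%:E * \int[mu]_q `|(P q)%:E|))%E).
    apply: ge0_le_integral => //.
    - by move=> r _; exact: integral_ge0.
    - apply: (@measurable_fun_fubini_tonelli_F _ _ _ _ R mu
        (fun z => `|(F z)%:E|%E)) => [|z] //.
      by apply: measurableT_comp => //; exact/measurable_EFinP.
    - apply: emeasurable_funM; last exact: measurable_cst.
      by apply/measurable_EFinP; exact: measurableT_comp.
    - have mPn : measurable_fun setT (fun q => `|(P q)%:E|%E).
        by apply: measurableT_comp => //; exact/measurable_EFinP.
      move=> r _; rewrite -ge0_integralZl//.
      apply: ge0_le_integral => //.
      + apply: measurableT_comp => //; apply/measurable_EFinP.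
        exact: measurableT_comp mF (pair1_measurable r).
      + apply: emeasurable_funM; first exact: measurable_cst.
        by apply: measurableT_comp => //; exact/measurable_EFinP.
      + move=> q _; rewrite /= lee_fin !normrM ler_piMr ?mulr_ge0//.
        by case: (r <= q)%R; rewrite ?normr1 ?normr0.
  rewrite ge0_integralZr//; last 2 first.
    by apply/measurable_EFinP; exact: measurableT_comp.
    by apply: integral_ge0.
  rewrite lte_mul_pinfty//; first by apply: integral_ge0 => *; rewrite lee_fin.
  by rewrite ge0_fin_numE//; apply: integral_ge0 => *; rewrite lee_fin.
have L : fine (\int[mu]_r \int[mu]_q (EFin \o F) (r, q))%E =
    \int[mu]_(r in `[a, b]) (g r * \int[mu]_(q in `[r, b]) p q).
  rewrite [RHS]Rintegral_mkcond; congr fine; apply: eq_integral => r _.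
  rewrite patchE; case: ifPn => [|ra]; last first.
    by under eq_integral => q _ do rewrite /= FE /G patchE (negbTE ra) !mul0r; rewrite integral0.
  rewrite inE/= in_itv/= => /andP[ar rb].
  rewrite -RintegralZl//.
  rewrite Rintegral_mkcond /Rintegral fineK; last first.
    apply: integrable_fin_num => //; apply: integrable_restrictT => c d.
    rewrite (_ : EFin \o _ = (fun x => (g r)%:E * (p x)%:E)%E)//.
    by apply: integrableZl => //; exact: ip.
  apply: eq_integral => q _; rewrite /= FE /G /P !patchE.
  have -> : r \in [set` `[a, b]] by rewrite inE/= in_itv/= ar rb.
  case: (boolP (q \in [set` `[r, b]])).
    rewrite inE/= in_itv/= => /andP[rq qb]; rewrite mem_set/= ?in_itv/=.
      by rewrite rq mulr1.
    by rewrite (le_trans ar rq) qb.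
  rewrite notin_setE/= in_itv/= => /negP; rewrite negb_and => /orP[/negbTE ->|/negbTE qb].
    by rewrite mulr0.
  by rewrite memNset ?mulr0 ?mul0r//= in_itv/= qb andbF.
have L2 : fine (\int[mu]_q \int[mu]_r (EFin \o F) (r, q))%E =
    \int[mu]_(q in `[a, b]) (p q * \int[mu]_(r in `[a, q]) g r).
  rewrite [RHS]Rintegral_mkcond; congr fine; apply: eq_integral => q _.
  rewrite patchE; case: ifPn => [|qa]; last first.
    by under eq_integral => r _ do rewrite /= FE /P patchE (negbTE qa) mulr0 mul0r; rewrite integral0.
  rewrite inE/= in_itv/= => /andP[aq qb].
  rewrite -RintegralZl//.
  rewrite Rintegral_mkcond /Rintegral fineK; last first.
    apply: integrable_fin_num => //; apply: integrable_restrictT => c d.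
    rewrite (_ : EFin \o _ = (fun x => (p q)%:E * (g x)%:E)%E)//.
    by apply: integrableZl => //; exact: ig.
  apply: eq_integral => r _; rewrite /= FE /G /P !patchE.
  have -> : q \in [set` `[a, b]] by rewrite inE/= in_itv/= aq qb.
  case: (boolP (r \in [set` `[a, q]])).
    rewrite inE/= in_itv/= => /andP[ar rq]; rewrite mem_set/= ?in_itv/=.
      by rewrite rq mulr1 mulrC.
    by rewrite ar (le_trans rq qb).
  rewrite notin_setE/= in_itv/= => /negP; rewrite negb_and => /orP[/negbTE ar|/negbTE ->].
    by rewrite memNset ?mulr0 ?mul0r//= in_itv/= ar.
  by rewrite mulr0.
by apply: etrans (esym L2) (etrans _ L); rewrite (Fubini iF).
Qed.

(** The product rule for an absolutely continuous factor: [u] is the integral of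
[g], so the order of integration is exchanged instead of differentiating [u]. *)
Lemma prim_mul u g p p' : locint g -> prim u g -> continuous p' ->
    (forall t, is_derive t 1 p (p' t)) ->
  prim (fun t => u t * p t) (fun t => g t * p t + u t * p' t).
Proof.
move=> ig ug cp dp a b ab.
have pp' := derive_prim cp dp; have ip := continuous_locint cp.
have cu := prim_continuous ig ug; have cpp := prim_continuous ip pp'.
have cM (f h : R -> R) : continuous f -> continuous h ->
    continuous (fun t => f t * h t).
  by move=> cf ch t; apply: continuousM; [exact: cf|exact: ch].
have igp : mu.-integrable `[a, b] (EFin \o (fun t => g t * p t)).
  have [M [_ HM]] : bounded_set (p @` `[a, b]).
    apply: compact_bounded; apply: continuous_compact.
      exact: continuous_subspaceT.
    exact: segment_compact.
  apply: (@le_integrable _ _ _ mu _ _ _ (fun t => ((`|M| + 1) * g t)%:E)) => //.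
  - apply/measurable_EFinP; apply: measurable_funM.
      by apply/measurable_EFinP; case/integrableP: (ig a b).
    by apply: measurable_funTS; exact: continuous_measurable_fun.
  - move=> t tab; rewrite /= lee_fin mulrC !normrM ler_wpM2r//.
    rewrite [leRHS]ger0_norm ?addr_ge0//; apply: HM; last by exists t.
    by rewrite (le_lt_trans (ler_norm M))// ltrDl.
  - rewrite (_ : (fun t => _) = (fun t => (`|M| + 1)%:E * (g t)%:E)%E)//.
    by apply: integrableZl => //; exact: ig.
have iup : mu.-integrable `[a, b] (EFin \o (fun t => u t * p' t)).
  by apply: continuous_locint; exact: cM.
rewrite RintegralD//.
have H1 : \int[mu]_(t in `[a, b]) (u t * p' t) =
    u a * (p b - p a) +
    \int[mu]_(q in `[a, b]) (p' q * \int[mu]_(r in `[a, q]) g r).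
  rewrite (pp' _ _ ab) -RintegralZl//.
  have E0 q : a <= q -> p' q * (\int[mu]_(r in `[a, q]) g r) = u q * p' q - u a * p' q.
    by move=> aq; rewrite -ug// mulrC mulrBl.
  rewrite (@eq_Rintegral _ _ _ mu _ (fun q => u q * p' q - u a * p' q)
    (fun q => p' q * \int[mu]_(r in `[a, q]) g r)); last first.
    move=> q; rewrite inE/= in_itv/= => /andP[aq _]; exact: E0.
  have iap : mu.-integrable `[a, b] (EFin \o (fun t => u a * p' t)).
    apply: continuous_locint; apply: cM => //; exact: cst_continuous.
  by rewrite RintegralB// addrC subrK.
rewrite {}H1 Rintegral_triangle//.
rewrite (@eq_Rintegral _ _ _ mu _ (fun r => g r * p b - g r * p r)
    (fun r => g r * \int[mu]_(q in `[r, b]) p' q)); last first.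
  move=> r; rewrite inE/= in_itv/= => /andP[_ rb].
  by rewrite -pp'// mulrBr.
have igb : mu.-integrable `[a, b] (EFin \o (fun t => g t * p b)).
  rewrite (_ : _ \o _ = (fun t => (g t)%:E * (p b)%:E)%E)//.
  by apply: integrableZr => //; exact: ig.
rewrite RintegralB// RintegralZr// -ug//.
ring.
Qed.

End Primitives.

(** * Euclidean pairing and square integrability *)

Section Dot.
Variables (R : realType) (n : nat).
Implicit Types (u v w : 'cV[R]_n) (M : 'M[R]_n).

Definition dot u v : R := (u^T *m v) 0 0.

Lemma dotE u v : dot u v = \sum_i u i 0 * v i 0.
Proof. by rewrite /dot mxE; apply: eq_bigr => i _; rewrite mxE. Qed.

Lemma dotC u v : dot u v = dot v u.
Proof. by rewrite !dotE; apply: eq_bigr => i _; rewrite mulrC. Qed.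

Lemma dotDl u v w : dot (u + v) w = dot u w + dot v w.
Proof. by rewrite /dot linearD/= mulmxDl mxE. Qed.

Lemma dotDr u v w : dot w (u + v) = dot w u + dot w v.
Proof. by rewrite dotC dotDl !(dotC w). Qed.

Lemma dotZl a u v : dot (a *: u) v = a * dot u v.
Proof. by rewrite /dot linearZ/= -scalemxAl mxE. Qed.

Lemma dotZr a u v : dot u (a *: v) = a * dot u v.
Proof. by rewrite dotC dotZl dotC. Qed.

Lemma dotNl u v : dot (- u) v = - dot u v.
Proof. by rewrite -scaleN1r dotZl mulN1r. Qed.

Lemma dotNr u v : dot u (- v) = - dot u v.
Proof. by rewrite dotC dotNl dotC. Qed.

Lemma dotBr u v w : dot w (u - v) = dot w u - dot w v.
Proof. by rewrite dotDr dotNr. Qed.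

Lemma dotBl u v w : dot (u - v) w = dot u w - dot v w.
Proof. by rewrite dotDl dotNl. Qed.

Lemma dot0l v : dot 0 v = 0.
Proof. by rewrite -(scale0r 0) dotZl mul0r. Qed.

Lemma dot0r v : dot v 0 = 0.
Proof. by rewrite dotC dot0l. Qed.

Lemma dot_mull M u v : dot (M *m u) v = dot u (M^T *m v).
Proof. by rewrite /dot trmx_mul mulmxA. Qed.

Lemma dot_mulr M u v : dot u (M *m v) = dot (M^T *m u) v.
Proof. by rewrite dot_mull trmxK. Qed.

Lemma dotvv v : dot v v = enorm v ^+ 2.
Proof. by rewrite sqr_enorm dotE; apply: eq_bigr => i _; rewrite expr2. Qed.

Lemma dotvv_ge0 v : 0 <= dot v v.
Proof. by rewrite dotvv sqr_ge0. Qed.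

Lemma dotvv_eq0 v : dot v v = 0 -> v = 0.
Proof. by rewrite dotvv => /eqP; rewrite sqrf_eq0 => /eqP/enorm_eq0. Qed.

Lemma dot_ext u : (forall v, dot v u = 0) -> u = 0.
Proof. by move=> /(_ u)/dotvv_eq0. Qed.

Lemma enormN v : enorm (- v) = enorm v.
Proof. by rewrite -scaleN1r enormZ normrN1 mul1r. Qed.

Lemma dot_cs u v : `|dot u v| <= enorm u * enorm v.
Proof.
rewrite ler_norml lerNl -dotNl -(enormN u) {1}dotE dot_le/= enormN dotE.
exact: dot_le.
Qed.

Lemma coord_le_enorm v i : `|v i 0| <= enorm v.
Proof.
rewrite -(ler_pXn2r (ltn0Sn 1)) ?nnegrE ?enorm_ge0// sqr_enorm real_normK ?num_real//.
by rewrite (bigD1 i)//= lerDl sumr_ge0// => j _; exact: sqr_ge0.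
Qed.

Lemma enorm_le_coord v c : 0 <= c -> (forall i, `|v i 0| <= c) ->
  enorm v <= n%:R * c.
Proof.
move=> c0 vc; apply: (le_trans (enorm_le_sum v)).
apply: (le_trans (ler_sum _ (fun i _ => vc i))).
by rewrite sumr_const card_ord -[leLHS]mulr_natl.
Qed.

Definition mnorm m (M : 'M[R]_(m, n)) := \sum_i \sum_j `|M i j|.

Lemma mnorm_ge0 m (M : 'M[R]_(m, n)) : 0 <= mnorm M.
Proof. by apply: sumr_ge0 => i _; apply: sumr_ge0. Qed.

End Dot.

Lemma enorm_mul (R : realType) m n (M : 'M[R]_(m, n)) (v : 'cV_n) :
  enorm (M *m v) <= mnorm M * enorm v.
Proof.
apply: (le_trans (enorm_le_sum _)); rewrite mulr_suml; apply: ler_sum => i _.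
rewrite mxE (le_trans (ler_norm_sum _ _ _))// mulr_suml; apply: ler_sum => j _.
by rewrite normrM ler_wpM2l// coord_le_enorm.
Qed.

Lemma enorm_dot_bound (R : realType) n (u : 'cV[R]_n) c : 0 <= c ->
  (forall w, `|dot w u| <= c * enorm w) -> enorm u <= c.
Proof.
move=> c0 /(_ u); rewrite dotvv ger0_norm ?sqr_ge0// expr2.
have [-> _ //|u0] := eqVneq (enorm u) 0.
by rewrite ler_pM2r// lt_neqAle eq_sym u0 enorm_ge0.
Qed.

Section SquareIntegrals.
Variable R : realType.
Local Notation mu := (@lebesgue_measure R).

Lemma discr_le (P Q S : R) : 0 <= P -> 0 <= Q ->
  (forall s, 0 <= P + 2 * s * S + s ^+ 2 * Q) -> S ^+ 2 <= P * Q.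
Proof.
move=> P0 Q0 h; have [Qz|Qn] := eqVneq Q 0.
  have [->|Sn] := eqVneq S 0; first by rewrite expr0n/= mulr_ge0.
  have := h (- (P + 1) / (2 * S)).
  have -> : 2 * (- (P + 1) / (2 * S)) * S = - (P + 1) by field.
  by rewrite Qz mulr0 addr0 opprD addNKr oppr_ge0 ler10.
have Qp : 0 < Q by rewrite lt_neqAle eq_sym Qn.
have := h (- S / Q).
have -> : P + 2 * (- S / Q) * S + (- S / Q) ^+ 2 * Q = P - S ^+ 2 / Q by field.
by rewrite subr_ge0 ler_pdivrMr.
Qed.

(** The quadratic polynomial [s |-> \int dot (f + s g) (f + s g)] has no sign
change, so its discriminant is nonpositive. *)
Lemma Rintegral_cs n (D : set R) (f g : R -> 'cV[R]_n) : measurable D ->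
    mu.-integrable D (EFin \o (fun t => dot (f t) (f t))) ->
    mu.-integrable D (EFin \o (fun t => dot (g t) (g t))) ->
    mu.-integrable D (EFin \o (fun t => dot (f t) (g t))) ->
  (\int[mu]_(t in D) dot (f t) (g t)) ^+ 2 <=
  (\int[mu]_(t in D) dot (f t) (f t)) * (\int[mu]_(t in D) dot (g t) (g t)).
Proof.
move=> mD iff igg ifg; apply: discr_le.
- by apply: Rintegral_ge0 => t _; exact: dotvv_ge0.
- by apply: Rintegral_ge0 => t _; exact: dotvv_ge0.
move=> s.
have iZ (h : R -> R) c : mu.-integrable D (EFin \o h) ->
    mu.-integrable D (EFin \o (fun t => c * h t)).
  move=> ih; rewrite (_ : _ \o _ = (fun t => c%:E * (h t)%:E)%E)//.
  exact: integrableZl.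
rewrite -!RintegralZl// -!RintegralD//; try exact: iZ; last first.
  rewrite (_ : EFin \o _ =
    (EFin \o (fun t => dot (f t) (f t))) \+ (EFin \o (fun t => 2 * s * dot (f t) (g t))))//.
  by apply: integrableD => //; exact: iZ.
apply: Rintegral_ge0 => t _.
have -> : dot (f t) (f t) + 2 * s * dot (f t) (g t) + s ^+ 2 * dot (g t) (g t) =
    dot (f t + s *: g t) (f t + s *: g t).
  by rewrite !dotDl !dotDr !dotZl !dotZr (dotC (g t) (f t)); ring.
exact: dotvv_ge0.
Qed.

Lemma symmetric_itv_cover : \bigcup_k (`[- k%:R, k%:R]%classic : set R) = setT.
Proof.
apply/seteqP; split => // t _; exists (Num.bound `|t|) => //=.
by rewrite in_itv/= -ler_norml ltW// archi_boundP.
Qed.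

Lemma cvg_integral_sym (g : R -> R) : measurable_fun setT g ->
    (forall t, 0 <= g t) ->
  (\int[mu]_(t in `[(- k%:R)%R, k%:R%R]) (g t)%:E)%E @[k --> \oo] -->
  (\int[mu]_t (g t)%:E)%E.
Proof.
move=> mg g0; rewrite -symmetric_itv_cover.
apply: ge0_nondecreasing_set_cvg_integral => //.
- move=> i j ij; rewrite subsetEset; apply: subset_itv; rewrite bnd_simp.
    by rewrite lerN2 ler_nat.
  by rewrite ler_nat.
- by move=> i; apply: measurable_funTS; exact/measurable_EFinP.
- by move=> i t _; rewrite lee_fin.
Qed.

Lemma bounded_integrable (g : R -> R) C : measurable_fun setT g ->
    (forall t, 0 <= g t) -> locint g ->
    (forall k : nat, \int[mu]_(t in `[- k%:R, k%:R]) g t <= C) ->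
  mu.-integrable setT (EFin \o g).
Proof.
move=> mg g0 ig gC; apply/integrableP; split; first exact/measurable_EFinP.
apply: (@le_lt_trans _ _ C%:E); last exact: ltry.
under eq_integral => t _ do rewrite /= ger0_norm//.
apply: cvge_le (cvg_integral_sym mg g0).
near=> k; rewrite -[leLHS]fineK ?lee_fin; first exact: gC.
by apply: integrable_fin_num => //; exact: ig.
Unshelve. all: by end_near. Qed.

Lemma integrable_locint (g : R -> R) : mu.-integrable setT (EFin \o g) -> locint g.
Proof. by move=> ig a b; apply: integrableS ig. Qed.

Lemma cvg_Rintegral_sym (g : R -> R) : mu.-integrable setT (EFin \o g) ->
  \int[mu]_(t in `[- k%:R, k%:R]) g t @[k --> \oo] --> \int[mu]_t g t.
Proof.
move=> ig.
have mg : measurable_fun setT g by apply/measurable_EFinP; case/integrableP: ig.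
have pos (h : R -> R) : mu.-integrable setT (EFin \o h) -> (forall t, 0 <= h t) ->
    \int[mu]_(t in `[- k%:R, k%:R]) h t @[k --> \oo] --> \int[mu]_t h t.
  move=> ih h0; apply: fine_cvg; rewrite fineK; last exact: integrable_fin_num.
  by apply: cvg_integral_sym => //; apply/measurable_EFinP; case/integrableP: ih.
have ia : mu.-integrable setT (EFin \o (fun t => `|g t|)) by exact: integrable_norm.
have igg : mu.-integrable setT (EFin \o (fun t => g t + `|g t|)).
  rewrite (_ : _ \o _ = (EFin \o g) \+ (EFin \o (fun t => `|g t|)))//.
  exact: integrableD.
have e (D : set R) : measurable D -> \int[mu]_(t in D) g t =
    \int[mu]_(t in D) (g t + `|g t|) - \int[mu]_(t in D) `|g t|.
  move=> mD; rewrite -RintegralB//; last 2 first.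
    by apply: integrableS igg.
    by apply: integrableS ia.
  by apply: eq_Rintegral => t _; rewrite addrK.
rewrite (e setT)//.
rewrite (_ : (fun k : nat => _) = (fun k : nat =>
  \int[mu]_(t in `[- k%:R, k%:R]) (g t + `|g t|) -
  \int[mu]_(t in `[- k%:R, k%:R]) `|g t|)); last first.
  by apply/funext => k; exact: e.
apply: cvgB; last exact: pos.
by apply: pos => // t; rewrite -lerBlDr sub0r lerNnormlW.
Qed.

Lemma integral_le_T (g : R -> R) a b : mu.-integrable setT (EFin \o g) ->
    (forall t, 0 <= g t) ->
  \int[mu]_(t in `[a, b]) g t <= \int[mu]_t g t.
Proof.
move=> ig g0; apply: fine_le.
- by apply: integrable_fin_num => //; exact: integrableS ig.
- by apply: integrable_fin_num.
- apply: ge0_subset_integral => //.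
  + by case/integrableP : ig.
  + by move=> t _; rewrite lee_fin.
Qed.

Lemma tail_arith (m p x T e : R) :
  T - m < e -> 0 <= p -> m + (p + x) <= T -> x <= e.
Proof. by move=> *; lra. Qed.

(** The integral converges at both ends, and the bound [K] is uniform in the
interval, which is what the pointwise Sobolev estimate needs. *)
Lemma integral_tail (g : R -> R) e : mu.-integrable setT (EFin \o g) ->
    (forall t, 0 <= g t) -> 0 < e ->
  exists K : R, forall a b, a <= b -> K <= a \/ b <= - K ->
    \int[mu]_(t in `[a, b]) g t <= e.
Proof.
move=> ig g0 e0.
have := cvg_Rintegral_sym ig => /cvgrPdist_lt/(_ _ e0)[k _ /(_ k (leqnn k))/= hk].
have il := integrable_locint ig.
have gp c d : 0 <= \int[mu]_(t in `[c, d]) g t by apply: Rintegral_ge0.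
exists k%:R => a b ab h; have k0 : - k%:R <= k%:R :> R by rewrite ge0_cp.
have key c d : c <= d -> \int[mu]_(t in `[c, d]) g t <= \int[mu]_t g t.
  by move=> cd; exact: integral_le_T.
move: hk; rewrite ger0_norm ?subr_ge0 ?key// => hk.
case: h => h.
  have := key (- k%:R) b (le_trans k0 (le_trans h ab)).
  rewrite (@Rintegral_itv_cat _ g _ k%:R b)// ?(le_trans h)//.
  rewrite (@Rintegral_itv_cat _ g k%:R a b)//.
  exact: tail_arith hk (gp k%:R a).
have := key a k%:R (le_trans ab (le_trans h k0)).
rewrite (@Rintegral_itv_cat _ g a b k%:R)// ?(le_trans h)//.
rewrite (@Rintegral_itv_cat _ g b (- k%:R) k%:R)//.
rewrite addrA addrC (addrC (\int[mu]_(t in `[a, b]) g t)).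
exact: tail_arith hk (gp b (- k%:R)).
Qed.

Lemma locintM (g p : R -> R) : locint g -> continuous p -> locint (fun t => g t * p t).
Proof.
move=> ig cpp a b.
have [M [_ HM]] : bounded_set (p @` `[a, b]).
  apply: compact_bounded; apply: continuous_compact.
    exact: continuous_subspaceT.
  exact: segment_compact.
apply: (@le_integrable _ _ _ mu _ _ _ (fun t => ((`|M| + 1) * g t)%:E)) => //.
- apply/measurable_EFinP; apply: measurable_funM.
    by apply/measurable_EFinP; case/integrableP: (ig a b).
  by apply: measurable_funTS; exact: continuous_measurable_fun.
- move=> t tab; rewrite /= lee_fin mulrC !normrM ler_wpM2r//.
  rewrite [leRHS]ger0_norm ?addr_ge0//; apply: HM; last by exists t.
  by rewrite (le_lt_trans (ler_norm M))// ltrDl.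
- rewrite (_ : (fun t => _) = (fun t => (`|M| + 1)%:E * (g t)%:E)%E)//.
  by apply: integrableZl => //; exact: ig.
Qed.

Lemma locintD (g p : R -> R) : locint g -> locint p -> locint (fun t => g t + p t).
Proof.
move=> ig ip a b; rewrite (_ : _ \o _ = (EFin \o g) \+ (EFin \o p))//.
by apply: integrableD.
Qed.

Lemma locintZ (g : R -> R) c : locint g -> locint (fun t => c * g t).
Proof.
move=> ig a b; rewrite (_ : _ \o _ = (fun t => c%:E * (g t)%:E)%E)//.
by apply: integrableZl.
Qed.

Lemma locint0 : locint (fun=> 0 : R).
Proof. by apply: continuous_locint; exact: cst_continuous. Qed.

Lemma locint_sum (I : Type) (r : seq I) (P : pred I) (G : I -> R -> R) :
  (forall i, P i -> locint (G i)) -> locint (fun t => \sum_(i <- r | P i) G i t).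
Proof.
move=> iG; elim: r => [|i r ih].
  rewrite (_ : (fun t => _) = fun=> 0); first exact: locint0.
  by apply/funext => t; rewrite big_nil.
have [Pi|Pi] := boolP (P i).
  rewrite (_ : (fun t => _) = fun t => G i t + \sum_(i <- r | P i) G i t).
    by apply: locintD => //; exact: iG.
  by apply/funext => t; rewrite big_cons Pi.
rewrite (_ : (fun t => _) = fun t => \sum_(i <- r | P i) G i t)//.
by apply/funext => t; rewrite big_cons (negbTE Pi).
Qed.

Lemma prim0 : prim (fun=> 0 : R) (fun=> 0).
Proof. by move=> a b _; rewrite subrr /Rintegral integral0. Qed.

Lemma primD (u v u' v' : R -> R) : locint v -> locint v' -> prim u v -> prim u' v' ->
  prim (fun t => u t + u' t) (fun t => v t + v' t).
Proof.
move=> iv iv' h h' a b ab; rewrite RintegralD//.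
by rewrite -h// -h'//; ring.
Qed.

Lemma primZ c (u v : R -> R) : locint v -> prim u v ->
  prim (fun t => c * u t) (fun t => c * v t).
Proof.
by move=> iv h a b ab; rewrite RintegralZl// -h// mulrBr.
Qed.

Lemma prim_sum (I : Type) (r : seq I) (U G : I -> R -> R) :
  (forall i, locint (G i)) -> (forall i, prim (U i) (G i)) ->
  prim (fun t => \sum_(i <- r) U i t) (fun t => \sum_(i <- r) G i t).
Proof.
move=> iG pG; elim: r => [|i r ih].
  rewrite (_ : (fun t => _) = fun=> 0); last by apply/funext => t; rewrite big_nil.
  rewrite [X in prim _ X](_ : _ = fun=> 0); first exact: prim0.
  by apply/funext => t; rewrite big_nil.
rewrite (_ : (fun t => _) = fun t => U i t + \sum_(i <- r) U i t); last first.
  by apply/funext => t; rewrite big_cons.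
rewrite [X in prim _ X](_ : _ = fun t => G i t + \sum_(i <- r) G i t).
  by apply: primD => //; exact: locint_sum.
by apply/funext => t; rewrite big_cons.
Qed.

Lemma prim_eq (u u' v : R -> R) t0 : prim u v -> prim u' v -> u t0 = u' t0 ->
  u = u'.
Proof.
move=> h h' e; apply/funext => t.
case: (lerP t0 t) => [tt|/ltW tt].
  by have := etrans (h _ _ tt) (esym (h' _ _ tt)); rewrite e => /addIr.
by have := etrans (h _ _ tt) (esym (h' _ _ tt)); rewrite e => /addrI/oppr_inj.
Qed.

Lemma Lfun2P (g : R -> R) : g \in Lfun mu 2%:E <->
  measurable_fun setT g /\ mu.-integrable setT (EFin \o (fun t => g t ^+ 2)).
Proof.
split=> [h|[mg ig]].
  split; last exact: Lfun2_integrable_sqr.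
  by move: h; rewrite inE => /andP[+ _]; rewrite inE.
rewrite inE; apply/andP; split; rewrite inE//= /finite_norm unlock.
apply: poweR_lty; case/integrableP: ig => _; apply: le_lt_trans.
rewrite le_eqVlt; apply/orP; left; apply/eqP; apply: eq_integral => t _ /=.
by rewrite -[2]/(2%:R) powR_mulrn// real_normK ?num_real// ger0_norm// sqr_ge0.
Qed.

Lemma Lfun2_locint (g : R -> R) : g \in Lfun mu 2%:E -> locint g.
Proof.
move=> /Lfun2P[mg ig] a b.
apply: (@le_integrable _ _ _ mu _ _ _ (fun t => (1 + g t ^+ 2)%:E)) => //.
- by apply/measurable_EFinP; apply: measurable_funTS.
- move=> t _; rewrite /= lee_fin [leRHS]ger0_norm ?addr_ge0 ?sqr_ge0//.
  rewrite -(@real_normK _ (g t)) ?num_real//; have := normr_ge0 (g t); nra.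
- apply: (@locintD (cst 1) (fun t => g t ^+ 2)); last exact: integrable_locint.
  by apply: continuous_locint; exact: cst_continuous.
Qed.

Section Vector.
Variable n : nat.
Implicit Types f g : R -> 'cV[R]_n.

Lemma sqint_dot_integrable f g : f \in @sqint R n -> g \in @sqint R n ->
  mu.-integrable setT (EFin \o (fun t => dot (f t) (g t))).
Proof.
move=> /sqintP hf /sqintP hg.
rewrite (_ : _ \o _ = (fun t => \sum_i (f t i 0 * g t i 0)%:E)%E); last first.
  by apply/funext => t /=; rewrite dotE sumEFin.
apply: integrable_sum => // i _.
by apply/Lfun1_integrable; exact: Lfun2_mul_Lfun1.
Qed.

Lemma sqr_l2norm f : f \in @sqint R n ->
  l2norm f ^+ 2 = \int[mu]_t dot (f t) (f t).
Proof.
move=> hf.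
apply: EFin_inj; rewrite -powR_mulrn ?l2norm_ge0// -poweR_EFin l2normE//.
rewrite powR_Lnorm ?pnatr_eq0// /Rintegral fineK; last first.
  by apply: integrable_fin_num => //; exact: sqint_dot_integrable.
apply: eq_integral => t _ /=.
by rewrite -[2]/(2%:R) powR_mulrn// ger0_norm ?enorm_ge0// dotvv.
Qed.

Lemma sqintI f : (forall i, measurable_fun setT (fun t => f t i 0)) ->
  mu.-integrable setT (EFin \o (fun t => dot (f t) (f t))) -> f \in @sqint R n.
Proof.
move=> mf idf; apply/sqintP => i; apply/Lfun2P; split => //.
apply: le_integrable idf => //.
  by apply/measurable_EFinP; apply: measurable_funX; exact: mf.
move=> t _; rewrite /= lee_fin ger0_norm ?sqr_ge0// ger0_norm ?dotvv_ge0//.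
rewrite dotvv -(@real_normK _ (f t i 0)) ?num_real//.
by rewrite ler_pXn2r// ?nnegrE ?enorm_ge0// coord_le_enorm.
Qed.

End Vector.
End SquareIntegrals.

(** * Weak derivatives and primitives *)

Section WeakDerivative.
Variable R : realType.
Local Notation mu := (@lebesgue_measure R).
Implicit Types (u v w p g phi : R -> R).

Lemma Rintegral_support g a b : (forall t, ~ (a <= t <= b) -> g t = 0) ->
  \int[mu]_t g t = \int[mu]_(t in `[a, b]) g t.
Proof.
move=> g0; rewrite [RHS]Rintegral_mkcond; apply: eq_Rintegral => t _.
rewrite patchE; case: ifPn => //; rewrite notin_setE/= in_itv/= => h.
exact: g0.
Qed.

Lemma prim_constant u v : prim u v -> forall a b, a <= b ->
  (forall t, a <= t <= b -> v t = 0) -> u b = u a.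
Proof.
move=> uv a b ab v0; apply/eqP; rewrite -subr_eq0 uv//; apply/eqP.
rewrite (@eq_Rintegral _ _ _ mu _ (fun=> 0)); last first.
  by move=> t; rewrite inE/= in_itv/=; exact: v0.
by rewrite /Rintegral integral0.
Qed.

Lemma prim_le u v : prim u v -> (forall t, 0 <= v t) -> forall a b, a <= b -> u a <= u b.
Proof. by move=> uv v0 a b ab; rewrite -subr_ge0 uv// Rintegral_ge0. Qed.

Lemma integral_continuous_eq0 v a b : continuous v -> (forall t, 0 <= v t) ->
    \int[mu]_(t in `[a, b]) v t = 0 ->
  forall t, a < t < b -> v t = 0.
Proof.
move=> cv v0 vi t /andP[at_ tb].
have uv := antider_prim (continuous_locint cv); set u := antider v in uv.
have ab : a <= b by rewrite ltW// (lt_trans at_).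
have uab : u b = u a by apply/eqP; rewrite -subr_eq0 uv// vi.
have um := prim_le uv v0.
have ut (s : R) : a <= s <= b -> u s = u a.
  move=> /andP[as_ sb]; apply/eqP; rewrite eq_le (um _ _ as_) andbT -uab.
  exact: um.
have near_cst : \forall s \near t, u s = cst (u a) s.
  near=> s; rewrite /= ut//; apply/andP; split; apply: ltW; near: s.
    exact: lt_nbhsr.
  exact: lt_nbhsl.
have du := continuous_prim_derive cv uv t.
have /near_eq_derive : \forall s \near t, cst (u a) s = u s.
  by apply: filterS near_cst.
move=> /(_ 1); rewrite (@derive_val _ _ _ _ _ _ _ du) => <-.
exact: derive_cst.
Unshelve. all: by end_near. Qed.

Lemma continuousMf (f h : R -> R) : continuous f -> continuous h ->
  continuous (fun t => f t * h t).
Proof. by move=> cf ch t; apply: continuousM; [exact: cf|exact: ch]. Qed.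

Lemma test_fun_support phi : test_fun phi -> exists2 M : R, 0 < M &
  forall t, M <= `|t| -> phi t = 0 /\ derive1 phi t = 0.
Proof.
move=> [dphi cphi' cK].
have [M [_ HM]] := compact_bounded cK.
have phi0 (t : R) : `|M| + 1 < `|t| -> phi t = 0.
  move=> Mt; apply/eqP; apply: contrapT => /negP h.
  have : `|t| <= `|M| + 1.
    by apply: HM; [rewrite (le_lt_trans (ler_norm M))// ltrDl|exact: subset_closure].
  by rewrite leNgt Mt.
exists (`|M| + 2) => [|t Mt]; first by rewrite ltr_wpDl.
have Mt1 : `|M| + 1 < `|t| by apply: lt_le_trans Mt; rewrite ltrD2l ltr1n.
split; first exact: phi0.
have ot : \forall s \near t, phi s = cst 0 s.
  have : (fun s : R => `|s|) s @[s --> t] --> `|t| by apply: norm_continuous.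
  move=> /cvgr_gt/(_ _ Mt1); apply: filterS => s; exact: phi0.
by rewrite derive1E (near_eq_derive _ ot) derive_cst.
Qed.

Lemma prim_test u v phi : locint v -> prim u v -> test_fun phi ->
  \int[mu]_t (u t * derive1 phi t) = - \int[mu]_t (v t * phi t).
Proof.
move=> iv uv tphi; have [M M0 HM] := test_fun_support tphi.
have [dphi cphi' _] := tphi.
have out (t : R) : ~ (- M <= t <= M) -> M <= `|t|.
  by move=> /negP; rewrite -ler_norml -ltNge => /ltW.
have nM : M <= `|- M| /\ M <= `|M| by rewrite normrN ger0_norm ?lexx// ltW.
have dp (t : R) : is_derive t 1 phi (derive1 phi t).
  by rewrite derive1E; exact: derivableP.
have MM : - M <= M by rewrite ge0_cp// ltW.
have := prim_mul iv uv cphi' dp MM.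
rewrite (HM _ nM.1).1 (HM _ nM.2).1 !mulr0 subrr.
have cphi : continuous phi.
  by move=> t; apply: differentiable_continuous; apply/derivable1_diffP.
rewrite RintegralD//; last 2 first.
  exact: locintM.
  apply: continuous_locint; apply: continuousMf => //; exact: prim_continuous uv.
rewrite -!Rintegral_support; last 2 first.
- by move=> t /out/HM[_ ->]; rewrite mulr0.
- by move=> t /out/HM[-> _]; rewrite mulr0.
by move/esym/eqP; rewrite addrC addr_eq0 => /eqP.
Qed.

(** On [[a, b]] take a bump [p], the [p]-weighted mean [m] of [w], and as test
function a primitive of [p * (w - m)]; the choice of [m] gives it compact support,
and then [p * (w - m)^2] has integral zero. *)
Lemma weak0_constant w : continuous w ->
    (forall phi, test_fun phi -> \int[mu]_t (w t * derive1 phi t) = 0) ->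
  forall s t, w s = w t.
Proof.
move=> cw weak0.
suff H (a b : R) : a < b -> exists m, forall t, a < t < b -> w t = m.
  move=> s t.
  have [m hm] : exists m, forall r, Num.min s t - 1 < r < Num.max s t + 1 -> w r = m.
    by apply: H; rewrite (@le_lt_trans _ _ (Num.min s t))// ?gerBl// ltr_pwDr// ge_min le_max lexx.
  have ins (r : R) : Num.min s t <= r <= Num.max s t -> w r = m.
    move=> /andP[r1 r2]; apply: hm; rewrite (lt_le_trans _ r1) ?ltrBlDr ?ltrDl//=.
    by rewrite (le_lt_trans r2)// ltrDl.
  by rewrite !ins// ?ge_min ?le_max ?lexx ?orbT.
move=> ab.
pose p (t : R) : R := Num.max 0 ((t - a) * (b - t)).
have cp : continuous p.
  move=> t; apply: (@continuous_max R R (fun=> 0) (fun t => (t - a) * (b - t))).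
    exact: cst_continuous.
  apply: continuousM; first by apply: cvgB; [exact: cvg_id|exact: cvg_cst].
  by apply: cvgB; [exact: cvg_cst|exact: cvg_id].
have p0 (t : R) : 0 <= p t by rewrite le_max lexx.
have pout (t : R) : ~ (a < t < b) -> p t = 0.
  move=> h; apply/max_idPl; rewrite leNgt; apply/negP => h'; apply: h; apply/andP.
  by split; nra.
have ppos (t : R) : a < t < b -> 0 < p t.
  by move=> /andP[at_ tb]; rewrite lt_max; apply/orP; right; nra.
pose I := \int[mu]_(t in `[a, b]) p t.
have I0 : I != 0.
  apply/negP => /eqP/(integral_continuous_eq0 cp p0) h.
  have mid : a < (a + b) / 2 < b by apply/andP; split; lra.
  by have := ppos _ mid; rewrite h// ltxx.
pose m := (\int[mu]_(t in `[a, b]) (p t * w t)) / I.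
exists m.
pose g (t : R) : R := p t * (w t - m).
have cg : continuous g.
  apply: continuousMf => // t; apply: cvgB; [exact: cw|exact: cvg_cst].
have lp := continuous_locint cp.
have lpw : locint (fun t => p t * w t) by apply: continuous_locint; exact: continuousMf.
have Ig : \int[mu]_(t in `[a, b]) g t = 0.
  rewrite (@eq_Rintegral _ _ _ mu _ (fun t => p t * w t - m * p t)); last first.
    by move=> t _; rewrite /g mulrBr (mulrC _ m).
  rewrite RintegralB//; last exact: (locintZ m lp).
  by rewrite RintegralZl// /m divfK// subrr.
have Pg := antider_prim (continuous_locint cg); set P := antider g in Pg.
pose phi (t : R) : R := P t - P a.
have phig : forall t : R, is_derive t 1 phi (g t).
  move=> t; rewrite -[g t]subr0; apply: is_deriveB.
  exact: continuous_prim_derive.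
have gout (t : R) : ~ (a < t < b) -> g t = 0 by move=> /pout; rewrite /g => ->; rewrite mul0r.
have phi_out (t : R) : ~ (a <= t <= b) -> phi t = 0.
  move=> /negP; rewrite negb_and -!ltNge => /orP[ta|bt]; apply/eqP; rewrite subr_eq0.
    apply/eqP/esym; apply: (prim_constant Pg (ltW ta)) => s /andP[_ sa].
    by apply: gout; rewrite ltNge sa.
  rewrite (prim_constant Pg (ltW bt)); last first.
    by move=> s /andP[bs _]; apply: gout; rewrite [s < b]ltNge bs andbF.
  by rewrite -subr_eq0 (Pg a b (ltW ab)) Ig.
have dphi : derive1 phi = g.
  by apply/funext => t; rewrite derive1E; have [_] := phig t.
have tphi : test_fun phi.
  split; [by move=> t; have [] := phig t|by rewrite dphi|].
  apply: (@subclosed_compact _ _ `[a, b]%classic).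
  - exact: closed_closure.
  - exact: segment_compact.
  - move=> t; rewrite -[X in _ -> X]/(`[a, b]%classic t).
    have /closure_id -> : closed (`[a, b]%classic : set R) by exact: itv_closed.
    apply: closure_subset => s /= phis; rewrite in_itv/=.
    by apply: contrapT => /phi_out /eqP; rewrite (negbTE phis).
have := weak0 _ tphi; rewrite dphi.
rewrite (@Rintegral_support _ a b); last first.
  move=> t h; rewrite gout ?mulr0// => /andP[ta tb].
  by apply: h; rewrite !ltW.
have cw2 : continuous (fun t => p t * (w t - m) ^+ 2).
  have cwm : continuous (fun t => w t - m).
    by move=> t; apply: cvgB; [exact: cw|exact: cvg_cst].
  by apply: continuousMf => //; exact: (continuousMf cwm cwm).
have lwg : locint (fun t => p t * (w t - m) ^+ 2) by exact: continuous_locint.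
rewrite (@eq_Rintegral _ _ _ mu _ (fun t => p t * (w t - m) ^+ 2 + m * g t)); last first.
  by move=> t _; rewrite /g; ring.
rewrite RintegralD//; last first.
  by apply: (locintZ m); exact: continuous_locint.
rewrite RintegralZl//; last by apply: continuous_locint.
rewrite Ig mulr0 addr0 => h t tab.
have := integral_continuous_eq0 cw2 _ h tab.
have pt := ppos t tab.
move=> /(_ (fun t => mulr_ge0 (p0 t) (sqr_ge0 _)))/eqP.
by rewrite mulf_eq0 (gt_eqF pt)/= sqrf_eq0 subr_eq0 => /eqP.
Qed.

(** The difference between [u] and a primitive of its weak derivative has weak
derivative zero. *)
Lemma weak_scalar_prim u v : continuous u -> locint v ->
    (forall phi, test_fun phi ->
       \int[mu]_t (u t * derive1 phi t) = - \int[mu]_t (v t * phi t)) ->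
  prim u v.
Proof.
move=> cu iv uv.
have Uv := antider_prim iv; set U := antider v in Uv.
have cU := prim_continuous iv Uv.
have h := @weak0_constant (fun t => u t - U t).
have cuU : continuous (fun t => u t - U t) by move=> t; apply: cvgB; [exact: cu|exact: cU].
have {h}h := h cuU; move=> a b ab; rewrite -Uv//.
suff /(_ b a) : forall s t, u s - U s = u t - U t.
  by move=> /(canRL (subrK _)) ->; rewrite addrAC (addrAC (u a)) subrr add0r addrC.
apply: h => phi tphi; have [M M0 HM] := test_fun_support tphi.
have [_ cphi' _] := tphi.
have sup (z : R -> R) : \int[mu]_t (z t * derive1 phi t) =
    \int[mu]_(t in `[- M, M]) (z t * derive1 phi t).
  apply: Rintegral_support => t /negP; rewrite -ler_norml -ltNge => /ltW/HM[_ ->].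
  by rewrite mulr0.
rewrite sup (@eq_Rintegral _ _ _ mu _ (fun t => u t * derive1 phi t - U t * derive1 phi t)).
  rewrite RintegralB//; [|by apply: continuous_locint; exact: continuousMf..].
  by rewrite -!sup uv// (prim_test iv Uv tphi) subrr.
by move=> t _; rewrite mulrBl.
Qed.

End WeakDerivative.

(** * Linear differential equations *)

Lemma cvg_rsum (R : realType) (T I : Type) (F : set_system T) (FF : Filter F)
    (r : seq I) (f : I -> T -> R) (l : I -> R) :
  (forall i, f i x @[x --> F] --> l i) ->
  \sum_(i <- r) f i x @[x --> F] --> \sum_(i <- r) l i.
Proof.
move=> fl; elim: r => [|i r ih].
  by rewrite big_nil; under eq_fun do rewrite big_nil; exact: cvg_cst.
by rewrite big_cons; under eq_fun do rewrite big_cons; exact: cvgD.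
Qed.

Lemma continuous_rsum (R : realType) (T : topologicalType) (I : Type) (r : seq I)
    (f : I -> T -> R) : (forall i, continuous (f i)) ->
  continuous (fun x => \sum_(i <- r) f i x).
Proof. by move=> cf x; apply: (@cvg_rsum _ _ _ (nbhs x)) => i; exact: cf. Qed.

Section Picard.
Variable R : realType.
Local Notation mu := (@lebesgue_measure R).

Lemma geometric_limit (x : nat -> R) C :
    (forall k, `|x k.+1 - x k| <= C / 2 ^+ k) ->
  exists l, forall k, `|l - x k| <= 2 * C / 2 ^+ k.
Proof.
move=> h.
pose e k : R := 2 * C / 2 ^+ k.
have eS k : e k = C / 2 ^+ k + e k.+1.
  by rewrite /e exprS; field; rewrite expf_neq0.
have hk k : x k - C / 2 ^+ k <= x k.+1 <= x k + C / 2 ^+ k.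
  by have := h k; rewrite ler_distl.
have up i j : x (i + j)%N + e (i + j)%N <= x i + e i.
  elim: j => [|j ih]; first by rewrite addn0.
  rewrite addnS; apply: le_trans ih; have /andP[_ h1] := hk (i + j)%N.
  by rewrite (eS (i + j)%N) addrA lerD2r.
have lo i j : x i - e i <= x (i + j)%N - e (i + j)%N.
  elim: j => [|j ih]; first by rewrite addn0.
  rewrite addnS; apply: (le_trans ih); have /andP[h1 _] := hk (i + j)%N.
  by rewrite (eS (i + j)%N) opprD addrA lerD2r.
have C0 : 0 <= C by have := h 0%N; rewrite expr0 divr1; apply: le_trans.
have e0 k : 0 <= e k by rewrite /e divr_ge0// ?mulr_ge0// exprn_ge0.
have lu i j : x i - e i <= x j + e j.
  apply: (le_trans (lo i j)); rewrite addnC; apply: le_trans (up j i).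
  by rewrite lerD2l (le_trans _ (e0 _))// oppr_le0.
pose A := range (fun k => x k - e k).
have A0 : A !=set0 by exists (x 0%N - e 0%N), 0%N.
have Aub j : ubound A (x j + e j) by move=> _ [i _ <-]; exact: lu.
exists (sup A) => k; rewrite ler_distl.
apply/andP; split; first by apply: ub_le_sup; [exists (x 0%N + e 0%N)|exists k].
by apply: ge_sup.
Qed.

Lemma geometric_eq0 (x C : R) : (forall k, `|x| <= C / 2 ^+ k) -> x = 0.
Proof.
move=> h; apply/eqP; rewrite -normr_le0 leNgt; apply/negP => x0.
have C0 : 0 <= C by have := h 0%N; rewrite expr0 divr1; apply: le_trans.
have := h (Num.bound (C / `|x|)); rewrite leNgt => /negP; apply.
rewrite ltr_pdivrMr ?exprn_gt0//.
by rewrite mulrC -ltr_pdivrMr//; apply: upper_nthrootP.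
Qed.

Lemma prim_dist_le (u v U V : R -> R) a b : locint v -> locint V ->
    prim u v -> prim U V -> a <= b ->
    (forall t, a <= t <= b -> `|v t| <= V t) ->
  `|u b - u a| <= U b - U a.
Proof.
move=> iv iV uv UV ab vV; rewrite uv// UV//.
apply: (le_trans (le_normr_Rintegral _ _)) => //.
by apply: le_Rintegral => //; apply: integrable_norm.
Qed.

Section Weight.
Variable L : R.
Hypothesis L0 : 0 < L.

(** Weighting by [weight L] makes the Picard operator a contraction on a whole
bounded interval, in both directions of time at once. *)
Definition weight t := expR (L * t) + expR (- L * t).

Lemma weight_ge1 t : 1 <= weight t.
Proof.
case: (lerP 0 t) => t0.
  by rewrite ler_wpDr ?expR_ge0// -expR0 ler_expR mulr_ge0// ltW.
by rewrite ler_wpDl ?expR_ge0// -expR0 ler_expR mulNr -mulrN mulr_ge0// ?ltW// oppr_gt0.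
Qed.

Lemma is_derive_expRM (c t : R) : is_derive t 1 (fun s => expR (c * s)) (c * expR (c * t)).
Proof.
have h : is_derive t 1 (fun s => c * s) c.
  rewrite -[X in is_derive _ _ _ X]mulr1.
  by apply: is_deriveZ.
by rewrite mulrC; apply: (@is_derive1_comp R expR (fun s => c * s)).
Qed.

Lemma continuous_expRM (c : R) : continuous (fun s => expR (c * s)).
Proof.
move=> t; apply: differentiable_continuous; apply/derivable1_diffP.
by have [] := is_derive_expRM c t.
Qed.

Lemma continuous_weight : continuous weight.
Proof. by move=> t; apply: cvgD; exact: continuous_expRM. Qed.

Lemma weight_prim K : prim (fun t => K / L * (expR (L * t) - expR (- L * t)))
  (fun t => K * weight t).
Proof.
apply: derive_prim.
  by move=> t; apply: cvgM; [exact: cvg_cst|exact: continuous_weight].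
move=> t; rewrite [X in is_derive _ _ _ X](_ : _ =
    K / L * (L * expR (L * t) - - L * expR (- L * t))); last first.
  by rewrite /weight; field; exact: lt0r_neq0.
by apply: is_deriveZ; apply: is_deriveB; exact: is_derive_expRM.
Qed.

Lemma antider_weight (v : R -> R) K b : locint v -> 0 <= K ->
    (forall s, `|s| <= b -> `|v s| <= K * weight s) ->
  forall t, `|t| <= b -> `|antider v t| <= K / L * weight t.
Proof.
move=> iv K0 vK t tb; rewrite -[antider v t]subr0 -(antider0 v).
have uv := antider_prim iv.
have iK : locint (fun t => K * weight t).
  apply: continuous_locint => s; apply: cvgM; first exact: cvg_cst.
  exact: continuous_weight.
have KL : 0 <= K / L by rewrite divr_ge0// ltW.
case: (lerP 0 t) => t0.
  apply: (le_trans (prim_dist_le iv iK uv (weight_prim K) t0 _)).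
    move=> s /andP[s0 st]; apply: vK; rewrite ger0_norm//.
    by rewrite (le_trans st)// -(ger0_norm t0).
  rewrite !mulr0 subrr mulr0 subr0 ler_wpM2l// lerD2l.
  by rewrite (le_trans _ (expR_ge0 _))// oppr_le0 expR_ge0.
rewrite distrC; apply: (le_trans (prim_dist_le iv iK uv (weight_prim K) (ltW t0) _)).
  move=> s /andP[st s0]; apply: vK; rewrite ler0_norm// (le_trans _ tb)//.
  by rewrite ltr0_norm// lerN2.
rewrite !mulr0 subrr mulr0 sub0r -mulrN ler_wpM2l// opprB addrC lerD2r.
by rewrite (le_trans _ (expR_ge0 _))// oppr_le0 expR_ge0.
Qed.

End Weight.

Section LinearODE.
Variables (n : nat) (B : R -> 'M[R]_n).
Hypothesis cB : forall i j, continuous (fun t => B t i j).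

Fixpoint picard k : R -> 'M[R]_n := if k is k'.+1 then
  fun t => 1%:M + \matrix_(i, j) antider (fun s => (B s *m picard k' s) i j) t
  else fun=> 1%:M.

Lemma continuous_mulmx_coord (Y : R -> 'M[R]_n) i j :
  (forall i j, continuous (fun t => Y t i j)) ->
  continuous (fun t => (B t *m Y t) i j).
Proof.
move=> cY; rewrite (_ : (fun t => _) = fun t => \sum_l B t i l * Y t l j).
  move=> t; apply: cvg_rsum => l; apply: cvgM; [exact: cB|exact: cY].
by apply/funext => t; rewrite mxE.
Qed.

Lemma picard_continuous k i j : continuous (fun t => picard k t i j).
Proof.
elim: k i j => [|k ih] i j /=; first by move=> t; exact: cvg_cst.
have iv := continuous_locint (continuous_mulmx_coord (i := i) (j := j) ih).
rewrite (_ : (fun t => _) = fun t => (1%:M : 'M[R]_n) i j +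
    antider (fun s => (B s *m picard k s) i j) t).
  move=> t; apply: cvgD; first exact: cvg_cst.
  exact: (prim_continuous iv (antider_prim iv)).
by apply/funext => t; rewrite !mxE.
Qed.

Lemma picard_prim k i j : prim (fun t => picard k.+1 t i j)
  (fun t => (B t *m picard k t) i j).
Proof.
move=> a b ab /=; rewrite !mxE opprD addrACA subrr add0r.
apply: (antider_prim _ ab); apply: continuous_locint.
by apply: continuous_mulmx_coord => i' j'; exact: picard_continuous.
Qed.

Lemma bounded_coef b : exists2 c, 0 < c &
  forall t, `|t| <= b -> mnorm (B t) <= c.
Proof.
have cm : continuous (fun t => mnorm (B t)).
  move=> t; apply: cvg_rsum => i; apply: cvg_rsum => j.
  by apply: cvg_norm; exact: cB.
have [M [_ HM]] : bounded_set ((fun t => mnorm (B t)) @` `[- b, b]).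
  apply: compact_bounded; apply: continuous_compact.
    exact: continuous_subspaceT.
  exact: segment_compact.
exists (`|M| + 1) => [|t tb]; first by rewrite ltr_wpDl.
rewrite -[leLHS]ger0_norm ?mnorm_ge0//; apply: HM.
  by rewrite (le_lt_trans (ler_norm M))// ltrDl.
by exists t => //=; rewrite in_itv/= -ler_norml.
Qed.

Lemma mulmx_coord_le (M Y : 'M[R]_n) c i j : (forall i j, `|Y i j| <= c) ->
  `|(M *m Y) i j| <= mnorm M * c.
Proof.
move=> Yc; have c0 : 0 <= c := le_trans (normr_ge0 _) (Yc i j).
rewrite mxE (le_trans (ler_norm_sum _ _ _))//.
apply: (@le_trans _ _ (\sum_l `|M i l| * c)).
  by apply: ler_sum => l _; rewrite normrM ler_wpM2l.
rewrite -mulr_suml ler_wpM2r// /mnorm [leRHS](bigD1 i)//= lerDl.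
by apply: sumr_ge0 => l _; exact: sumr_ge0.
Qed.

Lemma picard_step b : exists2 L, 0 < L & forall k t, `|t| <= b -> forall i j,
  `|picard k.+1 t i j - picard k t i j| <= weight L t / 2 ^+ k.
Proof.
have [c c0 hc] := bounded_coef b.
have L0 : 0 < 2 * c by rewrite mulr_gt0.
exists (2 * c) => //; elim=> [|k ih] t tb i j.
  rewrite expr0 divr1 /= [X in `|X - _|]mxE addrAC subrr add0r mxE.
  have iB : locint (fun s => (B s *m 1%:M) i j).
    by apply: continuous_locint; apply: continuous_mulmx_coord => i' j' s; exact: cvg_cst.
  apply: (le_trans (antider_weight L0 (K := c) iB (ltW c0) _ tb)).
    move=> s sb; apply: (le_trans (mulmx_coord_le (c := 1) _ _ _ _)).
      by move=> i' j'; rewrite mxE; case: (_ == _); rewrite ?normr1 ?normr0.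
    rewrite mulr1 (le_trans (hc _ sb))// ler_peMr// ?(ltW c0)//; exact: weight_ge1.
  rewrite ler_piMl//; first by rewrite (le_trans ler01)// weight_ge1.
  by rewrite invfM mulrCA mulfV ?gt_eqF// mulr1 invf_le1// ler1n.
pose v s := (B s *m (picard k.+1 s - picard k s)) i j.
have ivk m : locint (fun s => (B s *m picard m s) i j).
  apply: continuous_locint; apply: continuous_mulmx_coord => i' j'.
  exact: picard_continuous.
have iv : locint v.
  rewrite (_ : v = fun s => (B s *m picard k.+1 s) i j + (-1) * (B s *m picard k s) i j).
    by apply: locintD => //; exact: locintZ.
  by apply/funext => s; rewrite /v mulmxBr !mxE mulN1r.
have -> : picard k.+2 t i j - picard k.+1 t i j = antider v t.
  have h : prim (fun t => picard k.+2 t i j + (-1) * picard k.+1 t i j) v.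
    rewrite (_ : v = fun s => (B s *m picard k.+1 s) i j + (-1) * (B s *m picard k s) i j).
      apply: primD => //; first exact: locintZ.
        exact: picard_prim.
      by apply: primZ => //; exact: picard_prim.
    by apply/funext => s; rewrite /v mulmxBr !mxE mulN1r.
  have := @prim_eq _ _ _ v 0 h (antider_prim iv).
  rewrite antider0 => /(_ _)/(congr1 (@^~ t)) <-; first by rewrite mulN1r.
  by rewrite /= !mxE !antider0 addr0 mulN1r subrr.
have K0 : 0 <= c / 2 ^+ k by rewrite divr_ge0 ?exprn_ge0// ltW.
apply: (le_trans (antider_weight L0 (K := c / 2 ^+ k) iv K0 _ tb)).
  move=> s sb; have ihs i' j' : `|(picard k.+1 s - picard k s) i' j'| <= weight (2 * c) s / 2 ^+ k.
    by rewrite [X in `|X|]mxE [X in _ + X]mxE; exact: ih.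
  apply: (le_trans (mulmx_coord_le _ _ _ ihs)).
  rewrite mulrAC -mulrA ler_wpM2r ?hc//.
  by rewrite mulr_ge0// ?invr_ge0 ?exprn_ge0// (le_trans ler01)// weight_ge1.
rewrite mulrC ler_wpM2l//; first by rewrite (le_trans ler01)// weight_ge1.
rewrite exprS le_eqVlt; apply/orP; left; apply/eqP.
by field; rewrite expf_neq0//= gt_eqF.
Qed.

Definition ode_flow t : 'M[R]_n :=
  \matrix_(i, j) lim (picard k t i j @[k --> \oo]).

Lemma ode_flow_near b : exists C, forall k t, `|t| <= b -> forall i j,
  `|ode_flow t i j - picard k t i j| <= C / 2 ^+ k.
Proof.
have [L L0 hL] := picard_step b.
exists (2 * (expR (L * b) + expR (L * b))) => k t tb i j.
have hx k' := hL k' t tb i j.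
have [l hl] := geometric_limit hx.
have -> : ode_flow t i j = l.
  rewrite mxE; apply/cvg_lim => //; apply/cvgrPdist_le => e e0.
  pose m := Num.bound (2 * weight L t / e).
  exists m => //= k' mk'; apply: (le_trans (hl k')).
  rewrite ler_pdivrMr ?exprn_gt0// [leRHS]mulrC -ler_pdivrMr// ltW//.
  exact: upper_nthrootP.
apply: (le_trans (hl k)); rewrite ler_wpM2r ?invr_ge0 ?exprn_ge0//.
rewrite ler_wpM2l//; move: tb; rewrite ler_norml => /andP[tb1 tb2].
rewrite /weight lerD// ler_expR.
  by rewrite ler_pM2l.
by rewrite mulNr -mulrN ler_pM2l// lerNl.
Qed.

Lemma ode_flow_continuous i j : continuous (fun t => ode_flow t i j).
Proof.
move=> t; apply/cvgrPdist_le => e e0.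
have [C hC] := ode_flow_near (`|t| + 1).
pose k := Num.bound (C / (e / 3)).
have e3 : 0 < e / 3 by rewrite divr_gt0.
have kC : C / 2 ^+ k <= e / 3.
  rewrite ler_pdivrMr ?exprn_gt0// [leRHS]mulrC -ler_pdivrMr// ltW//.
  exact: upper_nthrootP.
have := @picard_continuous k i j t => /cvgrPdist_le/(_ _ e3) h.
have h1 : \forall s \near t, `|t - s| <= 1.
  by have /cvgrPdist_le/(_ 1 ltr01) : s @[s --> t] --> t by exact: cvg_id.
near=> s.
have s1 : `|s| <= `|t| + 1.
  by rewrite -lerBlDl (le_trans (lerB_dist _ _))// distrC; near: s.
have t1 : `|t| <= `|t| + 1 by rewrite lerDl.
have -> : ode_flow t i j - ode_flow s i j =
    (ode_flow t i j - picard k t i j) + ((picard k t i j - picard k s i j) +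
    (picard k s i j - ode_flow s i j)) by ring.
rewrite (_ : e = e / 3 + (e / 3 + e / 3)); last by field.
apply: (le_trans (ler_normD _ _)); apply: lerD.
  exact: le_trans (hC _ _ t1 _ _) kC.
apply: (le_trans (ler_normD _ _)); apply: lerD; first by near: s.
by rewrite distrC; exact: le_trans (hC _ _ s1 _ _) kC.
Unshelve. all: by end_near. Qed.

Lemma ode_flow_prim i j : prim (fun t => ode_flow t i j)
  (fun t => (B t *m ode_flow t) i j).
Proof.
move=> a b ab; apply/eqP; rewrite -subr_eq0; apply/eqP.
pose r := `|a| + `|b|.
have inr t : a <= t <= b -> `|t| <= r.
  move=> /andP[ta tb]; rewrite /r; case: (lerP 0 t) => t0.
    by apply: ler_wpDl => //; rewrite ger0_norm// (le_trans tb (ler_norm b)).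
  apply: ler_wpDr => //; rewrite ltr0_norm// -(normrN a).
  by rewrite (le_trans _ (ler_norm (- a))) ?lerN2.
have [C hC] := ode_flow_near r; have [c c0 hc] := bounded_coef r.
have lf : locint (fun t => (B t *m ode_flow t) i j).
  apply: continuous_locint; apply: continuous_mulmx_coord => i' j'.
  exact: ode_flow_continuous.
have lp k : locint (fun t => (B t *m picard k t) i j).
  apply: continuous_locint; apply: continuous_mulmx_coord => i' j'.
  exact: picard_continuous.
have [ra rb] : `|a| <= r /\ `|b| <= r by split; apply: inr; rewrite ab lexx.
have C0 : 0 <= C.
  by have := le_trans (normr_ge0 _) (hC 0%N _ ra i j); rewrite expr0 divr1.
apply: (@geometric_eq0 _ (C + C + c * C * (b - a))) => k.
have := picard_prim k i j ab => /eqP; rewrite -subr_eq0 => /eqP hk.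
set D := (X in `|X|).
pose I1 := \int[mu]_(t in `[a, b]) (B t *m ode_flow t) i j.
pose I2 := \int[mu]_(t in `[a, b]) (B t *m picard k t) i j.
have hI : `|I1 - I2| <= c * (C / 2 ^+ k) * (b - a).
  rewrite /I1 /I2 -RintegralB//; last exact: lp.
  have ld : locint (fun t => (B t *m ode_flow t) i j + (-1) * (B t *m picard k t) i j).
    by apply: locintD => //; exact: locintZ.
  apply: (@le_trans _ _ (\int[mu]_(t in `[a, b]) (cst (c * (C / 2 ^+ k)) t))).
    apply: (le_trans (le_normr_Rintegral _ _)) => //.
      rewrite (_ : _ \o _ = EFin \o (fun t => (B t *m ode_flow t) i j + (-1) * (B t *m picard k t) i j)).
        exact: ld.
      by apply/funext => t /=; rewrite mulN1r.
    apply: le_Rintegral => //.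
    - apply: integrable_norm => //.
      rewrite (_ : _ \o _ = EFin \o (fun t => (B t *m ode_flow t) i j + (-1) * (B t *m picard k t) i j)).
        exact: ld.
      by apply/funext => t /=; rewrite mulN1r.
    - by apply: continuous_locint; exact: cst_continuous.
    - move=> t /=; rewrite in_itv/= => /inr tr.
      rewrite (_ : _ - _ = (B t *m (ode_flow t - picard k t)) i j).
        apply: (le_trans (mulmx_coord_le (c := C / 2 ^+ k) _ _ _ _)).
          by move=> i' j'; rewrite [X in `|X|]mxE [X in _ + X]mxE; exact: hC.
        by rewrite ler_wpM2r ?hc// divr_ge0 ?exprn_ge0.
      by rewrite mulmxBr !mxE.
  rewrite Rintegral_cst//= lebesgue_measure_itv/= lte_fin.
  move: ab; rewrite le_eqVlt => /predU1P[->|ab]; first by rewrite ltxx mulr0 subrr mulr0.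
  by rewrite ab.
have DE : D = (ode_flow b i j - picard k.+1 b i j) +
    ((picard k.+1 a i j - ode_flow a i j) - (I1 - I2)).
  rewrite -[D]subr0 -[X in D - X]hk /D -/I1 -/I2.
  clear hI; by move: I1 I2 (picard _ _ _ _) (picard _ _ _ _) (ode_flow _ _ _) (ode_flow _ _ _) => *; ring.
clearbody D; rewrite {}DE.
have C2 : C / 2 ^+ k.+1 <= C / 2 ^+ k.
  by rewrite ler_wpM2l// lef_pV2 ?posrE ?exprn_gt0// ler_eXn2l ?ltr1n.
apply: (le_trans (ler_normD _ _)); rewrite !mulrDl -[leRHS]addrA; apply: lerD.
  exact: le_trans (hC _ _ rb _ _) C2.
rewrite (le_trans (ler_normB _ _))//; apply: lerD.
  by rewrite distrC; exact: le_trans (hC _ _ ra _ _) C2.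
by rewrite (le_trans hI)// !mulrA mulrAC.
Qed.

Lemma ode_flow0 : ode_flow 0 = 1%:M.
Proof.
apply/matrixP => i j; rewrite mxE; apply/cvg_lim => //.
rewrite (_ : (fun k => _) = fun=> (1%:M : 'M[R]_n) i j); first exact: cvg_cst.
by apply/funext => -[|k] //=; rewrite !mxE antider0 addr0.
Qed.

End LinearODE.

(** The limit of the Picard iterates satisfies the integral equation, and its
integrand is continuous. *)
Lemma linear_ode_ex n (B : R -> 'M[R]_n) :
    (forall i j, continuous (fun t => B t i j)) ->
  exists X : R -> 'M[R]_n, X 0 = 1%:M /\
    forall (t : R) i j, is_derive t 1 (fun s => X s i j) ((B t *m X t) i j).
Proof.
move=> cB; exists (ode_flow B); split; first exact: ode_flow0.
move=> t i j.
apply: (@continuous_prim_derive _ _ (fun s => (B s *m ode_flow B s) i j)).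
  by apply: continuous_mulmx_coord => // i' j'; exact: ode_flow_continuous.
exact: ode_flow_prim.
Qed.

End Picard.

(** * Linear Hamiltonian systems *)

Section Hamiltonian.
Variables (R : realType) (n : nat).
Local Notation mu := (@lebesgue_measure R).
Local Notation V := ('cV[R]_n).
Implicit Types (A : R -> 'M[R]_n) (u f p : R -> V).

Definition vcont u := forall i, continuous (fun t => u t i 0).
Definition vloc f := forall i, locint (fun t => f t i 0).

Definition mcont A := forall i j, continuous (fun t => A t i j).

Lemma vcont_vloc u : vcont u -> vloc u.
Proof. by move=> cu i; exact: continuous_locint. Qed.

Lemma continuous_dot u p : vcont u -> vcont p -> continuous (fun t => dot (u t) (p t)).
Proof.
move=> cu cp; rewrite (_ : (fun t => _) = fun t => \sum_i u t i 0 * p t i 0).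
  by move=> t; apply: cvg_rsum => i; apply: cvgM; [exact: cu|exact: cp].
by apply/funext => t; rewrite dotE.
Qed.

Lemma vcont_mulmx A u : mcont A -> vcont u -> vcont (fun t => A t *m u t).
Proof.
move=> cA cu i; rewrite (_ : (fun t => _) = fun t => \sum_j A t i j * u t j 0).
  by move=> t; apply: cvg_rsum => j; apply: cvgM; [exact: cA|exact: cu].
by apply/funext => t; rewrite mxE.
Qed.

Lemma mcont_cst (M : 'M[R]_n) : mcont (fun=> M).
Proof. by move=> i j t; exact: cvg_cst. Qed.

Lemma vcont_cst (v : V) : vcont (fun=> v).
Proof. by move=> i t; exact: cvg_cst. Qed.

Lemma vcontD u p : vcont u -> vcont p -> vcont (fun t => u t + p t).
Proof.
move=> cu cp i; under eq_fun do rewrite mxE.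
by move=> t; apply: cvgD; [exact: cu|exact: cp].
Qed.

Lemma mcontB A A' : mcont A -> mcont A' -> mcont (fun t => A t - A' t).
Proof.
move=> cA cA' i j; rewrite (_ : (fun t => _) = fun t => A t i j - A' t i j).
  by move=> t; apply: cvgB; [exact: cA|exact: cA'].
by apply/funext => t; rewrite !mxE.
Qed.

Lemma vlocD f p : vloc f -> vloc p -> vloc (fun t => f t + p t).
Proof.
move=> cf cp i; rewrite (_ : (fun t => _) = fun t => f t i 0 + p t i 0).
  exact: locintD.
by apply/funext => t; rewrite mxE.
Qed.

Lemma vloc_mulmx (M : 'M[R]_n) f : vloc f -> vloc (fun t => M *m f t).
Proof.
move=> vf i; rewrite (_ : (fun t => _) = fun t => \sum_j M i j * f t j 0).
  by apply: locint_sum => j _; exact: locintZ.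
by apply/funext => t; rewrite mxE.
Qed.

Lemma vlocN f : vloc f -> vloc (fun t => - f t).
Proof.
move=> vf; rewrite (_ : (fun t => _) = fun t => (-1)%:M *m f t).
  exact: vloc_mulmx.
by apply/funext => t; rewrite mul_scalar_mx scaleN1r.
Qed.

Lemma locint_dot u f : vcont u -> vloc f -> locint (fun t => dot (u t) (f t)).
Proof.
move=> cu vf; rewrite (_ : (fun t => _) = fun t => \sum_i f t i 0 * u t i 0).
  by apply: locint_sum => i _; exact: locintM.
by apply/funext => t; rewrite dotC dotE.
Qed.

Definition energy f s t : R := Num.sqrt (\int[mu]_(r in `[s, t]) dot (f r) (f r)).

Definition sqloc f := vloc f /\ locint (fun t => dot (f t) (f t)).

Lemma energy_ge0 f s t : 0 <= energy f s t. Proof. exact: sqrtr_ge0. Qed.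

Lemma sqr_energy f s t : energy f s t ^+ 2 = \int[mu]_(r in `[s, t]) dot (f r) (f r).
Proof. by rewrite sqr_sqrtr// Rintegral_ge0// => r _; exact: dotvv_ge0. Qed.

Lemma vcont_sqloc u : vcont u -> sqloc u.
Proof.
by move=> cu; split; [exact: vcont_vloc|apply: continuous_locint; exact: continuous_dot].
Qed.

Lemma sqint_sqloc f : f \in @sqint R n -> sqloc f.
Proof.
move=> hf; split; first by move=> i; apply: Lfun2_locint; exact: (sqintP _ hf).
by apply: integrable_locint; exact: sqint_dot_integrable.
Qed.

Lemma sqloc_ae_dot f p : sqloc f -> sqloc p -> locint (fun t => dot (f t) (p t)).
Proof.
move=> [vf df] [vp dp] a b.
apply: (@le_integrable _ _ _ mu _ _ _
  (fun t => (dot (f t) (f t) + dot (p t) (p t))%:E)) => //.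
- apply/measurable_EFinP.
  rewrite (_ : (fun t => _) = fun t => \sum_i f t i 0 * p t i 0); last first.
    by apply/funext => t; rewrite dotE.
  apply: measurable_sum => i; apply: measurable_funM.
    by apply/measurable_EFinP; case/integrableP: (vf i a b).
  by apply/measurable_EFinP; case/integrableP: (vp i a b).
- move=> t _; rewrite /= lee_fin [leRHS]ger0_norm ?addr_ge0 ?dotvv_ge0//.
  rewrite (le_trans (dot_cs _ _))// !dotvv.
  by have := sqr_ge0 (enorm (f t) - enorm (p t)); nra.
- exact: locintD.
Qed.

Lemma sqlocD f p : sqloc f -> sqloc p -> sqloc (fun t => f t + p t).
Proof.
move=> hf hp; split; first by apply: vlocD; [case: hf|case: hp].
rewrite (_ : (fun t => _) = fun t => (dot (f t) (f t) + dot (p t) (p t)) + 2 * dot (f t) (p t)).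
  apply: locintD; first by apply: locintD; [case: hf|case: hp].
  by apply: locintZ; exact: sqloc_ae_dot.
by apply/funext => t; rewrite !dotDl !dotDr (dotC (p t) (f t)); ring.
Qed.

Lemma Rintegral_dot_le u f c s t : vcont u -> sqloc f -> 0 <= c -> s <= t ->
    (forall r, s <= r <= t -> enorm (u r) <= c) ->
  `|\int[mu]_(r in `[s, t]) dot (u r) (f r)| <= c * Num.sqrt (t - s) * energy f s t.
Proof.
move=> cu [vf df] c0 st uc.
rewrite -(ler_pXn2r (ltn0Sn 1)) ?nnegrE ?mulr_ge0 ?sqrtr_ge0//.
rewrite real_normK ?num_real// !exprMn sqr_sqrtr ?subr_ge0// sqr_energy.
have iu : locint (fun t => dot (u t) (u t)).
  by apply: continuous_locint; exact: continuous_dot.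
apply: (le_trans (Rintegral_cs _ _ _ _)) => //; first exact: locint_dot.
apply: ler_wpM2r; first by apply: Rintegral_ge0 => r _; exact: dotvv_ge0.
apply: (@le_trans _ _ (\int[mu]_(r in `[s, t]) (cst (c ^+ 2) r))).
  apply: le_Rintegral => //; first by apply: continuous_locint; exact: cst_continuous.
  move=> r /=; rewrite in_itv/= => rst.
  by rewrite dotvv ler_pXn2r ?nnegrE ?enorm_ge0//; exact: uc.
rewrite Rintegral_cst//= lebesgue_measure_itv/= lte_fin.
by move: st; rewrite le_eqVlt => /predU1P[->|->//]; rewrite ltxx subrr.
Qed.

Lemma energy_le f c s t : 0 <= c -> s <= t -> locint (fun t => dot (f t) (f t)) ->
    (forall r, s <= r <= t -> enorm (f r) <= c) ->
  energy f s t <= c * Num.sqrt (t - s).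
Proof.
move=> c0 st df fc; rewrite -(ler_pXn2r (ltn0Sn 1)) ?nnegrE ?mulr_ge0 ?sqrtr_ge0//.
rewrite exprMn sqr_energy sqr_sqrtr ?subr_ge0//.
apply: (@le_trans _ _ (\int[mu]_(r in `[s, t]) (cst (c ^+ 2) r))).
  apply: le_Rintegral => //; first by apply: continuous_locint; exact: cst_continuous.
  move=> r /=; rewrite in_itv/= => rst.
  by rewrite dotvv ler_pXn2r ?nnegrE ?enorm_ge0//; exact: fc.
rewrite Rintegral_cst//= lebesgue_measure_itv/= lte_fin.
by move: st; rewrite le_eqVlt => /predU1P[->|->//]; rewrite ltxx subrr.
Qed.

Variable J : 'M[R]_n.
Hypotheses (JT : J^T = - J) (JJ : J *m J = - 1%:M).

(** Integrated form of [J u' - A u = f], using that the inverse of [J] is [- J]; the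
inhomogeneity need only be locally integrable. *)
Definition sol A u f := vcont u /\ forall i, prim (fun t => u t i 0)
  (fun t => (- (J *m (A t *m u t + f t))) i 0).

Definition hsol A p := forall (t : R) i,
  is_derive t 1 (fun s => p s i 0) ((- (J *m (A t *m p t))) i 0).

Lemma hsol_vcont A p : hsol A p -> vcont p.
Proof.
move=> hp i t; apply: differentiable_continuous; apply/derivable1_diffP.
by have [] := hp t i.
Qed.

Lemma vcont_rhs A p : mcont A -> vcont p -> vcont (fun t => - (J *m (A t *m p t))).
Proof.
move=> cA cp; rewrite (_ : (fun t => _) = fun t => (- J) *m (A t *m p t)).
  by apply: vcont_mulmx; [exact: mcont_cst|exact: vcont_mulmx].
by apply/funext => t; rewrite mulNmx.
Qed.

Lemma hsol_sol A p : mcont A -> hsol A p -> sol A p (fun=> 0).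
Proof.
move=> cA hp; split; first exact: hsol_vcont hp.
move=> i; apply: derive_prim => [|t]; rewrite ?addr0; last exact: hp.
under eq_fun do rewrite addr0; apply: vcont_rhs => //; exact: hsol_vcont hp.
Qed.

(** A change of the coefficient is absorbed in the inhomogeneity; this is how a
solution is compared with the periodic limit system. *)
Lemma sol_change A A' u f : sol A u f ->
  sol A' u (fun t => f t + (A t - A' t) *m u t).
Proof.
move=> [cu hu]; split => // i.
have -> : (fun t => (- (J *m (A' t *m u t + (f t + (A t - A' t) *m u t)))) i 0) =
    (fun t => (- (J *m (A t *m u t + f t))) i 0); last exact: hu.
apply/funext => t; congr ((- (J *m _)) i 0).
by rewrite mulmxBl [f t + _]addrC addrA subrKC.
Qed.

Lemma JK (v : V) : J *m (J *m v) = - v.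
Proof. by rewrite mulmxA JJ mulNmx mul1mx. Qed.

Lemma dotJJ (v w : V) : dot (J *m v) (J *m w) = dot v w.
Proof. by rewrite dot_mull JT mulNmx JK opprK. Qed.

Lemma enormJ (v : V) : enorm (J *m v) = enorm v.
Proof.
apply/eqP; rewrite -(eqrXn2 (n := 2))// ?enorm_ge0//.
by rewrite -!dotvv dotJJ.
Qed.

(** The symmetry of [A] and the antisymmetry of [J] cancel the contribution of [A]:
only the inhomogeneity changes the symplectic pairing with a homogeneous solution.
Most of what is proved about solutions is read off from this identity. *)
Lemma green A p u f : (forall t, (A t)^T = A t) -> mcont A -> vloc f ->
    hsol A p -> sol A u f ->
  prim (fun t => dot (p t) (J *m u t)) (fun t => dot (p t) (f t)).
Proof.
move=> sA cA vf hp [cu hu]; have cp := hsol_vcont hp.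
pose g t := - (J *m (A t *m u t + f t)); pose p' t := - (J *m (A t *m p t)).
have vg : vloc g.
  apply: vlocN; apply: vloc_mulmx; apply: vlocD => //.
  by apply: vcont_vloc; exact: vcont_mulmx.
have cp' : vcont p' by exact: vcont_rhs.
have H i j : prim (fun t => u t j 0 * p t i 0)
    (fun t => g t j 0 * p t i 0 + u t j 0 * p' t i 0).
  by apply: prim_mul.
have L i j : locint (fun t => g t j 0 * p t i 0 + u t j 0 * p' t i 0).
  apply: locintD; first by apply: locintM; [exact: vg|exact: cp].
  by apply: continuous_locint; apply: continuousMf; [exact: cu|exact: cp'].
have := @prim_sum _ _ (index_enum 'I_n) (fun i t => \sum_j J i j * (u t j 0 * p t i 0))
  (fun i t => \sum_j J i j * (g t j 0 * p t i 0 + u t j 0 * p' t i 0)).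
have -> : (fun t => \sum_i \sum_j J i j * (u t j 0 * p t i 0)) =
    (fun t => dot (p t) (J *m u t)).
  apply/funext => t; rewrite dotE; apply: eq_bigr => i _; rewrite mxE mulr_sumr.
  by apply: eq_bigr => j _; ring.
have -> : (fun t => \sum_i \sum_j J i j * (g t j 0 * p t i 0 + u t j 0 * p' t i 0)) =
    (fun t => dot (p t) (f t)).
  apply/funext => t.
  transitivity (dot (p t) (J *m g t) + dot (p' t) (J *m u t)).
    rewrite !dotE -big_split/=; apply: eq_bigr => i _; rewrite !mxE !mulr_sumr -big_split/=.
    by apply: eq_bigr => j _; ring.
  rewrite /g /p' mulmxN JK opprK dotNl dotJJ dotDr dot_mulr sA; ring.
apply=> i.
  by apply: locint_sum => j _; exact: locintZ.
by apply: prim_sum => j; [exact: locintZ|apply: primZ].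
Qed.

Definition flow_of A (X : R -> 'M[R]_n) := X 0 = 1%:M /\
  forall (t : R) i j, is_derive t 1 (fun s => X s i j) ((- (J *m (A t *m X t))) i j).

Lemma flow_ex A : mcont A -> exists X, flow_of A X.
Proof.
move=> cA; have [|X [X0 dX]] := @linear_ode_ex R n (fun t => - (J *m A t)).
  move=> i j; rewrite (_ : (fun t => _) = fun t => \sum_l (- J) i l * A t l j).
    by move=> t; apply: cvg_rsum => l; apply: cvgM; [exact: cvg_cst|exact: cA].
  by apply/funext => t; rewrite -mulNmx mxE.
exists X; split => // t i j; rewrite (_ : - _ = (- (J *m A t)) *m X t)//.
by rewrite mulNmx mulmxA.
Qed.

Section Flow.
Variables (A : R -> 'M[R]_n) (X : R -> 'M[R]_n).
Hypotheses (sA : forall t, (A t)^T = A t) (cA : mcont A) (fX : flow_of A X).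

Lemma flow_hsol a : hsol A (fun t => X t *m a).
Proof.
move=> t i; rewrite (_ : (fun s => _) = fun s => \sum_j a j 0 * X s i j); last first.
  by apply/funext => s; rewrite mxE; apply: eq_bigr => j _; rewrite mulrC.
have -> : (- (J *m (A t *m (X t *m a)))) i 0 =
    \sum_j a j 0 * (- (J *m (A t *m X t))) i j.
  by rewrite !mulmxA -mulNmx mxE; apply: eq_bigr => j _; rewrite mulrC.
have fs (F : 'I_n -> R -> R) : (fun s => \sum_j F j s) = \sum_j F j.
  by apply/funext => s; rewrite fct_sumE.
rewrite fs; have := @is_derive_sum R R R n (fun j s => a j 0 * X s i j) t 1
  (fun j => a j 0 * (- (J *m (A t *m X t))) i j).
by apply => j; apply: is_deriveZ; exact: fX.2.
Qed.

Lemma flow_mcont : mcont X.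
Proof.
move=> i j t; apply: differentiable_continuous; apply/derivable1_diffP.
by have [] := fX.2 t i j.
Qed.

Lemma hsol_pairing_cst p r s t : hsol A p -> hsol A r ->
  dot (p s) (J *m r s) = dot (p t) (J *m r t).
Proof.
move=> hp hr; have := green sA cA _ hp (hsol_sol cA hr).
move=> /(_ (vcont_vloc (@vcont_cst 0))) h; wlog st : s t / s <= t.
  by move=> H; case/orP: (le_total s t) => st; [exact: H|apply/esym; exact: H].
by rewrite (prim_constant h st)// => q _; rewrite dot0r.
Qed.

(** Green's identity for two homogeneous solutions: their symplectic pairing is
constant. *)
Lemma flow_symplectic t : (X t)^T *m J *m X t = J.
Proof.
have X0 := fX.1; apply/matrixP => i j.
have := hsol_pairing_cst t 0 (flow_hsol (delta_mx i 0)) (flow_hsol (delta_mx j 0)).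
have E (M : 'M[R]_n) : dot (M *m delta_mx i 0) (J *m (M *m delta_mx j 0)) =
    (M^T *m J *m M) i j.
  rewrite dot_mull /dot trmx_delta (mulmxA J) (mulmxA M^T) (mulmxA M^T J).
  by rewrite -colE -rowE !mxE.
by rewrite !E X0 trmx1 mul1mx mulmx1.
Qed.

(** The inverse of a symplectic matrix, by the formula that symplecticity provides.
*)
Definition flow_inv t := - (J *m (X t)^T *m J).

Lemma flow_invK t : flow_inv t *m X t = 1%:M.
Proof. by rewrite /flow_inv mulNmx -!mulmxA (mulmxA _ J) flow_symplectic JJ opprK. Qed.

Lemma flow_Kinv t : X t *m flow_inv t = 1%:M.
Proof. by apply: mulmx1C; exact: flow_invK. Qed.

Lemma hsol_through s (w : V) : exists2 p, hsol A p & p s = w.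
Proof.
exists (fun t => X t *m (flow_inv s *m w)); first exact: flow_hsol.
by rewrite mulmxA flow_Kinv mul1mx.
Qed.

(** The pairing with every homogeneous solution is constant, hence zero, and the
values of homogeneous solutions at a given time exhaust the space. *)
Lemma sol_eq0 u s : sol A u (fun=> 0) -> u s = 0 -> forall t, u t = 0.
Proof.
move=> hu us t; have v0 := vcont_vloc (@vcont_cst 0).
have H w : dot w (J *m u t) = 0.
  have [p hp <-] := hsol_through t w.
  have h := green sA cA v0 hp hu; have h0 q : dot (p q) 0 = 0 by rewrite dot0r.
  case/orP: (le_total s t) => st.
    by rewrite (prim_constant h st)// us mulmx0 dot0r.
  by rewrite -(prim_constant h st)// us mulmx0 dot0r.
have /(congr1 (mulmx J)) : J *m u t = 0 by apply: dot_ext.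
by rewrite JK mulmx0 => /eqP; rewrite oppr_eq0 => /eqP.
Qed.

Lemma sol_flow u : sol A u (fun=> 0) -> u = fun t => X t *m u 0.
Proof.
move=> hu; apply/funext => t; apply/eqP; rewrite -subr_eq0; apply/eqP.
have [cp hp] := hsol_sol cA (flow_hsol (u 0)).
apply: (@sol_eq0 (fun t => u t - X t *m u 0) 0); last by rewrite fX.1 mul1mx subrr.
case: hu => cu hu; split.
  move=> i; rewrite (_ : (fun t => _) = fun t => u t i 0 - (X t *m u 0) i 0).
    by move=> s; apply: cvgB; [exact: cu|exact: cp].
  by apply/funext => s; rewrite !mxE.
have rl v : vcont v -> forall i, locint (fun t => (- (J *m (A t *m v t + 0))) i 0).
  move=> cv i; apply: continuous_locint; under eq_fun do rewrite addr0.
  exact: vcont_rhs.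
move=> i; have := primD (rl _ cu i) (locintZ (-1) (rl _ cp i)) (hu i)
  (primZ (-1) (rl _ cp i) (hp i)).
have mB (P Q : V) : (P - Q) i 0 = P i 0 - Q i 0 by rewrite !mxE.
congr prim; apply/funext => s; rewrite mulN1r -mB//.
by rewrite !addr0 !mulmxBr opprB opprK addrC.
Qed.

End Flow.

End Hamiltonian.

(** * Hyperbolic splitting *)

Section Splitting.
Variable R : realType.

Lemma cvg0_le (a b : nat -> R) : (forall k, 0 <= a k <= b k) ->
  b k @[k --> \oo] --> 0 -> a k @[k --> \oo] --> 0.
Proof.
move=> ab b0; apply/cvgrPdist_le => e e0.
have /cvgrPdist_le/(_ e e0) := b0; apply: filterS => k.
have /andP[a0 akb] := ab k.
by rewrite !sub0r !normrN !ger0_norm// ?(le_trans a0)//; exact: le_trans.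
Qed.

Lemma contracting_recurrence (a b : nat -> R) r : 0 <= r < 1 ->
    (forall k, 0 <= a k) -> (forall k, a k.+1 <= r * a k + b k) ->
    b k @[k --> \oo] --> 0 ->
  a k @[k --> \oo] --> 0.
Proof.
move=> /andP[r0 r1] a0 hab b0; apply/cvgrPdist_le => e e0.
have e1 : 0 < e / 2 * (1 - r) by rewrite mulr_gt0 ?divr_gt0// subr_gt0.
have /cvgrPdist_le/(_ _ e1)[K _ hK] := b0.
have bK k : (K <= k)%N -> b k <= e / 2 * (1 - r).
  move=> Kk; rewrite (le_trans (ler_norm _))//.
  by have := hK k Kk; rewrite /= sub0r normrN.
have H j : a (K + j)%N <= r ^+ j * a K + e / 2.
  elim: j => [|j ih].
    by rewrite addn0 expr0 mul1r lerDl divr_ge0// ltW.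
  rewrite addnS (le_trans (hab _))// exprS.
  have := bK _ (leq_addr j K); have := ler_wpM2l r0 ih; nra.
have rj : r ^+ j * a K @[j --> \oo] --> 0.
  rewrite -[X in _ --> X](mul0r (a K)); apply: cvgMl.
  by apply: cvg_expr; rewrite ger0_norm.
have e2 : 0 < e / 2 by rewrite divr_gt0.
have /cvgrPdist_le/(_ _ e2)[L _ hL] := rj.
exists (K + L)%N => // k /= kKL.
rewrite sub0r normrN ger0_norm//.
have Kk : (K <= k)%N by rewrite (leq_trans _ kKL)// leq_addr.
rewrite -(subnKC Kk) (le_trans (H _))// [leRHS](splitr e) lerD2r.
have := hL (k - K)%N; rewrite /= leq_subRL// => /(_ kKL).
by rewrite sub0r normrN; apply: le_trans; exact: ler_norm.
Qed.

Local Notation C := R[i].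
Local Notation normc := (@ComplexField.Normc.normc R).

Lemma normc_ge0 (z : C) : 0 <= normc z.
Proof. by case: z => a b; exact: sqrtr_ge0. Qed.

Lemma normcE1 (z : C) : `|z| = (normc z)%:C%C.
Proof. by case: z. Qed.

Lemma normc_neq1 (z : C) : `|z| != 1 -> normc z != 1.
Proof. by apply: contra => /eqP z1; rewrite normcE1 z1. Qed.

Lemma Re_le_normc (z : C) : `|complex.Re z| <= normc z.
Proof.
case: z => a b /=; rewrite -sqrtr_sqr ler_sqrt ?addr_ge0 ?sqr_ge0//.
by rewrite lerDl sqr_ge0.
Qed.

Variable n : nat.
Local Notation V := ('cV[R]_n).

Definition decays (M : 'M[R]_n) (x : V) :=
  enorm (M ^+ k *m x) @[k --> \oo] --> (0 : R).

Definition cdecays (M : 'M[C]_n) (w : 'cV[C]_n) :=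
  forall i, normc ((M ^+ k *m w) i 0) @[k --> \oo] --> (0 : R).

Lemma cvg_shift (a : nat -> R) : a k @[k --> \oo] --> 0 -> a k.+1 @[k --> \oo] --> 0.
Proof. by move=> h; have := h; rewrite -cvg_shiftS. Qed.

Lemma cvg_unshift (a : nat -> R) : a k.+1 @[k --> \oo] --> 0 -> a k @[k --> \oo] --> 0.
Proof. by rewrite cvg_shiftS. Qed.

(** If [M w = c w + d eta] up to a shift in the exponent, with [eta] decaying and
[c] of modulus less than one, then [w] decays, by the recurrence [a_(k+1) <= r a_k +
b_k]. *)
Lemma cdecays_factor (M : 'M[C]_n) (c d : C) (e : nat) w eta : normc c < 1 ->
    (forall k, M ^+ k.+1 *m w = c *: (M ^+ k *m w) + d *: (M ^+ (k + e)%N *m eta)) ->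
  cdecays M eta -> cdecays M w.
Proof.
move=> c1 rec deta i.
pose b k := normc d * normc ((M ^+ (k + e)%N *m eta) i 0).
apply: (@contracting_recurrence _ b (normc c)).
- by rewrite normc_ge0.
- by move=> k; exact: normc_ge0.
- have E (P Q : 'cV[C]_n) : (c *: P + d *: Q) i 0 = c * P i 0 + d * Q i 0.
    by rewrite !mxE.
  move=> k; rewrite rec E; apply: (le_trans (le_normcD _ _)).
  by rewrite !ComplexField.Normc.normcM.
- rewrite -[X in _ --> X](mulr0 (normc d)); apply: cvgM; first exact: cvg_cst.
  rewrite /b; elim: e {rec b} => [|e ih]; first by under eq_fun do rewrite addn0; exact: deta.
  by under eq_fun do rewrite addnS -addSn; exact: (cvg_shift ih).
Qed.

Lemma cdecays0 (M : 'M[C]_n) : cdecays M 0.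
Proof.
move=> i; under eq_fun do rewrite mulmx0 mxE ComplexField.Normc.normc0.
exact: cvg_cst.
Qed.

End Splitting.

Section ComplexDecay.
Variables (R : realType) (n : nat).
Local Notation C := R[i].
Local Notation normc := (@ComplexField.Normc.normc R).
Variables (M N : 'M[C]_n.+1).
Hypothesis MN : M *m N = 1%:M.

Let NM : N *m M = 1%:M. Proof. exact: mulmx1C. Qed.

Let horner_cons (c : C) (p : {poly C}) (w : 'cV[C]_n.+1) :
  horner_mx M (('X - c%:P) * p) *m w = horner_mx M p *m (M *m w - c *: w).
Proof.
rewrite mulrC rmorphM/= -mulmxE -mulmxA; congr (_ *m _).
by rewrite rmorphB/= horner_mx_X horner_mx_C mulmxBl mul_scalar_mx.
Qed.

(** The linear factors are removed one at a time, so multiple roots need no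
generalized eigenvectors. *)
Lemma stable_factor (s : seq C) (w : 'cV[C]_n.+1) :
    (forall z, z \in s -> normc z < 1) ->
  horner_mx M (\prod_(z <- s) ('X - z%:P)) *m w = 0 -> cdecays M w.
Proof.
elim: s w => [|c s ih] w hs.
  by rewrite big_nil rmorph1 mul1mx => ->; exact: cdecays0.
rewrite big_cons horner_cons => h.
apply: (@cdecays_factor _ _ M c 1 0 w (M *m w - c *: w)).
- by apply: hs; rewrite mem_head.
- move=> k; rewrite addn0 mulmxBr -scalemxAr scale1r addrC subrK.
  by rewrite exprSr -mulmxE mulmxA.
- by apply: ih => // z zs; apply: hs; rewrite in_cons zs orbT.
Qed.

Lemma unstable_factor (s : seq C) (w : 'cV[C]_n.+1) :
    (forall z, z \in s -> 1 < normc z) ->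
  horner_mx M (\prod_(z <- s) ('X - z%:P)) *m w = 0 -> cdecays N w.
Proof.
elim: s w => [|c s ih] w hs.
  by rewrite big_nil rmorph1 mul1mx => ->; exact: cdecays0.
rewrite big_cons horner_cons => h.
have c1 : 1 < normc c by apply: hs; rewrite mem_head.
have c0 : c != 0.
  by apply: contraTneq c1 => ->; rewrite ComplexField.Normc.normc0 -leNgt.
apply: (@cdecays_factor _ _ N c^-1 (- c^-1) 1 w (M *m w - c *: w)).
- by rewrite ComplexField.Normc.normcV invf_lt1// (lt_trans ltr01).
- move=> k; have e : N ^+ k.+1 *m (M *m w) = N ^+ k *m w.
    by rewrite exprSr -mulmxE -mulmxA (mulmxA N) NM mul1mx.
  rewrite addn1 mulmxBr -scalemxAr scalerBr !scaleNr scalerA.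
  by rewrite mulVf// scale1r opprK e addrA subrr add0r.
- by apply: ih => // z zs; apply: hs; rewrite in_cons zs orbT.
Qed.

(** The characteristic polynomial is the product of two coprime polynomials, with
roots inside and outside the unit circle; a Bezout identity and the Cayley-Hamilton
theorem split every vector. *)
Lemma complex_splitting : (forall z, eigenvalue M z -> normc z != 1) ->
  forall w, exists ws wu, [/\ w = ws + wu, cdecays M ws & cdecays N wu].
Proof.
move=> ev w; have [rs] := closed_field_poly_normal (char_poly M).
rewrite (monicP (char_poly_monic M)) scale1r => chM.
have rsE z : z \in rs -> normc z != 1.
  by move=> zr; apply: ev; rewrite eigenvalue_root_char chM root_prod_XsubC.
pose ss := [seq z <- rs | normc z < 1]; pose su := [seq z <- rs | ~~ (normc z < 1)].
pose ps : {poly C} := \prod_(z <- ss) ('X - z%:P).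
pose pu : {poly C} := \prod_(z <- su) ('X - z%:P).
have chE : char_poly M = ps * pu.
  by rewrite chM /ps /pu !big_filter (bigID (fun z => normc z < 1)).
have cop : coprimep ps pu.
  apply/Pdiv.ClosedField.coprimepP => z; rewrite root_prod_XsubC mem_filter => /andP[z1 _].
  rewrite -/(root pu z) root_prod_XsubC mem_filter z1.
  by [].
have [[u v] /= uv] := Bezout_eq1_coprimepP _ _ cop.
exists (horner_mx M (v * pu) *m w), (horner_mx M (u * ps) *m w); split.
- by rewrite -mulmxDl -rmorphD addrC/= uv rmorph1 mul1mx.
- apply: (@stable_factor ss); first by move=> z; rewrite mem_filter => /andP[].
  rewrite -/ps mulmxA mulmxE -rmorphM mulrCA -chE rmorphM/= Cayley_Hamilton mulr0.
  by rewrite mul0mx.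
- apply: (@unstable_factor su).
    move=> z; rewrite mem_filter -leNgt => /andP[z1 /rsE zn].
    by rewrite lt_neqAle eq_sym zn.
  rewrite -/pu mulmxA mulmxE -rmorphM mulrCA (mulrC pu) -chE rmorphM/= Cayley_Hamilton.
  by rewrite mulr0 mul0mx.
Qed.

End ComplexDecay.

Section RealSplitting.
Variables (R : realType) (n : nat).
Local Notation V := ('cV[R]_n).
Local Notation toC := (map_mx (real_complex R)).

Lemma decays0 (M : 'M[R]_n) : decays M 0.
Proof. by rewrite /decays; under eq_fun do rewrite mulmx0 enorm0; exact: cvg_cst. Qed.

Lemma decaysD (M : 'M[R]_n) x y : decays M x -> decays M y -> decays M (x + y).
Proof.
move=> hx hy; apply: (@cvg0_le _ _ (fun k => enorm (M ^+ k *m x) + enorm (M ^+ k *m y))).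
  by move=> k; rewrite enorm_ge0/= mulmxDr enormD.
by rewrite -[X in _ --> X](addr0 0); apply: cvgD.
Qed.

Lemma decaysZ (M : 'M[R]_n) a x : decays M x -> decays M (a *: x).
Proof.
move=> hx; apply: (@cvg0_le _ _ (fun k => `|a| * enorm (M ^+ k *m x))).
  by move=> k; rewrite enorm_ge0/= -scalemxAr enormZ.
by rewrite -[X in _ --> X](mulr0 `|a|); apply: cvgM => //; exact: cvg_cst.
Qed.

Lemma decaysB (M : 'M[R]_n) x y : decays M x -> decays M y -> decays M (x - y).
Proof. by move=> hx hy; rewrite -scaleN1r; apply: decaysD => //; exact: decaysZ. Qed.

Lemma decays_sum (M : 'M[R]_n) I (r : seq I) (F : I -> V) :
  (forall i, decays M (F i)) -> decays M (\sum_(i <- r) F i).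
Proof.
move=> h; elim/big_ind : _ => // [|x y]; [exact: decays0|exact: decaysD].
Qed.

Lemma decays_coord (M : 'M[R]_n) x :
  (forall i, `|(M ^+ k *m x) i 0| @[k --> \oo] --> (0 : R)) -> decays M x.
Proof.
move=> h; apply: (@cvg0_le _ _ (fun k => \sum_i `|(M ^+ k *m x) i 0|)).
  by move=> k; rewrite enorm_ge0/= enorm_le_sum.
rewrite [X in _ --> X](_ : 0 = \sum_(i < n) 0); last by rewrite big1.
exact: cvg_rsum.
Qed.

Lemma decays_Re (M : 'M[R]_n) (w : 'cV[R[i]]_n) : cdecays (toC M) w ->
  decays M (\col_i complex.Re (w i 0)).
Proof.
move=> hw; apply: decays_coord => i; apply: cvg0_le (hw i) => k.
rewrite normr_ge0/=; apply: le_trans (Re_le_normc _).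
have -> : toC M ^+ k = toC (M ^+ k).
  elim: k => [|k ih]; first by rewrite !expr0 map_mx1.
  by rewrite !exprS ih -!mulmxE map_mxM.
rewrite (_ : (M ^+ k *m _) i 0 = complex.Re ((toC (M ^+ k) *m w) i 0))//.
rewrite !mxE.
rewrite (big_morph (@complex.Re R) (id1 := 0) (op1 := +%R)) => [|[a b] [c d]|]//.
apply: eq_bigr => j _; rewrite !mxE.
by case: (w j 0) => a b /=; rewrite mul0r subr0.
Qed.

End RealSplitting.

Lemma real_splitting (R : realType) n (M N : 'M[R]_n) : M *m N = 1%:M ->
    (forall z, eigenvalue (map_mx (real_complex R) M) z -> `|z| != 1) ->
  forall x, exists2 y, decays M y & decays N (x - y).
Proof.
case: n M N => [|n] M N MN ev x.
  by exists 0; [exact: decays0|rewrite subr0 (_ : x = 0) ?flatmx0//; exact: decays0].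
pose toC := map_mx (real_complex R).
have MNC : toC _ _ M *m toC _ _ N = 1%:M by rewrite -map_mxM MN map_mx1.
have [z /ev/normc_neq1//|ws [wu [e hs hu]]] := @complex_splitting _ _ _ _ MNC _ (toC _ _ x).
exists (\col_i complex.Re (ws i 0)); first exact: decays_Re.
rewrite (_ : x - _ = \col_i complex.Re (wu i 0)); first exact: decays_Re.
apply/colP => i; rewrite !mxE.
have := congr1 (fun v : 'cV_n.+1 => complex.Re (v i 0)) e; rewrite /toC !mxE/= => ->.
by case: (ws i 0) (wu i 0) => a b [c d] /=; rewrite addrC addKr.
Qed.

(** The vectors whose forward orbits decay and those whose backward orbits decay are
complementary, and each is isotropic for [J] because the symplectic pairing is
constant along orbits. An isotropic subspace has at most half the dimension, so both
have exactly half of it. A high power of [M] then contracts the first and expands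
the second by a factor two. *)
Lemma hyperbolic_splitting (R : realType) n (J M : 'M[R]_n) :
    J^T = - J -> J *m J = - 1%:M -> M^T *m J *m M = J ->
    (forall z, eigenvalue (map_mx (real_complex R) M) z -> `|z| != 1) ->
  exists P : 'M[R]_n, exists m : nat,
    [/\ (0 < m)%N, (\rank P + \rank P = n)%N, (\rank (1%:M - P)%R + \rank (1%:M - P)%R = n)%N &
     forall x, [/\ P *m (M ^+ m *m x) = M ^+ m *m (P *m x),
       enorm (M ^+ m *m (P *m x)) <= 2^-1 * enorm (P *m x) &
       enorm ((1%:M - P) *m x) <= 2^-1 * enorm (M ^+ m *m ((1%:M - P) *m x))]].
Proof.
move=> JT JJ sM ev.
pose N := - (J *m M^T *m J).
have NM : N *m M = 1%:M by rewrite /N mulNmx -!mulmxA (mulmxA _ J) sM JJ opprK.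
have MN : M *m N = 1%:M by apply: mulmx1C.
have NMk k : N ^+ k *m M ^+ k = 1%:M.
  elim: k => [|k ih]; first by rewrite !expr0 mulmx1.
  by rewrite exprSr exprS -!mulmxE -mulmxA (mulmxA N) NM mul1mx.
have sN : N^T *m J *m N = J.
  have : N^T *m (M^T *m J *m M) *m N = N^T *m J *m N by rewrite sM.
  rewrite -!mulmxA MN mulmx1 mulmxA -trmx_mul MN trmx1 mul1mx => <-.
  by [].
have iso (K : 'M[R]_n) x y : K^T *m J *m K = J -> decays K x -> decays K y ->
    dot x (J *m y) = 0.
  move=> sK hx hy.
  have inv k : dot (K ^+ k *m x) (J *m (K ^+ k *m y)) = dot x (J *m y).
    elim: k => [|k ih]; first by rewrite !expr0 !mul1mx.
    by rewrite exprS -mulmxE -!mulmxA dot_mull (mulmxA J) (mulmxA K^T) (mulmxA K^T J) sK.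
  have : dot x (J *m y) @[k --> \oo] --> (0 : R).
    apply/norm_cvg0P.
    apply: (@cvg0_le _ _ (fun k => enorm (K ^+ k *m x) * (mnorm J * enorm (K ^+ k *m y)))).
      move=> k; rewrite normr_ge0/= -(inv k) (le_trans (dot_cs _ _))//.
      by rewrite ler_wpM2l ?enorm_ge0// enorm_mul.
    rewrite -[X in _ --> X](mul0r (mnorm J * 0)); apply: cvgM => //.
    by apply: cvgM => //; exact: cvg_cst.
  by move=> h; apply: (cvg_unique _ (cvg_cst _) h).
have split0 x : decays M x -> decays N x -> x = 0.
  move=> hM hN; apply: dot_ext => w.
  have [y hy hwy] := real_splitting MN ev (J *m w).
  have := iso _ _ _ sM hy hM; have := iso _ _ _ sN hwy hN.
  rewrite dotBl => + h0; rewrite h0 subr0.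
  rewrite dot_mull JT mulNmx !mulmxA JJ mulNmx mul1mx opprK.
  by [].
pose P : 'M[R]_n := \matrix_(i, j) (s2val (cid2 (real_splitting MN ev (delta_mx j 0)))) i 0.
have PE x : P *m x = \sum_j x j 0 *: s2val (cid2 (real_splitting MN ev (delta_mx j 0))).
  apply/colP => i; rewrite mxE summxE; apply: eq_bigr => j _.
  by rewrite !mxE mulrC.
have Ps x : decays M (P *m x).
  by rewrite PE; apply: decays_sum => j; apply: decaysZ; case: (cid2 _).
have Pu x : decays N ((1%:M - P) *m x).
  have -> : (1%:M - P) *m x =
      \sum_j x j 0 *: (delta_mx j 0 - s2val (cid2 (real_splitting MN ev (delta_mx j 0)))).
    rewrite mulmxBl mul1mx PE; under [RHS]eq_bigr do rewrite scalerBr.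
    rewrite sumrB; congr (_ - _); apply/colP => i; rewrite summxE (bigD1 i)//= !mxE !eqxx mulr1.
    by rewrite big1 ?addr0// => j ji; rewrite !mxE eq_sym (negbTE ji) mulr0.
  by apply: decays_sum => j; apply: decaysZ; case: (cid2 _).
have uniqP x y : decays M y -> decays N (x - y) -> P *m x = y.
  move=> hy hxy; apply/eqP; rewrite -subr_eq0; apply/eqP; apply: split0.
    exact: decaysB.
  have -> : P *m x - y = (x - y) - (1%:M - P) *m x.
    by rewrite mulmxBl mul1mx opprB [RHS]addrC addrA subrK.
  exact: decaysB.
have Mdec x : decays M x -> decays M (M *m x).
  move=> hx; rewrite /decays.
  under eq_fun do rewrite mulmxA mulmxE -exprSr.
  exact: (cvg_shift hx).
have MdecN x : decays N x -> decays N (M *m x).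
  move=> hx; apply: (@cvg_unshift _ (fun k => enorm (N ^+ k *m (M *m x)))).
  apply: cvg0_le hx => k; rewrite enorm_ge0/=.
  by rewrite exprSr -mulmxE -mulmxA (mulmxA N) NM mul1mx.
have PM (x : 'cV[R]_n) : P *m (M *m x) = M *m (P *m x).
  apply: uniqP; first exact: Mdec.
  rewrite -mulmxBr; apply: MdecN; have := Pu x; by rewrite mulmxBl mul1mx.
have PP (x : 'cV[R]_n) : P *m (P *m x) = P *m x by apply: uniqP => //; rewrite subrr; exact: decays0.
have PMk k (x : 'cV[R]_n) : P *m (M ^+ k *m x) = M ^+ k *m (P *m x).
  elim: k x => [|k ih] x; first by rewrite expr0 !mul1mx.
  by rewrite exprS -mulmxE -!mulmxA PM ih.
have mx_ext (K L : 'M[R]_n) : (forall x : 'cV_n, K *m x = L *m x) -> K = L.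
  move=> h; apply/matrixP => i j; have /colP/(_ i) := h (delta_mx j 0).
  by rewrite -!colE !mxE.
have PPm : P *m P = P by apply: mx_ext => x; rewrite -mulmxA PP.
have rk (K : 'M[R]_n) : K^T *m J *m K = 0 -> (\rank K + \rank K <= n)%N.
  move=> h; have := mulmx0_rank_max h; congr (_ + _ <= _)%N.
  have Ju : J \in unitmx.
    have JJ1 : J *m (- J) = 1%:M by rewrite mulmxN JJ opprK.
    by have [] := mulmx1_unit JJ1.
  by rewrite mxrankMfree ?row_free_unit// mxrank_tr.
have isoK (K L : 'M[R]_n) : L^T *m J *m L = J -> (forall x, decays L (K *m x)) ->
    K^T *m J *m K = 0.
  move=> sL hK; apply: mx_ext => y; rewrite mul0mx; apply: dot_ext => x.
  have := iso L (K *m x) (K *m y) sL (hK x) (hK y).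
  by rewrite dot_mull !mulmxA.
have rP := rk _ (isoK _ _ sM Ps); have rQ := rk _ (isoK _ _ sN Pu).
have rPQ : (n <= \rank P + \rank (1%:M - P)%R)%N.
  by have := mxrank_add P (1%:M - P); rewrite addrC subrK mxrank1.
have small (K L : 'M[R]_n) : (forall x, decays L (K *m x)) ->
    \forall m \near \oo, mnorm (L ^+ m *m K) <= 2^-1.
  move=> hK.
  have : mnorm (L ^+ m *m K) @[m --> \oo] --> (0 : R).
    rewrite [X in _ --> X](_ : 0 = \sum_(i < n) \sum_(j < n) 0); last first.
      by rewrite big1// => i _; rewrite big1.
    apply: cvg_rsum => i; apply: cvg_rsum => j.
    apply: cvg0_le (hK (delta_mx j 0)) => m; rewrite normr_ge0/=.
    apply: le_trans (coord_le_enorm _ i).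
    by rewrite mulmxA -colE [in leRHS]mxE.
  have h2 : 0 < 2^-1 :> R by rewrite invr_gt0.
  move=> /cvgrPdist_le/(_ _ h2); apply: filterS => m.
  by rewrite sub0r normrN ger0_norm// mnorm_ge0.
have [m1 _ hm1] := small _ _ Ps; have [m2 _ hm2] := small _ _ Pu.
pose m := (m1 + m2).+1.
exists P, m; split => //.
- lia.
- lia.
move=> x; split; first exact: PMk.
- rewrite -[in leLHS](PP x) mulmxA (le_trans (enorm_mul _ _))//.
  by rewrite ler_wpM2r ?enorm_ge0//; apply: hm1; rewrite /= /m leqW// leq_addr.
- have QQ : (1%:M - P) *m ((1%:M - P) *m x) = (1%:M - P) *m x.
    by rewrite mulmxA mulmxBl mul1mx mulmxBr mulmx1 PPm subrr subr0.
  have QM : (1%:M - P) *m (M ^+ m *m ((1%:M - P) *m x)) = M ^+ m *m ((1%:M - P) *m x).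
    by rewrite [LHS]mulmxBl mul1mx PMk -mulmxBr -[X in _ *m (X - _)]mul1mx -mulmxBl QQ.
  rewrite -[leLHS](_ : enorm (N ^+ m *m (1%:M - P) *m (M ^+ m *m ((1%:M - P) *m x))) = _).
    rewrite (le_trans (enorm_mul _ _))// ler_wpM2r ?enorm_ge0//.
    by apply: hm2; rewrite /= /m leqW// leq_addl.
  by rewrite -mulmxA QM (mulmxA (N ^+ m)) NMk mul1mx.
Qed.

(** * Growth of a quadratic form *)

Section Growth.
Variable R : realType.

Lemma is_derive_ge0_le (h h' : R -> R) : (forall t : R, is_derive t 1 h (h' t)) ->
  (forall t, 0 <= h' t) -> forall s t, s <= t -> h s <= h t.
Proof.
move=> dh h0 s t st.
have ch : continuous h.
  by move=> r; apply: differentiable_continuous; apply/derivable1_diffP; have [] := dh r.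
have [c _ e] := MVT_segment st (fun r _ => dh r) (continuous_subspaceT ch).
by rewrite -subr_ge0 e mulr_ge0// subr_ge0.
Qed.

(** Differentiate [phi] times the exponential with either sign. *)
Lemma gronwall (phi phi' : R -> R) (K : R) :
    (forall t : R, is_derive t 1 phi (phi' t)) ->
    (forall t, `|phi' t| <= K * phi t) ->
  forall s t, phi t <= expR (K * `|t - s|) * phi s.
Proof.
move=> dphi hphi s t.
have dM c (r : R) : is_derive r 1 (fun r => expR (c * r) * phi r)
    (expR (c * r) * (phi' r + c * phi r)).
  have := @is_deriveM _ _ (fun r => expR (c * r)) phi r 1 _ _ (is_derive_expRM c r) (dphi r).
  by move=> h; apply: is_derive_eq; rewrite /GRing.scale/=; ring.
case/orP: (le_total s t) => st.
  rewrite ger0_norm ?subr_ge0//.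
  have := @is_derive_ge0_le _ _ (fun r => is_deriveN (dM (- K) r)) _ _ _ st.
  move=> /(_ _)/= h; have {}h : expR (- K * t) * phi t <= expR (- K * s) * phi s.
    rewrite -lerN2; apply: h => r; rewrite -mulrN mulr_ge0 ?expR_ge0//.
    have := hphi r; rewrite ler_norml => /andP[_]; lra.
  rewrite -(ler_pM2l (expR_gt0 (- K * t))) (le_trans h)// mulrA -expRD.
  by rewrite le_eqVlt; apply/orP; left; apply/eqP; congr (expR _ * _); ring.
rewrite ler0_norm ?subr_le0//.
have h : expR (K * t) * phi t <= expR (K * s) * phi s.
  apply: (is_derive_ge0_le (dM K)) => // r; rewrite mulr_ge0 ?expR_ge0//.
  have := hphi r; rewrite ler_norml => /andP[]; lra.
rewrite -(ler_pM2l (expR_gt0 (K * t))) (le_trans h)// mulrA -expRD.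
by rewrite le_eqVlt; apply/orP; left; apply/eqP; congr (expR _ * _); ring.
Qed.

Lemma is_derive_dot n (p p' : R -> 'cV[R]_n) (t : R) :
    (forall i, is_derive t 1 (fun s => p s i 0) (p' t i 0)) ->
  is_derive t 1 (fun s => dot (p s) (p s)) (2 * dot (p t) (p' t)).
Proof.
move=> hp.
have -> : (fun s => dot (p s) (p s)) = \sum_i (fun s => p s i 0 * p s i 0).
  by apply/funext => s; rewrite dotE fct_sumE.
have -> : 2 * dot (p t) (p' t) = \sum_i (p t i 0 * p' t i 0 + p t i 0 * p' t i 0).
  by rewrite dotE mulr_sumr; apply: eq_bigr => i _; ring.
apply: (@is_derive_sum _ _ _ _ (fun i s => p s i 0 * p s i 0)) => i.
exact: (@is_deriveM _ _ (fun s => p s i 0) (fun s => p s i 0)).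
Qed.

Section Quadratic.
Variables (n : nat) (P Q M : 'M[R]_n).
Hypotheses (PQ : P + Q = 1%:M)
  (Pc : forall x : 'cV_n, P *m (M *m x) = M *m (P *m x))
  (Ps : forall x : 'cV_n, enorm (M *m (P *m x)) <= 2^-1 * enorm (P *m x))
  (Qu : forall x : 'cV_n, enorm (Q *m x) <= 2^-1 * enorm (M *m (Q *m x))).

(** A Lyapunov form: it increases along the hyperbolic map, whose contracted part
enters negatively and expanded part positively. *)
Definition qform (x : 'cV[R]_n) := enorm (Q *m x) ^+ 2 - enorm (P *m x) ^+ 2.
Definition qbound := mnorm P ^+ 2 + mnorm Q ^+ 2.

Lemma qbound_ge0 : 0 <= qbound. Proof. by rewrite addr_ge0 ?sqr_ge0. Qed.

Lemma Qc (x : 'cV_n) : Q *m (M *m x) = M *m (Q *m x).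
Proof.
have -> : Q = 1%:M - P by rewrite -PQ addrC addKr.
by rewrite mulmxBl mul1mx Pc -mulmxBr mulmxBl mul1mx.
Qed.

Lemma sqr_enorm_mul m (K : 'M[R]_(m, n)) (x : 'cV_n) :
  enorm (K *m x) ^+ 2 <= mnorm K ^+ 2 * enorm x ^+ 2.
Proof.
by rewrite -exprMn ler_pXn2r ?nnegrE ?enorm_ge0 ?mulr_ge0 ?mnorm_ge0 ?enorm_ge0// enorm_mul.
Qed.

Lemma qform_le x : qform x <= qbound * enorm x ^+ 2.
Proof.
rewrite /qform /qbound; have := sqr_enorm_mul Q x.
have := sqr_ge0 (enorm (P *m x)); have := mulr_ge0 (sqr_ge0 (mnorm P)) (sqr_ge0 (enorm x)).
rewrite mulrDl; lra.
Qed.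

Lemma qform_ge x : - (qbound * enorm x ^+ 2) <= qform x.
Proof.
rewrite /qform /qbound; have := sqr_enorm_mul P x.
have := sqr_ge0 (enorm (Q *m x)); have := mulr_ge0 (sqr_ge0 (mnorm Q)) (sqr_ge0 (enorm x)).
rewrite mulrDl; lra.
Qed.

Lemma enorm_split (x : 'cV[R]_n) :
  enorm x ^+ 2 <= 2 * (enorm (P *m x) ^+ 2 + enorm (Q *m x) ^+ 2).
Proof.
have h : enorm x <= enorm (P *m x) + enorm (Q *m x).
  by rewrite -[X in enorm X <= _]mul1mx -PQ mulmxDl enormD.
have [p q r] := And3 (enorm_ge0 (P *m x)) (enorm_ge0 (Q *m x)) (enorm_ge0 x).
apply: (@le_trans _ _ ((enorm (P *m x) + enorm (Q *m x)) ^+ 2)).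
  by rewrite ler_pXn2r ?nnegrE ?addr_ge0.
have := sqr_ge0 (enorm (P *m x) - enorm (Q *m x)); nra.
Qed.

(** For [y = M x] the form grows by at least three quarters of the squares of the
components; the constant 48 leaves room to absorb the deviation of [y] from [M x].
*)
Lemma qform_growth x y (F : R) : 0 <= F -> 48 * qbound * enorm (y - M *m x) ^+ 2 <=
    enorm x ^+ 2 + F ->
  8^-1 * enorm x ^+ 2 <= qform y - qform x + F.
Proof.
set h := y - M *m x => F0 hF.
have yE : y = M *m x + h by rewrite /h subrKC.
have [a0 b0] := (enorm_ge0 (Q *m x), enorm_ge0 (P *m x)).
have hQ := sqr_enorm_mul Q h; have hP := sqr_enorm_mul P h.
have yQ : 2 * enorm (Q *m x) <= enorm (Q *m y) + enorm (Q *m h).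
  apply: (@le_trans _ _ (enorm (M *m (Q *m x)))).
    by have := Qu x; lra.
  have -> : M *m (Q *m x) = Q *m y + - (Q *m h) by rewrite yE mulmxDr Qc addrK.
  by rewrite (le_trans (enormD _ _))// enormN.
have yP : enorm (P *m y) <= 2^-1 * enorm (P *m x) + enorm (P *m h).
  rewrite yE mulmxDr Pc (le_trans (enormD _ _))// lerD2r; exact: Ps.
have := enorm_split x; have := sqr_ge0 (enorm x); rewrite /qform.
have [d1 d2] := (enorm_ge0 (Q *m h), enorm_ge0 (P *m h)).
have [y1 y2] := (enorm_ge0 (Q *m y), enorm_ge0 (P *m y)).
move: hF hQ hP yQ yP a0 b0 d1 d2 y1 y2; rewrite /qbound.
move: (enorm (Q *m x)) (enorm (P *m x)) (enorm (Q *m h)) (enorm (P *m h))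
  (enorm (Q *m y)) (enorm (P *m y)) (enorm x ^+ 2) (enorm h ^+ 2)
  (mnorm P ^+ 2) (mnorm Q ^+ 2) => a b dq dp yq yp x2 h2 mp mq.
move=> hF hQ hP yQ yP a0 b0 d1 d2 y1 y2 x20 xs.
have s1 : 2 * a ^+ 2 - dq ^+ 2 <= yq ^+ 2.
  have : 4 * a ^+ 2 <= (yq + dq) ^+ 2.
    have -> : 4 * a ^+ 2 = (2 * a) ^+ 2 by ring.
    by rewrite ler_pXn2r ?nnegrE ?addr_ge0 ?mulr_ge0.
  have := sqr_ge0 (yq - dq); nra.
have s2 : yp ^+ 2 <= 2^-1 * b ^+ 2 + 2 * dp ^+ 2.
  have : yp ^+ 2 <= (2^-1 * b + dp) ^+ 2.
    by rewrite ler_pXn2r ?nnegrE ?addr_ge0 ?mulr_ge0 ?invr_ge0.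
  have := sqr_ge0 (2^-1 * b - dp); nra.
have s3 : 48 * (dq ^+ 2 + dp ^+ 2) <= x2 + F by nra.
have x2F : 0 <= x2 + F by apply: le_trans s3; rewrite mulr_ge0// addr_ge0 ?sqr_ge0.
have q0 := sqr_ge0 dq; have p0 := sqr_ge0 dp; have aa := sqr_ge0 a; have bb := sqr_ge0 b.
lra.
Qed.

(** A vector on which the form is negative definite can raise its value only through
the cross term with [d]; completing the square leaves a bound in [d] alone. *)
Lemma qform_add_le e d (c : R) : 0 < c -> qform e <= - (c * enorm e ^+ 2) ->
  qform (e + d) <= (qbound ^+ 2 / c + qbound) * enorm d ^+ 2.
Proof.
move=> c0 he.
have E : qform (e + d) = qform e + 2 * (dot (Q *m e) (Q *m d) - dot (P *m e) (P *m d)) + qform d.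
  by rewrite /qform -!dotvv !mulmxDr !dotDl !dotDr (dotC (Q *m d)) (dotC (P *m d)); ring.
have B : dot (Q *m e) (Q *m d) - dot (P *m e) (P *m d) <= qbound * (enorm e * enorm d).
  have cs (K : 'M[R]_n) : `|dot (K *m e) (K *m d)| <= mnorm K ^+ 2 * (enorm e * enorm d).
    apply: (le_trans (dot_cs _ _)); rewrite expr2 mulrACA.
    by apply: ler_pM; rewrite ?enorm_ge0 ?enorm_mul.
  have := ler_norm (dot (Q *m e) (Q *m d)); have := ler_norm (- dot (P *m e) (P *m d)).
  rewrite normrN; have := cs P; have := cs Q; rewrite /qbound mulrDl; lra.
rewrite E; have qd := qform_le d.
have q0 := qbound_ge0; have [e0 d0] := (enorm_ge0 e, enorm_ge0 d).
have key : 2 * (qbound * (enorm e * enorm d)) <=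
    c * enorm e ^+ 2 + qbound ^+ 2 / c * enorm d ^+ 2.
  have s := sqr_ge0 (c * enorm e - qbound * enorm d).
  rewrite -(ler_pM2l c0).
  have -> : c * (c * enorm e ^+ 2 + qbound ^+ 2 / c * enorm d ^+ 2) =
    c ^+ 2 * enorm e ^+ 2 + qbound ^+ 2 * enorm d ^+ 2 by field; rewrite gt_eqF.
  nra.
rewrite [leRHS]mulrDl.
have arith (a k z1 z2 m b m1 : R) :
  2 * z1 <= m + z2 -> k <= z1 -> a <= - m -> b <= m1 -> a + 2 * k + b <= z2 + m1.
  by move=> *; lra.
exact: arith key B he qd.
Qed.

End Quadratic.
End Growth.

(** * Finite-dimensional compactness *)

Section FiniteDimension.
Variable R : realType.

Lemma bounded_sum_small (a : nat -> R) C k0 : (forall k, 0 <= a k) ->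
    (forall K, (k0 <= K)%N -> \sum_(k0 <= j < K) a j <= C) ->
  forall e, 0 < e -> exists K0, forall k, (K0 <= k)%N -> a k <= e.
Proof.
move=> a0 aC e e0; pose b j := a (j + k0)%N.
have cb : cvgn (series b).
  apply: nondecreasing_is_cvgn.
    by apply/nondecreasing_seqP => j; rewrite /series/= big_nat_recr//= lerDl a0.
  exists C => _ [j _ <-]; have := aC (j + k0)%N (leq_addl _ _).
  by rewrite -[X in \sum_(X <= _ < _) _]add0n big_addn addnK.
have /cvgrPdist_le/(_ e e0)[K _ hK] := cvg_series_cvg_0 cb.
exists (K + k0)%N => k Kk; have k0k : (k0 <= k)%N by rewrite (leq_trans _ Kk)// leq_addl.
have := hK (k - k0)%N; rewrite /= leq_subRL// addnC => /(_ Kk).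
rewrite /b subnK// sub0r normrN; apply: le_trans; exact: ler_norm.
Qed.

Variable n : nat.
Local Notation V := ('cV[R]_n).

(** A maximal-rank matrix among those whose row space lies in [S] has [S] as row
space. *)
Lemma subspace_matrix (S : V -> Prop) : S 0 ->
    (forall a x y, S x -> S y -> S (a *: x + y)) ->
  exists E : 'M[R]_n, forall x, S x <-> (x^T <= E)%MS.
Proof.
move=> S0 Sl.
pose good (E : 'M[R]_n) := forall x : V, (x^T <= E)%MS -> S x.
pose ranks k := `[< exists2 E, good E & \rank E = k >].
have g0 : exists k, ranks k.
  exists 0%N; apply/asboolP; exists 0; last by rewrite mxrank0.
  by move=> x; rewrite submx0 => /eqP/(congr1 trmx); rewrite trmxK trmx0 => ->.
have rb k : ranks k -> (k <= n)%N by move=> /asboolP[E _ <-]; exact: rank_leq_row.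
case: (ex_maxnP g0 rb) => r /asboolP[E gE rE] rmax.
exists E => x; split; last exact: gE.
move=> Sx; apply: contrapT => xE.
have : good (E + x^T)%MS.
  move=> y /sub_addsmxP[[u v]] /= yE.
  have -> : y = v 0 0 *: x + (u *m E)^T.
    apply: trmx_inj; rewrite linearD/= trmxK yE addrC; congr (_ + _).
    by rewrite linearZ/= {1}[v]mx11_scalar mul_scalar_mx.
  by apply: Sl => //; apply: gE; rewrite trmxK submxMl.
move=> gEx; have : ranks (\rank (E + x^T)%MS) by apply/asboolP; exists (E + x^T)%MS.
move=> /rmax; rewrite -rE => h.
have /mxrank_leqif_sup [_ e] : (E <= E + x^T)%MS by exact: addsmxSl.
have : (E + x^T <= E)%MS by rewrite -e eqn_leq h mxrankS// addsmxSl.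
by rewrite addsmx_sub => /andP[_ ?]; exact: xE.
Qed.

Lemma orthogonal_decomposition m (E : 'M[R]_(m, n)) (u : V) :
  exists e d : V, [/\ u = e + d, (e^T <= E)%MS & E *m d = 0].
Proof.
have cap0 : (E :&: kermx E^T = 0)%MS.
  apply/eqP; rewrite -submx0; apply/row_subP => i; set v := row i _.
  have : (v <= E :&: kermx E^T)%MS by exact: row_sub.
  rewrite sub_capmx => /andP[/submxP[c cE] /sub_kermxP h].
  have : dot v^T v^T = 0.
    by rewrite /dot trmxK [in X in _ *m X]cE trmx_mul mulmxA h mul0mx mxE.
  by move/dotvv_eq0/(congr1 trmx); rewrite trmxK trmx0 => ->; rewrite sub0mx.
have full : (u^T <= E + kermx E^T)%MS.
  apply: submx_full; rewrite /row_full mxrank_disjoint_sum// mxrank_ker mxrank_tr.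
  by rewrite subnKC// rank_leq_col.
have /sub_addsmxP[[c k] /= uE] := full.
exists (c *m E)^T, (k *m kermx E^T)^T; split.
- by apply: trmx_inj; rewrite linearD/= !trmxK.
- by rewrite trmxK submxMl.
- by apply: trmx_inj; rewrite trmx_mul trmxK -mulmxA mulmx_ker mulmx0 trmx0.
Qed.

Lemma continuous_dot_rV m (K L : 'M[R]_(m, n)) :
  continuous (fun v : 'rV[R]_n => dot (K *m v^T) (L *m v^T)).
Proof.
have E (v : 'rV[R]_n) : dot (K *m v^T) (L *m v^T) =
    \sum_i (\sum_j K i j * v 0 j) * (\sum_j L i j * v 0 j).
  rewrite dotE; apply: eq_bigr => i _; rewrite !mxE.
  by congr (_ * _); apply: eq_bigr => j _; rewrite mxE.
rewrite (_ : (fun v => _) = fun v : 'rV[R]_n =>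
    \sum_i (\sum_j K i j * v 0 j) * (\sum_j L i j * v 0 j)); last by apply/funext.
have cl (c : 'I_n -> R) : continuous (fun v : 'rV[R]_n => \sum_j c j * v 0 j).
  apply: continuous_rsum => j v; apply: (@cvgM _ _ (nbhs v)); first exact: cvg_cst.
  exact: coord_continuous.
by apply: continuous_rsum => i v; apply: (@cvgM _ _ (nbhs v)); exact: cl.
Qed.

Lemma continuous_dotl_rV (w : V) : continuous (fun v : 'rV[R]_n => dot w v^T).
Proof.
rewrite (_ : (fun v => _) = fun v : 'rV[R]_n => \sum_i w i 0 * v 0 i); last first.
  by apply/funext => v; rewrite dotE; apply: eq_bigr => i _; rewrite mxE.
apply: continuous_rsum => i v; apply: (@cvgM _ _ (nbhs v)); first exact: cvg_cst.
exact: coord_continuous.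
Qed.

(** Compactness of the unit sphere, in the form in which closed conditions satisfied
eventually by the sequence pass to a cluster point. *)
Lemma unit_cluster (v : nat -> V) : (forall k, enorm (v k) = 1) ->
  exists2 a : V, enorm a = 1 & forall g : 'rV[R]_n -> R, continuous g ->
    (exists k0, forall k, (k0 <= k)%N -> g (v k)^T <= 0) -> g a^T <= 0.
Proof.
move=> v1; pose A := [set w : 'rV[R]_n | dot w^T w^T = 1].
have cdot : continuous (fun w : 'rV[R]_n => dot w^T w^T).
  rewrite (_ : (fun w => _) = fun w : 'rV[R]_n => dot (1%:M *m w^T) (1%:M *m w^T)).
    exact: continuous_dot_rV.
  by apply/funext => w; rewrite !mul1mx.
have cA : compact A.
  apply: bounded_closed_compact.
    exists 1; split; first exact: num_real.
    move=> x x1 w /= w1; apply: ltW; apply: le_lt_trans x1.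
    rewrite /Num.norm/= mx_normrE; apply: bigmax_le => // -[i j] _ /=.
    have e1 : enorm w^T = 1.
      apply/eqP; rewrite -(eqrXn2 (n := 2))// ?enorm_ge0//.
      by rewrite -dotvv w1 expr1n.
    by rewrite -e1; have := coord_le_enorm w^T j; rewrite mxE (ord1 i).
  by apply: (@closed_comp _ _ (fun w : 'rV[R]_n => dot w^T w^T) [set 1]) => [w _|];
    [exact: cdot|exact: closed_eq].
have [|a [Aa ca]] := cA ((fun k => (v k)^T) @ \oo) _.
  by exists 0%N => // k _; rewrite /A /= trmxK dotvv v1 expr1n.
exists a^T.
  by apply/eqP; rewrite -(eqrXn2 (n := 2))// ?enorm_ge0// -dotvv expr1n; apply/eqP.
move=> g cg [k0 hk0]; rewrite trmxK.
have clB : closed [set w | g w <= 0].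
  by apply: (@closed_comp _ _ g [set x | x <= 0]) => [w _|];
    [exact: cg|exact: closed_le].
have : closure [set w | g w <= 0] a.
  move: ca; rewrite clusterE => /(_ [set w | g w <= 0]); apply.
  by exists k0 => // k /=; exact: hk0.
by rewrite -(closure_id _).1.
Qed.

End FiniteDimension.

(** * Estimates for solutions *)

Section Estimates.
Variables (R : realType) (n : nat) (J : 'M[R]_n).
Hypotheses (JT : J^T = - J) (JJ : J *m J = - 1%:M).
Local Notation mu := (@lebesgue_measure R).
Local Notation V := ('cV[R]_n).
Implicit Types (A : R -> 'M[R]_n) (u f p : R -> V).

Lemma ler_enorm_sqr (x y : R) : 0 <= x -> 0 <= y -> x ^+ 2 <= y ^+ 2 -> x <= y.
Proof. by move=> x0 y0; rewrite ler_pXn2r. Qed.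

Lemma hsol_bound A al p s t : (forall t, mnorm (A t) <= al) -> hsol J A p ->
  enorm (p t) <= expR (al * `|t - s|) * enorm (p s).
Proof.
move=> bA hp; pose p' t := - (J *m (A t *m p t)).
have h := @gronwall _ (fun t => dot (p t) (p t)) (fun t => 2 * dot (p t) (p' t)) (2 * al)
  (fun t => is_derive_dot (hp t)).
apply: ler_enorm_sqr; rewrite ?mulr_ge0 ?enorm_ge0 ?expR_ge0//.
rewrite exprMn -!dotvv expr2 -expRD.
have -> : al * `|t - s| + al * `|t - s| = 2 * al * `|t - s| by ring.
apply: h => r; rewrite normrM ger0_norm// -mulrA ler_wpM2l//.
rewrite /p' dotNr normrN (le_trans (dot_cs _ _))// enormJ// dotvv expr2 mulrCA.
rewrite ler_wpM2l ?enorm_ge0// (le_trans (enorm_mul _ _))//.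
by rewrite ler_wpM2r ?enorm_ge0.
Qed.

Lemma hsol_bound_le A al p s t tau : 0 <= al -> (forall t, mnorm (A t) <= al) ->
    hsol J A p -> `|t - s| <= tau ->
  enorm (p t) <= expR (al * tau) * enorm (p s).
Proof.
move=> al0 bA hp ts; apply: (le_trans (hsol_bound s t bA hp)).
by rewrite ler_wpM2r ?enorm_ge0// ler_expR ler_wpM2l.
Qed.

Lemma energy_sub f s r t : locint (fun t => dot (f t) (f t)) -> s <= r -> r <= t ->
  energy f s r <= energy f s t.
Proof.
move=> df sr rt; apply: ler_wsqrtr; rewrite (Rintegral_itv_cat df sr rt) lerDl.
by apply: Rintegral_ge0 => q _; exact: dotvv_ge0.
Qed.

Lemma norm_diff_le (x y z : R) : x - y = z -> `|x| <= `|y| + `|z|.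
Proof. by move=> <-; rewrite addrC; have := ler_normD (x - y) y; rewrite subrK. Qed.

(** Duality: the pairing of [u] at time [r] with an arbitrary vector is propagated
back to time [s] by Green's identity along the homogeneous solution through that
vector. *)
Lemma sol_bound A al u f s r t tau : 0 <= al -> (forall t, mnorm (A t) <= al) ->
    (forall t, (A t)^T = A t) -> mcont A -> sqloc f -> sol J A u f ->
    s <= r -> r <= t -> t - s <= tau ->
  enorm (u r) <= expR (al * tau) * (enorm (u s) + Num.sqrt tau * energy f s t).
Proof.
move=> al0 bA sA cA sf hu sr rt ts.
have tau0 : 0 <= tau by apply: le_trans ts; rewrite subr_ge0 (le_trans sr).
apply: enorm_dot_bound.
  by rewrite mulr_ge0 ?expR_ge0// addr_ge0 ?enorm_ge0// mulr_ge0 ?sqrtr_ge0.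
move=> w; have [X fX] := flow_ex J cA.
have [p hp pr] := hsol_through JT JJ sA cA fX r (J *m w).
have := green JT JJ sA cA sf.1 hp hu sr; rewrite pr dotJJ// => /norm_diff_le h.
apply: (le_trans h).
have pb q : s <= q <= r -> enorm (p q) <= expR (al * tau) * enorm w.
  move=> /andP[sq qr]; rewrite -(enormJ JT JJ w) -pr; apply: (hsol_bound_le al0 bA hp).
  by rewrite ler0_norm ?subr_le0// opprB (le_trans _ ts)// lerB.
have -> : expR (al * tau) * (enorm (u s) + Num.sqrt tau * energy f s t) * enorm w =
  expR (al * tau) * enorm w * enorm (u s) +
  expR (al * tau) * enorm w * Num.sqrt tau * energy f s t by ring.
apply: lerD.
  rewrite (le_trans (dot_cs _ _))// enormJ// ler_wpM2r ?enorm_ge0//.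
  by apply: pb; rewrite lexx.
have c0 : 0 <= expR (al * tau) * enorm w by rewrite mulr_ge0 ?expR_ge0 ?enorm_ge0.
apply: (le_trans (Rintegral_dot_le (hsol_vcont hp) sf c0 sr pb)).
apply: ler_pM; rewrite ?mulr_ge0 ?sqrtr_ge0//; last exact: energy_sub sf.2 sr rt.
rewrite ler_wpM2l// ler_wsqrtr// (le_trans _ ts)// lerB//.
Qed.

Lemma hsol_shift A p (c : R) : hsol J A p ->
  hsol J (fun t => A (t + c)) (fun t => p (t + c)).
Proof.
move=> hp t i.
have d1 : is_derive t 1 (fun s : R => s + c) (1 + 0) by exact: is_deriveD.
rewrite -[X in is_derive _ _ _ X]mulr1 -[X in _ * X]addr0.
exact: (@is_derive1_comp R (fun s => p s i 0) (fun s => s + c) t _ _ (hp (t + c) i) d1).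
Qed.

Section Periodic.
Variables (A X : R -> 'M[R]_n) (T : R).
Hypotheses (sA : forall t, (A t)^T = A t) (cA : mcont A) (fX : flow_of J A X)
  (perA : forall t, A (t + T) = A t).

Lemma periodic_mul k t : A (t + k%:R * T) = A t.
Proof.
elim: k => [|k ih]; first by rewrite mul0r addr0.
by rewrite -natr1 mulrDl mul1r addrA perA.
Qed.

Lemma flow_periodic k t : X (t + k%:R * T) = X t *m X T ^+ k.
Proof.
have mx_ext (K L : 'M[R]_n) : (forall x : 'cV_n, K *m x = L *m x) -> K = L.
  move=> h; apply/matrixP => i j; have /colP/(_ i) := h (delta_mx j 0).
  by rewrite -!colE !mxE.
have shift c : (forall t, A (t + c) = A t) -> forall t, X (t + c) = X t *m X c.
  move=> pc r; apply: mx_ext => a; rewrite -mulmxA.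
  have hs : hsol J A (fun t => X (t + c) *m a).
    move=> q i; have := hsol_shift c (flow_hsol fX a) q i.
    by rewrite pc.
  have /(congr1 (@^~ r)) /= -> := sol_flow JT JJ sA cA fX (hsol_sol cA hs).
  by rewrite add0r.
have base : X (k%:R * T) = X T ^+ k.
  elim: k => [|k ih]; first by rewrite mul0r expr0 fX.1.
  rewrite -natr1 mulrDl mul1r (shift T perA) ih exprSr.
  by [].
by rewrite shift ?base// => r; exact: periodic_mul.
Qed.

End Periodic.

(** Over one step a solution differs from the periodic flow by the effect of the
inhomogeneity and of the coefficient error, both measured through Green's identity
for the periodic system with [(A - Ap) u + f] as inhomogeneity. The number [k]
bounds the growth over one step. *)
Lemma step_estimate A Ap XP al dl u f s tau :
    0 <= al -> 0 <= tau -> 0 <= dl ->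
    (forall t, mnorm (A t) <= al) -> (forall t, mnorm (Ap t) <= al) ->
    (forall t, (A t)^T = A t) -> (forall t, (Ap t)^T = Ap t) ->
    mcont A -> mcont Ap -> flow_of J Ap XP ->
    (forall t, Ap (t - s) = Ap t) ->
    (forall t, s <= t -> mnorm (A t - Ap t) <= dl) ->
    sqloc f -> sol J A u f -> forall k, k = expR (al * tau) ->
  enorm (u (s + tau) - XP tau *m u s) <=
  k * tau * dl * k * enorm (u s) +
  (k * Num.sqrt tau + k * tau * dl * k * Num.sqrt tau) * energy f s (s + tau).
Proof.
move=> al0 tau0 dl0 bA bAp sA sAp cA cAp fXP perA hd sf hu k kE.
set t := s + tau; have st : s <= t by rewrite lerDl.
have k0 : 0 <= k by rewrite kE expR_ge0.
have [e0 u0] := (energy_ge0 f s t, enorm_ge0 (u s)).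
apply: enorm_dot_bound.
  by rewrite addr_ge0 ?mulr_ge0 ?addr_ge0 ?mulr_ge0 ?sqrtr_ge0.
move=> w; pose b := flow_inv J XP tau *m (J *m w).
have hb : XP tau *m b = J *m w by rewrite mulmxA (flow_Kinv JT JJ sAp cAp fXP) mul1mx.
pose p r := XP (r - s) *m b.
have hp : hsol J Ap p.
  move=> q i; have := hsol_shift (- s) (flow_hsol fXP b) q i.
  by rewrite perA.
have pt : p t = J *m w by rewrite /p /t addrC addKr.
have ps : p s = b by rewrite /p subrr fXP.1 mul1mx.
pose d r := (A r - Ap r) *m u r.
have cd : vcont d by apply: vcont_mulmx; [exact: mcontB|exact: hu.1].
have sd : sqloc d := vcont_sqloc cd.
have sg : sqloc (fun r => f r + d r) by exact: sqlocD.
have := green JT JJ sAp cAp sg.1 hp (sol_change Ap hu) st; rewrite pt ps dotJJ//.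
have -> : dot b (J *m u s) = dot w (XP tau *m u s).
  rewrite -(dotJJ JT JJ w) -hb dot_mull (mulmxA J) (mulmxA (XP tau)^T) (mulmxA (XP tau)^T J).
  by rewrite (flow_symplectic JT JJ sAp cAp fXP).
rewrite -dotBr => ->.
have cp := hsol_vcont hp.
rewrite (@eq_Rintegral _ _ _ mu _ (fun r => dot (p r) (f r) + dot (p r) (d r))); last first.
  by move=> r _; rewrite dotDr.
rewrite RintegralD//; [|exact: (locint_dot cp sf.1)|exact: (locint_dot cp sd.1)].
have pb r : s <= r <= t -> enorm (p r) <= k * enorm w.
  move=> /andP[sr rt]; rewrite -(enormJ JT JJ w) -pt kE; apply: (hsol_bound_le al0 bAp hp).
  by rewrite ler0_norm ?subr_le0// opprB /t lerBlDr addrC lerD2l.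
have kw0 : 0 <= k * enorm w by rewrite mulr_ge0 ?enorm_ge0.
have tst : t - s = tau by rewrite /t addrC addKr.
have I1 := Rintegral_dot_le cp sf kw0 st pb.
have I2 := Rintegral_dot_le cp sd kw0 st pb.
have c0 : 0 <= dl * (k * (enorm (u s) + Num.sqrt tau * energy f s t)).
  by rewrite !mulr_ge0// addr_ge0// mulr_ge0// sqrtr_ge0.
have E2 : energy d s t <= dl * (k * (enorm (u s) + Num.sqrt tau * energy f s t)) * Num.sqrt tau.
  rewrite -tst; apply: energy_le => //; rewrite ?tst//; first exact: sd.2.
  move=> r /andP[sr rt]; apply: (le_trans (enorm_mul _ _)).
  apply: ler_pM; rewrite ?mnorm_ge0 ?enorm_ge0//; first exact: hd.
  by rewrite kE; apply: (sol_bound al0 bA sA cA sf hu sr rt); rewrite tst.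
rewrite tst in I1 I2.
apply: (le_trans (ler_normD _ _)).
apply: (le_trans (lerD I1 (le_trans I2 (ler_wpM2l _ E2)))).
  by rewrite mulr_ge0 ?sqrtr_ge0.
have sq : Num.sqrt tau * Num.sqrt tau = tau by rewrite -expr2 sqr_sqrtr.
rewrite le_eqVlt; apply/orP; left; apply/eqP.
move: (energy f s t) (enorm w) (enorm (u s)) (Num.sqrt tau) sq => e W U q sq.
rewrite -sq; ring.
Qed.

End Estimates.

(** * Solutions on a half-line *)

Section HalfLine.
Variables (R : realType) (n : nat) (J : 'M[R]_n).
Hypotheses (JT : J^T = - J) (JJ : J *m J = - 1%:M).
Local Notation mu := (@lebesgue_measure R).
Local Notation V := ('cV[R]_n).
Variables (A X : R -> 'M[R]_n) (al : R).
Hypotheses (al0 : 0 <= al) (bA : forall t, mnorm (A t) <= al)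
  (sA : forall t, (A t)^T = A t) (cA : mcont A) (fX : flow_of J A X).

(** With [X] the flow, these vectors form the stable subspace at plus infinity. *)
Definition stable (a : V) := forall e, 0 < e ->
  exists t0, forall t, t0 <= t -> enorm (X t *m a) <= e.

Definition pairing_vanishes (u : R -> V) (a : V) := forall e, 0 < e ->
  exists t0, forall t, t0 <= t -> `|dot (X t *m a) (J *m u t)| <= e.

(** The discrete form of exponential dichotomy that survives a perturbation tending
to zero: on a grid of times a quadratic form grows by at least the square of the
solution, up to the energy of the inhomogeneity. *)
Definition expanding (tau : R) (P Q : 'M[R]_n) (k0 : nat) (C : R) :=
  forall u f, sqloc f -> sol J A u f -> forall k, (k0 <= k)%N ->
    8^-1 * enorm (u (k%:R * tau)) ^+ 2 <=
    qform P Q (u (k.+1%:R * tau)) - qform P Q (u (k%:R * tau)) +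
    C * \int[mu]_(r in `[k%:R * tau, k.+1%:R * tau]) dot (f r) (f r).

(** The step is a multiple of the period for which the monodromy matrix doubles on
one half of the space and halves on the other; far out, the deviation from the
periodic flow is small enough to be absorbed by the growth of the form. *)
Lemma asymptotic_expanding Ap XP T : (forall t, mnorm (Ap t) <= al) ->
    (forall t, (Ap t)^T = Ap t) -> mcont Ap -> flow_of J Ap XP ->
    0 < T -> (forall t, Ap (t + T) = Ap t) ->
    (forall e, 0 < e -> exists t0, forall t, t0 <= t -> mnorm (A t - Ap t) <= e) ->
    (forall z, eigenvalue (map_mx (real_complex R) (XP T)) z -> `|z| != 1) ->
  exists tau P Q k0 C, [/\ 0 < tau, P + Q = 1%:M,
    (\rank P + \rank P = n)%N /\ (\rank Q + \rank Q = n)%N, 0 <= C &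
    expanding tau P Q k0 C].
Proof.
move=> bAp sAp cAp fXP T0 perAp lim hyp.
have [P [m [m0 rP rQ h]]] := hyperbolic_splitting JT JJ
  (flow_symplectic JT JJ sAp cAp fXP T) hyp.
pose Q := 1%:M - P; pose tau := m%:R * T.
have PQ : P + Q = 1%:M by rewrite /Q subrKC.
have tau0 : 0 < tau by rewrite mulr_gt0// ltr0n.
have Mm : XP T ^+ m = XP tau.
  have := flow_periodic JT JJ sAp cAp fXP perAp m 0.
  by rewrite add0r fXP.1 mul1mx.
rewrite Mm in h.
pose k := expR (al * tau); have k0 : 0 < k := expR_gt0 _.
pose qb := qbound P Q; have qb0 : 0 <= qb := qbound_ge0 P Q.
pose ep := (96 * qb + 1)^-1.
have den : 0 < 96 * qb + 1 by rewrite ltr_wpDl// mulr_ge0.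
have ep0 : 0 < ep by rewrite invr_gt0.
have ep1 : 96 * qb * ep ^+ 2 <= 1.
  have e1 : ep <= 1 by rewrite invf_le1// lerDr mulr_ge0.
  have e2 : 96 * qb * ep <= 1 by rewrite ler_pdivrMr// mul1r lerDl.
  rewrite expr2 mulrA -[leRHS](mulr1 1) ler_pM// ?mulr_ge0// ltW//.
pose dl := ep / (k * tau * k).
have dl0 : 0 < dl by apply: divr_gt0 => //; do 2!(apply: mulr_gt0 => //).
have dlE : k * tau * dl * k = ep.
  by rewrite /dl; field; rewrite !gt_eqF.
have [t0 ht0] := lim _ dl0.
pose C1 := k * Num.sqrt tau + ep * Num.sqrt tau.
pose K0 := Num.bound (`|t0| / tau).
exists tau, P, Q, K0, (96 * qb * C1 ^+ 2); split => //.
  by apply: mulr_ge0; [exact: mulr_ge0|exact: sqr_ge0].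
move=> u f sf hu j K0j; set s := j%:R * tau.
have sS : j.+1%:R * tau = s + tau by rewrite /s -natr1 mulrDl mul1r.
have t0s : t0 <= s.
  rewrite (le_trans (ler_norm _))// -ler_pdivrMr// ltW//.
  apply: (lt_le_trans (archi_boundP _)); first by rewrite divr_ge0// ltW.
  by rewrite ler_nat.
have per t : Ap (t - s) = Ap t.
  have := periodic_mul perAp (j * m) (t - s).
  by rewrite natrM -mulrA -/tau -/s subrK => ->.
have := step_estimate JT JJ al0 (ltW tau0) (ltW dl0) bA bAp sA sAp cA cAp fXP per
  (fun t st => ht0 t (le_trans t0s st)) sf hu (erefl k).
rewrite dlE -/C1 sS -sqr_energy; set e := energy f s (s + tau).
set x := u s; set y := u (s + tau) => hxy.
have e0 : 0 <= e := energy_ge0 _ _ _.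
have [Pc Ps Qu] : [/\ forall x : V, P *m (XP tau *m x) = XP tau *m (P *m x),
    forall x : V, enorm (XP tau *m (P *m x)) <= 2^-1 * enorm (P *m x) &
    forall x : V, enorm (Q *m x) <= 2^-1 * enorm (XP tau *m (Q *m x))].
  by split => z; have [] := h z.
have c0 : 0 <= 96 * qb * C1 ^+ 2 by apply: mulr_ge0; [exact: mulr_ge0|exact: sqr_ge0].
apply: (qform_growth PQ Pc Ps Qu) => //; first by rewrite mulr_ge0 ?sqr_ge0.
have C10 : 0 <= C1 by rewrite addr_ge0// mulr_ge0 ?sqrtr_ge0// ltW.
move: hxy; rewrite -/qb; move: (enorm_ge0 x) (enorm_ge0 (y - XP tau *m x)).
move: (enorm x) (enorm (y - XP tau *m x)) => xx hh x0 h0 hxy.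
have : hh ^+ 2 <= 2 * (ep ^+ 2 * xx ^+ 2) + 2 * (C1 ^+ 2 * e ^+ 2).
  apply: (@le_trans _ _ ((ep * xx + C1 * e) ^+ 2)).
    by rewrite ler_pXn2r ?nnegrE// addr_ge0// mulr_ge0// ltW.
  by have := sqr_ge0 (ep * xx - C1 * e); nra.
move=> /(ler_wpM2l (mulr_ge0 (ler0n _ 48) qb0))/le_trans; apply.
have := ler_wpM2r (sqr_ge0 xx) ep1.
move: (ep ^+ 2) (xx ^+ 2) (C1 ^+ 2) (e ^+ 2) => E2 X2 C2 F2; nra.
Qed.

Section Grid.
Variables (tau : R) (P Q : 'M[R]_n) (k0 : nat) (C : R).
Hypotheses (tau0 : 0 < tau) (PQ : P + Q = 1%:M)
  (rP : (\rank P + \rank P = n)%N) (rQ : (\rank Q + \rank Q = n)%N)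
  (C0 : 0 <= C) (grow : expanding tau P Q k0 C).
Local Notation tk := (fun k : nat => k%:R * tau).
Local Notation q := (qform P Q).
Local Notation kap := (expR (al * tau)).

Let tk_le j k : (j <= k)%N -> tk j <= tk k.
Proof. by move=> jk; rewrite /= ler_pM2r// ler_nat. Qed.

Let tkS k : tk k.+1 = tk k + tau.
Proof. by rewrite /= -natr1 mulrDl mul1r. Qed.

Lemma growth_sum u f k K : sqloc f -> sol J A u f -> (k0 <= k)%N -> (k <= K)%N ->
  8^-1 * \sum_(k <= j < K) enorm (u (tk j)) ^+ 2 <=
  q (u (tk K)) - q (u (tk k)) + C * \int[mu]_(r in `[tk k, tk K]) dot (f r) (f r).
Proof.
move=> sf hu k0k; elim: K => [|K ih].
  by rewrite leqn0 => /eqP ->; rewrite big_geq// mulr0 subrr set_itv1 Rintegral_set1 mulr0 addr0.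
rewrite leq_eqVlt => /predU1P[<-|]; last rewrite ltnS => kK.
  by rewrite big_geq// mulr0 subrr set_itv1 Rintegral_set1 mulr0 addr0.
rewrite big_nat_recr//= mulrDr.
rewrite (Rintegral_itv_cat sf.2 (tk_le kK) (tk_le (leqnSn K))) mulrDr.
have arith (a b x y z i j : R) : a <= y - x + i -> b <= z - y + j -> a + b <= z - x + (i + j).
  by move=> *; lra.
exact: arith (ih kK) (grow sf hu (leq_trans k0k kK)).
Qed.

Let zero_sqloc : sqloc (fun=> 0 : V).
Proof. by apply: vcont_sqloc; exact: vcont_cst. Qed.

Lemma growth_sum0 a k K : (k0 <= k)%N -> (k <= K)%N ->
  8^-1 * \sum_(k <= j < K) enorm (X (tk j) *m a) ^+ 2 <=
  q (X (tk K) *m a) - q (X (tk k) *m a).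
Proof.
move=> k0k kK; have := growth_sum zero_sqloc (hsol_sol cA (flow_hsol fX a)) k0k kK.
have -> : \int[mu]_(r in `[tk k, tk K]) dot (0 : V) 0 = 0.
  by rewrite dot0l /Rintegral integral0.
by rewrite mulr0 addr0.
Qed.

Lemma grid_index t : 0 <= t -> exists k, tk k <= t <= tk k.+1.
Proof.
move=> t0; exists (Num.trunc (t / tau)).
have /andP[h1 h2] := truncn_itv (divr_ge0 t0 (ltW tau0)).
by rewrite -ler_pdivlMr// h1/= -ler_pdivrMr// ltW.
Qed.

Lemma stable_of_grid a : (forall e, 0 < e -> exists K0, forall k, (K0 <= k)%N ->
    enorm (X (tk k) *m a) <= e) -> stable a.
Proof.
move=> h e e0.
have [K0 hK] := h (e / kap) (divr_gt0 e0 (expR_gt0 _)).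
exists (tk K0.+1) => t tt.
have t0 : 0 <= t by apply: le_trans tt; rewrite mulr_ge0// ltW.
have [k /andP[kt tk1]] := grid_index t0.
have Kk : (K0 <= k)%N.
  by have := le_trans tt tk1; rewrite /= ler_pM2r// ler_nat.
have hp := flow_hsol fX a.
apply: (le_trans (hsol_bound_le JT JJ (s := tk k) (tau := tau) al0 bA hp _)).
  by rewrite ger0_norm ?subr_ge0// lerBlDr addrC -tkS.
by rewrite mulrC -ler_pdivlMr ?expR_gt0// hK.
Qed.

Lemma stable_grid a : stable a -> forall e, 0 < e -> exists K0, forall k, (K0 <= k)%N ->
  enorm (X (tk k) *m a) <= e.
Proof.
move=> sa e e0; have [t0 ht] := sa e e0.
exists (Num.bound (`|t0| / tau)) => k Kk; apply: ht.
rewrite (le_trans (ler_norm _))// -ler_pdivrMr// ltW//.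
apply: (lt_le_trans (archi_boundP _)); first by rewrite divr_ge0// ltW.
by rewrite ler_nat.
Qed.

Lemma stable_qform_small a : stable a -> forall e, 0 < e -> forall K1, exists2 K,
  (K1 <= K)%N & q (X (tk K) *m a) <= e.
Proof.
move=> sa e e0 K1.
have qb1 : 0 < qbound P Q + 1 by rewrite ltr_wpDl// qbound_ge0.
pose d := Num.min 1 (e / (qbound P Q + 1)).
have d0 : 0 < d by rewrite lt_min ltr01 divr_gt0.
have [K0 hK] := stable_grid sa d0.
exists (maxn K0 K1); first exact: leq_maxr.
have h := hK _ (leq_maxl K0 K1).
apply: (le_trans (qform_le P Q _)).
have d1 : d <= 1 by rewrite ge_min lexx.
have d2 : d * (qbound P Q + 1) <= e by rewrite -ler_pdivlMr// ge_min lexx orbT.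
have x0 := enorm_ge0 (X (tk (maxn K0 K1)) *m a).
move: h x0; set x := enorm _ => h x0.
have xd : x ^+ 2 <= d by rewrite expr2 -[leRHS](mulr1 d); apply: ler_pM => //; exact: le_trans d1.
have qb0 := qbound_ge0 P Q; apply: le_trans d2.
rewrite mulrDr mulr1 (mulrC d); apply: ler_wpDr; first exact: ltW.
exact: ler_wpM2l.
Qed.

Lemma stable_sum a k K : stable a -> (k0 <= k)%N -> (k <= K)%N ->
  8^-1 * \sum_(k <= j < K) enorm (X (tk j) *m a) ^+ 2 <= - q (X (tk k) *m a).
Proof.
move=> sa k0k kK; apply/ler_addgt0Pr => e e0.
have [L KL qL] := stable_qform_small sa e0 K.
have := growth_sum0 a k0k (leq_trans kK KL).
rewrite (big_cat_nat kK KL)/= mulrDr => h.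
have s0 : 0 <= 8^-1 * \sum_(K <= j < L) enorm (X (tk j) *m a) ^+ 2.
  by rewrite mulr_ge0 ?invr_ge0//; apply: sumr_ge0 => j _; exact: sqr_ge0.
have arith (x y z w : R) : x + y <= z - w -> 0 <= y -> z <= e -> x <= - w + e.
  by move=> *; lra.
exact: arith h s0 qL.
Qed.

(** The form is increasing along the orbit and tends to zero, so it is negative, by
at least the amount of its next increment. *)
Lemma stable_qform_le a k : stable a -> (k0 <= k)%N ->
  q (X (tk k) *m a) <= - (8^-1 * enorm (X (tk k) *m a) ^+ 2).
Proof.
by move=> sa k0k; rewrite lerNr; have := stable_sum sa k0k (leqnSn k); rewrite big_nat1.
Qed.

Lemma stable0 : stable 0.
Proof. by move=> e e0; exists 0 => t _; rewrite mulmx0 enorm0 ltW. Qed.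

Lemma stable_lin c a b : stable a -> stable b -> stable (c *: a + b).
Proof.
move=> ha hb e e0.
have c1 : 0 < `|c| + 1 by rewrite ltr_wpDl.
have [t1 h1] := ha (e / (2 * (`|c| + 1))) (divr_gt0 e0 (mulr_gt0 (ltr0n _ 2) c1)).
have [t2 h2] := hb (e / 2) (divr_gt0 e0 (ltr0n _ 2)).
exists (Num.max t1 t2) => t; rewrite ge_max => /andP[tt1 tt2].
rewrite mulmxDr -scalemxAr (le_trans (enormD _ _))// enormZ [leRHS](splitr e) lerD ?h2//.
have h := h1 _ tt1; apply: (@le_trans _ _ ((`|c| + 1) * enorm (X t *m a))).
  by rewrite ler_wpM2r ?enorm_ge0// lerDl.
by move: h; rewrite ler_pdivlMr ?mulr_gt0// => h; rewrite ler_pdivlMr//; lra.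
Qed.

Lemma stable_isotropic a b : stable a -> stable b -> dot a (J *m b) = 0.
Proof.
move=> ha hb; apply/eqP; rewrite -normr_le0; apply/ler_addgt0Pr => e e0; rewrite add0r.
pose d := Num.min 1 e; have d0 : 0 < d by rewrite lt_min ltr01.
have [d1 de] : d <= 1 /\ d <= e by split; rewrite ge_min lexx ?orbT.
have [t1 h1] := ha d d0; have [t2 h2] := hb d d0.
pose t := Num.max t1 t2.
have x1 : enorm (X t *m a) <= d by apply: h1; rewrite le_max lexx.
have x2 : enorm (X t *m b) <= d by apply: h2; rewrite le_max lexx orbT.
have := hsol_pairing_cst JT JJ sA cA 0 t (flow_hsol fX a) (flow_hsol fX b).
rewrite fX.1 !mul1mx => ->; apply: (le_trans (dot_cs _ _)); rewrite (enormJ JT JJ).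
apply: le_trans de; rewrite -[leRHS](mulr1 d); apply: ler_pM; rewrite ?enorm_ge0//.
exact: le_trans x2 d1.
Qed.

(** A convergent sum of squares over the grid forces decay along the grid, hence
everywhere by the growth bound between grid points. *)
Lemma bounded_orbit_stable a B : (forall K, (k0 <= K)%N ->
    \sum_(k0 <= j < K) enorm (X (tk j) *m a) ^+ 2 <= B) -> stable a.
Proof.
move=> h; apply: stable_of_grid => e e0.
have [K hK] := bounded_sum_small (fun k => sqr_ge0 _) h (exprn_gt0 2 e0).
exists K => k Kk; have := hK _ Kk.
by rewrite ler_pXn2r ?nnegrE ?enorm_ge0// ltW.
Qed.

(** If the space of stable vectors were too small, at each grid time there would be
a unit vector orthogonal to it whose orbit is at that time in the contracted
subspace. The form is then nonpositive along the orbit up to that time; a cluster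
point of these vectors has nonpositive form at all grid times, hence is stable, and
yet is orthogonal to the stable vectors. *)
Lemma stable_dim (E : 'M[R]_n) : (forall a, stable a <-> (a^T <= E)%MS) ->
  (\rank P <= \rank E)%N.
Proof.
move=> hE; rewrite leqNgt; apply/negP => rE.
have ex k : exists v : V, [/\ enorm v = 1, Q *m (X (tk k) *m v) = 0 & E *m v = 0].
  pose K := row_mx (Q *m X (tk k))^T E^T.
  have rK : (\rank K < n)%N.
    apply: (@leq_ltn_trans (\rank Q + \rank E)); last by move: rP rQ rE; lia.
    rewrite -mxrank_tr tr_row_mx !trmxK -addsmxE.
    apply: (leq_trans (mxrank_adds_leqif _ _).1); rewrite leq_add2r.
    exact: mxrankM_maxl.
  have : kermx K != 0 by rewrite -mxrank_eq0 mxrank_ker subn_eq0 -ltnNge.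
  move=> /rowV0Pn[v /sub_kermxP vK v0].
  have := vK; rewrite mul_mx_row -(row_mx0 R 1 n n) => /eq_row_mx[v1 v2].
  have nv : enorm v^T != 0.
    by apply: contra v0 => /eqP/enorm_eq0/(congr1 trmx); rewrite trmxK trmx0 => ->.
  exists ((enorm v^T)^-1 *: v^T); split.
  - by rewrite enormZ ger0_norm ?invr_ge0 ?enorm_ge0// mulVf.
  - rewrite -!scalemxAr mulmxA (_ : _ *m v^T = 0) ?scaler0//.
    by apply: trmx_inj; rewrite trmx_mul trmxK trmx0.
  - rewrite -scalemxAr (_ : _ *m v^T = 0) ?scaler0//.
    by apply: trmx_inj; rewrite trmx_mul trmxK trmx0.
pose v k : V := projT1 (cid (ex k)).
have vP k : [/\ enorm (v k) = 1, Q *m (X (tk k) *m v k) = 0 & E *m v k = 0].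
  exact: projT2 (cid (ex k)).
have [a a1 ha] := unit_cluster (fun k => let: And3 h _ _ := vP k in h).
have qa j : (k0 <= j)%N -> q (X (tk j) *m a) <= 0.
  move=> k0j; pose g (w : 'rV[R]_n) := dot ((Q *m X (tk j)) *m w^T) ((Q *m X (tk j)) *m w^T)
     - dot ((P *m X (tk j)) *m w^T) ((P *m X (tk j)) *m w^T).
  have gE x : g x^T = q (X (tk j) *m x) by rewrite /g trmxK !dotvv -!mulmxA.
  rewrite -gE; apply: ha.
    by move=> w; apply: (@cvgB _ _ _ (nbhs w)); exact: continuous_dot_rV.
  exists j => k jk; rewrite gE; have [_ h _] := vP k.
  have := growth_sum0 (v k) k0j jk; rewrite [q (X (tk k) *m _)]/qform h enorm0 expr0n/= sub0r.
  have s0 : 0 <= 8^-1 * \sum_(j <= i < k) enorm (X (tk i) *m v k) ^+ 2.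
    by rewrite mulr_ge0 ?invr_ge0//; apply: sumr_ge0 => i _; exact: sqr_ge0.
  have arith (x y z : R) : x <= - y - z -> 0 <= x -> 0 <= y -> z <= 0 by move=> *; lra.
  move=> /arith; apply => //; exact: sqr_ge0.
have sa : stable a.
  apply: (@bounded_orbit_stable _ (8 * - q (X (tk k0) *m a))) => K k0K.
  have := growth_sum0 a (leqnn k0) k0K; have := qa K k0K.
  have arith (x y z : R) : y <= 0 -> 8^-1 * x <= y - z -> x <= 8 * - z by move=> *; lra.
  exact: arith.
have Ea : E *m a = 0.
  apply/colP => i; rewrite [RHS]mxE; apply/eqP.
  have rowE x : dot (row i E)^T x = (E *m x) i 0.
    by rewrite /dot trmxK -row_mul mxE.
  have h (w : V) : (forall k, dot w (v k) = 0) -> dot w a <= 0.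
    move=> w0; rewrite -(trmxK a); apply: (ha (fun x => dot w x^T)).
      exact: continuous_dotl_rV.
    by exists 0%N => k _; rewrite trmxK w0.
  have h0 k : dot (row i E)^T (v k) = 0 by rewrite rowE; have [_ _ ->] := vP k; rewrite mxE.
  rewrite eq_le -rowE h//= -oppr_le0 -dotNl h// => k.
  by rewrite dotNl h0 oppr0.
have /submxP[c cE] := (hE a).1 sa.
have : dot a a = 0 by rewrite /dot cE -mulmxA Ea mulmx0 mxE.
by rewrite dotvv a1 expr1n => /eqP; rewrite oner_eq0.
Qed.

(** The stable space is isotropic and has at least half the dimension, so it is its
own symplectic complement. *)
Lemma stable_lagrangian a : (forall b, stable b -> dot b (J *m a) = 0) -> stable a.
Proof.
have [E hE] := subspace_matrix stable0 stable_lin.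
have rE := stable_dim hE.
move=> ha; apply/hE.
have subE : (E <= kermx (E *m J)^T)%MS.
  apply/sub_kermxP; rewrite trmx_mul JT mulNmx mulmxN; apply/eqP; rewrite oppr_eq0; apply/eqP.
  apply/matrixP => i j; rewrite [RHS]mxE.
  have st k : stable (row k E)^T by apply/hE; rewrite trmxK row_sub.
  have := stable_isotropic (st i) (st j).
  have E2 (M : 'M[R]_n) : (row i E *m col j M) 0 0 = (E *m M) i j.
    by rewrite !mxE; apply: eq_bigr => k _; rewrite !mxE.
  by rewrite /dot trmxK tr_row !colE (mulmxA J) -colE E2.
have Ju : J \in unitmx.
  have JJ1 : J *m (- J) = 1%:M by rewrite mulmxN JJ opprK.
  by have [] := mulmx1_unit JJ1.
have rk : \rank (kermx (E *m J)^T) = (n - \rank E)%N.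
  by rewrite mxrank_ker mxrank_tr mxrankMfree ?row_free_unit.
have /mxrank_leqif_sup [le e] := subE.
have : (kermx (E *m J)^T <= E)%MS.
  by rewrite -e eqn_leq le rk; move: rP rE (rank_leq_row E); lia.
apply: submx_trans; apply/sub_kermxP.
rewrite -trmx_mul; apply: trmx_inj; rewrite trmxK trmx0 -mulmxA.
apply/colP => i; rewrite [RHS]mxE.
have st : stable (row i E)^T by apply/hE; rewrite trmxK row_sub.
by have := ha _ st; rewrite /dot trmxK -row_mul mxE.
Qed.

(** A Lagrangian subspace and its image under [J] are orthogonal complements; this
is applied to the stable space transported to time [tk k]. *)
Lemma stable_complement k u : exists a b, [/\ stable a, stable b &
  u = X (tk k) *m a + J *m (X (tk k) *m b)].
Proof.
have [E hE] := subspace_matrix stable0 stable_lin.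
have [e [d [ue eE dE]]] := orthogonal_decomposition (E *m (X (tk k))^T) u.
have /submxP[c cE] := eE.
pose I := flow_inv J X (tk k).
have XI : X (tk k) *m I = 1%:M := flow_Kinv JT JJ sA cA fX (tk k).
exists (c *m E)^T, (I *m (- (J *m d))); split.
- by apply/hE; rewrite trmxK submxMl.
- apply: stable_lagrangian => b /hE/submxP[z zE].
  have : dot (X (tk k) *m b) d = 0.
    by rewrite /dot trmx_mul zE -!mulmxA (mulmxA E) dE mulmx0 mxE.
  have <- : dot (X (tk k) *m b) (J *m (X (tk k) *m (I *m (- (J *m d))))) =
      dot b (J *m (I *m (- (J *m d)))).
    rewrite dot_mull (mulmxA J) (mulmxA (X _)^T) (mulmxA (X _)^T J).
    by rewrite (flow_symplectic JT JJ sA cA fX).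
  by rewrite (mulmxA (X _) I) XI mul1mx mulmxN JK// opprK.
- rewrite (mulmxA (X _) I) XI mul1mx mulmxN JK// opprK ue; congr (_ + _).
  by rewrite -[LHS]trmxK cE mulmxA trmx_mul trmxK.
Qed.

(** Green's identity from time [tk k] to infinity, where the pairing vanishes, and
the fact that the energy of a stable orbit after time [tk k] is controlled by its
value there. *)
Lemma grid_pairing_const : exists2 c, 0 <= c & forall u f b k,
    f \in @sqint R n -> sol J A u f -> stable b -> pairing_vanishes u b ->
    (k0 <= k)%N ->
  `|dot (X (tk k) *m b) (J *m u (tk k))| <= c * l2norm f * enorm (X (tk k) *m b).
Proof.
pose qb := qbound P Q; have qb0 : 0 <= qb := qbound_ge0 P Q.
pose c2 := tau * kap ^+ 2 * (8 * qb).
have c20 : 0 <= c2 by apply: mulr_ge0; apply: mulr_ge0; rewrite ?sqr_ge0// ltW.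
exists (Num.sqrt c2); first exact: sqrtr_ge0.
move=> u f b k hf hu sb hub k0k.
set w := X (tk k) *m b; pose F := l2norm f.
have F0 : 0 <= F := l2norm_ge0 f.
have sf := sqint_sqloc hf.
have cv : vcont (fun t => X t *m b) := hsol_vcont (flow_hsol fX b).
have sv := vcont_sqloc cv.
have hb := flow_hsol fX b.
(* Summing the growth of the form along the orbit of [b] bounds its energy after
   time [tk k] by its value there. *)
have mass L : (k <= L)%N ->
    \int[mu]_(r in `[tk k, tk L]) dot (X r *m b) (X r *m b) <= c2 * enorm w ^+ 2.
  move=> kL.
  have step : \int[mu]_(r in `[tk k, tk L]) dot (X r *m b) (X r *m b) <=
      tau * kap ^+ 2 * \sum_(k <= j < L) enorm (X (tk j) *m b) ^+ 2.
    elim: L kL => [|L ih].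
      by rewrite leqn0 => /eqP ->; rewrite big_geq// mulr0 set_itv1 Rintegral_set1.
    rewrite leq_eqVlt => /predU1P[<-|].
      by rewrite big_geq// mulr0 set_itv1 Rintegral_set1.
    rewrite ltnS => kL; rewrite big_nat_recr//= mulrDr.
    rewrite (Rintegral_itv_cat sv.2 (tk_le kL) (tk_le (leqnSn L))).
    apply: lerD; first exact: ih.
    have := energy_le (c := kap * enorm (X (tk L) *m b)) _ (tk_le (leqnSn L)) sv.2.
    rewrite mulr_ge0 ?expR_ge0 ?enorm_ge0// => /(_ isT) h.
    have {}h : energy (fun t => X t *m b) (tk L) (tk L.+1) <=
        kap * enorm (X (tk L) *m b) * Num.sqrt (tk L.+1 - tk L).
      apply: h => r /andP[r1 r2]; apply: (hsol_bound_le JT JJ al0 bA hb).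
      by rewrite ger0_norm ?subr_ge0// lerBlDl -tkS.
    have tt : tk L.+1 - tk L = tau by rewrite tkS addrC addKr.
    rewrite -sqr_energy; rewrite tt in h.
    have -> : tau * kap ^+ 2 * enorm (X (tk L) *m b) ^+ 2 =
      (kap * enorm (X (tk L) *m b) * Num.sqrt tau) ^+ 2.
      by rewrite !exprMn (sqr_sqrtr (ltW tau0)); ring.
    rewrite ler_pXn2r ?nnegrE ?energy_ge0// mulr_ge0 ?sqrtr_ge0//.
    by rewrite mulr_ge0 ?expR_ge0 ?enorm_ge0.
  apply: (le_trans step); rewrite /c2 -[leRHS]mulrA; apply: ler_wpM2l.
    by apply: mulr_ge0; [exact: ltW|exact: sqr_ge0].
  rewrite -[leRHS]mulrA.
  have := stable_sum sb k0k kL; have := qform_ge P Q (X (tk k) *m b).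
  have arith (s qq m : R) : - m <= qq -> 8^-1 * s <= - qq -> s <= 8 * m by move=> *; lra.
  exact: arith.
rewrite -/w -/F; apply/ler_addgt0Pr => e e0.
have [t0 ht0] := hub e e0.
pose L := maxn k (Num.bound (`|t0| / tau)).
have kL : (k <= L)%N by exact: leq_maxl.
have t0L : t0 <= tk L.
  rewrite (le_trans (ler_norm _))// -ler_pdivrMr// ltW//.
  apply: (lt_le_trans (archi_boundP _)); first by rewrite divr_ge0// ltW.
  by rewrite ler_nat leq_maxr.
have := green JT JJ sA cA sf.1 hb hu (tk_le kL) => g.
have {}g := norm_diff_le (etrans (esym (opprB _ _)) (congr1 -%R g)).
rewrite normrN in g; apply: (le_trans g); rewrite addrC; apply: lerD; last exact: ht0.
apply: ler_enorm_sqr => //; first by rewrite !mulr_ge0 ?sqrtr_ge0 ?enorm_ge0.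
rewrite real_normK ?num_real//.
have svf : locint (fun t => dot (X t *m b) (f t)) := locint_dot cv sf.1.
apply: (le_trans (Rintegral_cs _ (sv.2 _ _) (sf.2 _ _) (svf _ _))) => //.
have -> : (Num.sqrt c2 * F * enorm w) ^+ 2 = c2 * enorm w ^+ 2 * F ^+ 2.
  by rewrite !exprMn (sqr_sqrtr c20); ring.
apply: ler_pM; first by apply: Rintegral_ge0 => r _; exact: dotvv_ge0.
- by apply: Rintegral_ge0 => r _; exact: dotvv_ge0.
- exact: mass.
- rewrite /F sqr_l2norm//; apply: integral_le_T; first exact: sqint_dot_integrable.
  by move=> r; exact: dotvv_ge0.
Qed.

(** At each grid time the solution is decomposed along the stable space and its
image under [J]. The second component is bounded by the pairing with stable
solutions, hence by the norm of [f], and the form is negative on the first; so the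
form is bounded along [u], and its growth then bounds the sum of squares. *)
Lemma half_line_bounded u f : f \in @sqint R n -> sol J A u f ->
    (forall a, stable a -> pairing_vanishes u a) ->
  exists B, forall t, 0 <= t -> \int[mu]_(r in `[0, t]) dot (u r) (u r) <= B.
Proof.
move=> hf hu hpair; have [c c0 hc] := grid_pairing_const.
have sf := sqint_sqloc hf; have su := vcont_sqloc hu.1.
pose F := l2norm f; have F0 : 0 <= F := l2norm_ge0 f.
have intF s t : \int[mu]_(r in `[s, t]) dot (f r) (f r) <= F ^+ 2.
  rewrite /F sqr_l2norm//; apply: integral_le_T; first exact: sqint_dot_integrable.
  by move=> r; exact: dotvv_ge0.
have u0 s t : 0 <= \int[mu]_(r in `[s, t]) dot (u r) (u r).
  by apply: Rintegral_ge0 => r _; exact: dotvv_ge0.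
pose D := (qbound P Q ^+ 2 / 8^-1 + qbound P Q) * (c * F) ^+ 2.
have qu k : (k0 <= k)%N -> q (u (tk k)) <= D.
  move=> k0k; have [a [b [sa sb uE]]] := stable_complement k (u (tk k)).
  set e := X (tk k) *m a in uE; set w := X (tk k) *m b in uE.
  have wb : enorm w <= c * F.
    have := hc u f b k hf hu sb (hpair b sb) k0k; rewrite -/w -/F.
    rewrite uE mulmxDr JK// dotDr dotNr.
    have -> : dot w (J *m e) = 0.
      have := hsol_pairing_cst JT JJ sA cA (tk k) 0 (flow_hsol fX b) (flow_hsol fX a).
      by rewrite fX.1 !mul1mx (stable_isotropic sb sa) => h; exact: h.
    rewrite add0r normrN dotvv ger0_norm ?sqr_ge0// expr2.
    have [->|w0] := eqVneq (enorm w) 0; first by rewrite mulr_ge0.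
    by rewrite ler_pM2r// lt_neqAle eq_sym w0 enorm_ge0.
  rewrite uE; apply: (@le_trans _ _
      ((qbound P Q ^+ 2 / 8^-1 + qbound P Q) * enorm (J *m w) ^+ 2)).
    by apply: qform_add_le => //; exact: stable_qform_le.
  rewrite /D enormJ//; apply: ler_wpM2l.
    by rewrite addr_ge0 ?qbound_ge0// divr_ge0// sqr_ge0.
  by rewrite ler_pXn2r ?nnegrE ?enorm_ge0// mulr_ge0.
pose S := 8 * (D - q (u (tk k0)) + C * F ^+ 2).
have sumS K : (k0 <= K)%N -> \sum_(k0 <= j < K) enorm (u (tk j)) ^+ 2 <= S.
  move=> k0K; have := growth_sum sf hu (leqnn k0) k0K.
  have h2 := ler_wpM2l C0 (intF (tk k0) (tk K)); have h1 := qu K k0K.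
  have arith (s x y z v w : R) : x <= v -> z <= w -> 8^-1 * s <= x - y + z -> s <= 8 * (v - y + w).
    by move=> *; lra.
  exact: arith h1 h2.
have massS K : (k0 <= K)%N -> \int[mu]_(r in `[tk k0, tk K]) dot (u r) (u r) <=
    tau * kap ^+ 2 * (2 * \sum_(k0 <= j < K) enorm (u (tk j)) ^+ 2 +
      2 * tau * \int[mu]_(r in `[tk k0, tk K]) dot (f r) (f r)).
  elim: K => [|K ih].
    by rewrite leqn0 => /eqP ->; rewrite big_geq// set_itv1 !Rintegral_set1 !mulr0 addr0 mulr0.
  rewrite leq_eqVlt => /predU1P[<-|].
    by rewrite big_geq// set_itv1 !Rintegral_set1 !mulr0 addr0 mulr0.
  rewrite ltnS => k0K; rewrite big_nat_recr//=.
  rewrite (Rintegral_itv_cat su.2 (tk_le k0K) (tk_le (leqnSn K))).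
  rewrite (Rintegral_itv_cat sf.2 (tk_le k0K) (tk_le (leqnSn K))).
  have stp : \int[mu]_(r in `[tk K, tk K.+1]) dot (u r) (u r) <=
      tau * kap ^+ 2 * (2 * enorm (u (tk K)) ^+ 2 +
        2 * tau * \int[mu]_(r in `[tk K, tk K.+1]) dot (f r) (f r)).
    rewrite -!sqr_energy; set ef := energy f _ _; set U := enorm _.
    have [ef0 U0] : 0 <= ef /\ 0 <= U by split; [exact: energy_ge0|exact: enorm_ge0].
    have b0 : 0 <= kap * (U + Num.sqrt tau * ef).
      by rewrite mulr_ge0 ?expR_ge0// addr_ge0// mulr_ge0 ?sqrtr_ge0.
    have h : energy u (tk K) (tk K.+1) <= kap * (U + Num.sqrt tau * ef) * Num.sqrt (tk K.+1 - tk K).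
      apply: energy_le => //; [exact: tk_le|exact: su.2|].
      move=> r /andP[r1 r2]; apply: (sol_bound JT JJ al0 bA sA cA sf hu r1 r2).
      by rewrite tkS addrC addKr.
    have tt : tk K.+1 - tk K = tau by rewrite tkS addrC addKr.
    rewrite tt in h.
    apply: (@le_trans _ _ ((kap * (U + Num.sqrt tau * ef) * Num.sqrt tau) ^+ 2)).
      by rewrite ler_pXn2r ?nnegrE ?energy_ge0// mulr_ge0 ?sqrtr_ge0.
    rewrite !exprMn (sqr_sqrtr (ltW tau0)) mulrC mulrA ler_wpM2l//.
      by rewrite mulr_ge0 ?sqr_ge0// ltW.
    have sq : Num.sqrt tau ^+ 2 = tau by rewrite (sqr_sqrtr (ltW tau0)).
    move: (Num.sqrt tau) sq => qt <-.
    have := sqr_ge0 (U - qt * ef); rewrite -mulrA -exprMn; nra.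
  have arith (a b k x y v w i j : R) : a <= k * (2 * x + 2 * tau * v) ->
    b <= k * (2 * y + 2 * tau * w) -> a + b <= k * (2 * (x + y) + 2 * tau * (v + w)).
    move=> h1 h2; have -> : k * (2 * (x + y) + 2 * tau * (v + w)) =
      k * (2 * x + 2 * tau * v) + k * (2 * y + 2 * tau * w) by ring.
    exact: lerD.
  exact: (arith _ _ _ _ _ _ _ 0 0 (ih k0K) stp).
pose M := tau * kap ^+ 2 * (2 * S + 2 * tau * F ^+ 2).
have massM K : (k0 <= K)%N -> \int[mu]_(r in `[tk k0, tk K]) dot (u r) (u r) <= M.
  move=> k0K; apply: (le_trans (massS K k0K)); apply: ler_wpM2l.
    by rewrite mulr_ge0 ?sqr_ge0// ltW.
  apply: lerD; first by rewrite ler_wpM2l// sumS.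
  by rewrite ler_wpM2l// mulr_ge0// ltW.
have tk0 : 0 <= tk k0 by rewrite mulr_ge0// ltW.
exists (\int[mu]_(r in `[0, tk k0]) dot (u r) (u r) + M) => t t0.
have [k /andP[_ tk1]] := grid_index t0.
pose K := maxn k0 k.+1.
have tK : t <= tk K by apply: (le_trans tk1); apply: tk_le; exact: leq_maxr.
have k0K : (k0 <= K)%N by exact: leq_maxl.
apply: (@le_trans _ _ (\int[mu]_(r in `[0, tk K]) dot (u r) (u r))).
  by rewrite (Rintegral_itv_cat su.2 t0 tK) lerDl.
by rewrite (Rintegral_itv_cat su.2 tk0 (tk_le k0K)) lerD2l massM.
Qed.

End Grid.
End HalfLine.

(** * Reversal of time *)

Section TimeReversal.
Variable R : realType.
Local Notation mu := (@lebesgue_measure R).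
Local Notation opp := (-%R : measurableTypeR R -> measurableTypeR R).
Implicit Types f : R -> \bar R.

Lemma ge0_integral_opp (D : set R) f : measurable D -> measurable_fun D f ->
  (forall t, D t -> (0 <= f t)%E) ->
  (\int[mu]_(t in opp @^-1` D) f (- t)%R = \int[mu]_(t in D) f t)%E.
Proof.
move=> mD mf f0; rewrite -[LHS](@ge0_integral_pushforward _ _ _ _ _ opp _ mu D f)//.
- by apply: eq_measure_integral => //= B mB BS; exact: lebesgue_measureN.
- by move=> t; rewrite inE; exact: f0.
Qed.

Lemma integrable_opp (D : set R) f : measurable D -> mu.-integrable D f ->
  mu.-integrable (opp @^-1` D) (fun t => f (- t)).
Proof.
move=> mD /integrableP[mf lf]; apply/integrableP; split.
  apply: (@measurable_comp _ _ _ _ _ _ D f _ opp) => //.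
  by move=> _ [t Dt <-].
by rewrite (@ge0_integral_opp D (fun t => `|f t|)%E)//; exact: measurableT_comp.
Qed.

Lemma integral_opp (D : set R) f : measurable D -> mu.-integrable D f ->
  (\int[mu]_(t in opp @^-1` D) f (- t)%R = \int[mu]_(t in D) f t)%E.
Proof.
move=> mD ff; have /integrableP[mf _] := ff.
rewrite integralE [RHS]integralE.
rewrite -(ge0_integral_opp mD (measurable_funepos mf) (fun t _ => funepos_ge0 f t)).
rewrite -(ge0_integral_opp mD (measurable_funeneg mf) (fun t _ => funeneg_ge0 f t)).
by rewrite !unlock.
Qed.

Lemma opp_preimage_segment (a b : R) : opp @^-1` `[a, b] = `[- b, - a]%classic.
Proof. by rewrite opp_preimage_itvbndbnd. Qed.

Lemma locint_opp (v : R -> R) : locint v -> locint (fun t => v (- t)).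
Proof.
move=> lv a b; have := integrable_opp _ (lv (- b) (- a)).
by rewrite opp_preimage_segment !opprK; apply.
Qed.

Lemma Rintegral_opp (v : R -> R) a b : locint v ->
  \int[mu]_(t in `[a, b]) v (- t) = \int[mu]_(t in `[- b, - a]) v t.
Proof.
move=> lv; have := integral_opp _ (lv (- b) (- a)).
by rewrite opp_preimage_segment !opprK /Rintegral => ->.
Qed.

Lemma prim_opp (u v : R -> R) : locint v -> prim u v ->
  prim (fun t => u (- t)) (fun t => - v (- t)).
Proof.
move=> lv uv a b ab; rewrite -[RHS]opprK.
have -> : (fun t => - v (- t)) = (fun t => -1 * v (- t)) by apply/funext => t; rewrite mulN1r.
rewrite RintegralZl//; last exact: locint_opp.
by rewrite Rintegral_opp// -uv ?lerN2//; ring.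
Qed.

Lemma sqint_opp n (f : R -> 'cV[R]_n) : f \in @sqint R n ->
  (fun t => f (- t)) \in @sqint R n.
Proof.
move=> hf; have hm := fun i => measurable_coord i hf; apply: sqintI => [i|].
  exact: (@measurableT_comp _ _ _ _ _ _ (fun t => f t i 0) _ opp).
have := integrable_opp measurableT (sqint_dot_integrable hf hf).
by rewrite preimage_setT.
Qed.

Lemma continuous_oppc (g : R -> R) : continuous g -> continuous (fun t => g (- t)).
Proof.
move=> cg t; apply: (@continuous_comp _ _ _ (-%R : R -> R) g); last exact: cg.
exact: opp_continuous.
Qed.

Lemma vcont_opp n (u : R -> 'cV[R]_n) : vcont u -> vcont (fun t => u (- t)).
Proof. by move=> cu i; exact: continuous_oppc (cu i). Qed.

Lemma mcont_opp n (A : R -> 'M[R]_n) : mcont A -> mcont (fun t => A (- t)).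
Proof. by move=> cA i j; exact: continuous_oppc (cA i j). Qed.

Lemma is_derive_opp (g : R -> R) (t c : R) : is_derive (- t) 1 g c ->
  is_derive t 1 (fun s => g (- s)) (- c).
Proof.
move=> hg; have := @is_derive1_comp R g -%R t c (-1) hg.
by rewrite mulrN1; apply; exact: is_deriveNid.
Qed.

Lemma sol_opp n (J : 'M[R]_n) A (u f : R -> 'cV[R]_n) : mcont A -> vloc f -> sol J A u f ->
  sol (- J) (fun t => A (- t)) (fun t => u (- t)) (fun t => f (- t)).
Proof.
move=> cA vf [cu hu]; split => [|i]; first exact: vcont_opp.
have := prim_opp _ (hu i); rewrite (_ : (fun t => - _) = fun t =>
  (- (- J *m (A (- t) *m u (- t) + f (- t)))) i 0).
  apply; apply: vlocN; apply: vloc_mulmx; apply: vlocD => //.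
  by apply: vcont_vloc; exact: vcont_mulmx.
by apply/funext => t; rewrite mulNmx [in RHS]mxE; congr (- _); rewrite mxE opprK mxE.
Qed.

Lemma flow_opp n (J : 'M[R]_n) (A X : R -> 'M[R]_n) : flow_of J A X ->
  flow_of (- J) (fun t => A (- t)) (fun t => X (- t)).
Proof.
move=> [X0 dX]; split=> [|t i j]; first by rewrite oppr0.
have := is_derive_opp (dX (- t) i j).
by rewrite mulNmx !mxE.
Qed.

End TimeReversal.

(** * Sobolev functions as solutions *)

Section MatrixNorm.
Variables (R : realType) (m n : nat).

Lemma mx_norm_le (M : 'M[R]_(m, n)) c : 0 <= c -> (forall i j, `|M i j| <= c) -> `|M| <= c.
Proof.
move=> c0 Mc; rewrite [leLHS]mx_normrE; apply: bigmax_le => // -[i j] _; exact: Mc.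
Qed.

Lemma coord_le_norm (M : 'M[R]_(m, n)) i j : `|M i j| <= `|M|.
Proof. by rewrite [leRHS]mx_normrE; apply: (le_bigmax _ (fun p => `|M p.1 p.2|) (i, j)). Qed.

Lemma cvg_mx (T : Type) (F : set_system T) (FF : Filter F) (f : T -> 'M[R]_(m, n)) (M : 'M[R]_(m, n)) :
  (forall i j, f t i j @[t --> F] --> M i j) -> f @ F --> M.
Proof.
move=> h; apply/cvgrPdist_le => e e0.
have H : \forall t \near F, forall i j, `|M i j - f t i j| <= e.
  apply: filter_forall => i; apply: filter_forall => j.
  by move: (h i j) => /cvgrPdist_le; apply.
near=> t; apply: mx_norm_le (ltW e0) _ => i j.
by rewrite !mxE; move: i j; near: t.
Unshelve. all: by end_near. Qed.

End MatrixNorm.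

Section Sobolev.
Variables (R : realType) (n : nat).
Local Notation mu := (@lebesgue_measure R).
Local Notation V := ('cV[R]_n).
Implicit Types (u v f : R -> V) (x : H1 R n) (A : R -> 'M[R]_n).

Lemma ae_Rintegral (D : set R) (g h : R -> R) : measurable D ->
    mu.-integrable D (EFin \o g) -> mu.-integrable D (EFin \o h) ->
    {ae mu, forall t, g t = h t} ->
  \int[mu]_(t in D) g t = \int[mu]_(t in D) h t.
Proof.
move=> mD /integrableP[mg _] /integrableP[mh _] gh; congr fine.
by apply: ae_eq_integral => //; apply: leb_aeS gh => t e _; rewrite e.
Qed.

Lemma increment_le u v s t : vloc v -> locint (fun t => dot (v t) (v t)) ->
    (forall i, prim (fun t => u t i 0) (fun t => v t i 0)) -> s <= t ->
  enorm (u t - u s) <= Num.sqrt (t - s) * energy v s t.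
Proof.
move=> vv dv uv st; apply: enorm_dot_bound => [|w].
  by rewrite mulr_ge0 ?sqrtr_ge0 ?energy_ge0.
have -> : dot w (u t - u s) = \int[mu]_(r in `[s, t]) dot w (v r).
  have -> : (fun r => dot w (v r)) = fun r => \sum_i w i 0 * v r i 0.
    by apply/funext => r; rewrite dotE.
  have iZ i : locint (fun r => w i 0 * v r i 0) by apply: locintZ.
  have := @prim_sum _ _ (index_enum 'I_n) (fun i r => w i 0 * u r i 0)
    (fun i r => w i 0 * v r i 0) iZ (fun i => primZ (w i 0) (vv i) (uv i)).
  by move=> /(_ _ _ st) <-; rewrite dotBr !dotE.
rewrite [leRHS]mulrC mulrA; exact: (@Rintegral_dot_le _ _ (fun=> w) v (enorm w) s t (@vcont_cst _ _ w) (conj vv dv)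
  (enorm_ge0 w) st (fun _ _ => lexx _)).
Qed.

Lemma energy_mono f a b s t : locint (fun t => dot (f t) (f t)) -> a <= s -> s <= t -> t <= b ->
  energy f s t <= energy f a b.
Proof.
move=> df as_ st tb; rewrite ler_sqrt ?Rintegral_ge0//; last by move=> r _; exact: dotvv_ge0.
rewrite (Rintegral_itv_cat df as_ (le_trans st tb)) (Rintegral_itv_cat df st tb).
by rewrite addrCA lerDl addr_ge0 ?Rintegral_ge0// => r _; exact: dotvv_ge0.
Qed.

(** On a unit interval a function is bounded below by its value at the left end
minus its total oscillation, and so is its mean square. *)
Lemma sobolev_pointwise u v t : vcont u -> vloc v -> locint (fun t => dot (v t) (v t)) ->
    (forall i, prim (fun t => u t i 0) (fun t => v t i 0)) ->
  enorm (u t) <= energy u t (t + 1) + energy v t (t + 1).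
Proof.
move=> cu vv dv uv; rewrite -lerBlDr.
set c := _ - _; have [c0|c0] := lerP c 0; first exact: le_trans c0 (energy_ge0 _ _ _).
have du : locint (fun r => dot (u r) (u r)) by case: (vcont_sqloc cu).
have t1 : t <= t + 1 by rewrite lerDl.
have cr r : t <= r <= t + 1 -> c ^+ 2 <= dot (u r) (u r).
  move=> /andP[tr rt]; rewrite dotvv ler_sqr ?nnegrE ?enorm_ge0 ?(ltW c0)//.
  have h1 := increment_le vv dv uv tr.
  have h2 : Num.sqrt (r - t) * energy v t r <= energy v t (t + 1).
    apply: (@le_trans _ _ (1 * energy v t r)); last by rewrite mul1r energy_mono.
    by rewrite ler_wpM2r ?energy_ge0// -sqrtr1 ler_sqrt// lerBlDl.
  have h3 : enorm (u t) <= enorm (u r) + enorm (u r - u t).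
    by rewrite -(enormN (u r - u t)) (le_trans _ (enormD _ _))// opprB addrC subrK.
  rewrite /c lerBlDr (le_trans h3)// lerD2l; exact: le_trans h1 h2.
rewrite -(ler_pXn2r (ltn0Sn 1)) ?nnegrE ?energy_ge0 ?(ltW c0)// sqr_energy.
apply: (@le_trans _ _ (\int[mu]_(r in `[t, t + 1]) (cst (c ^+ 2) r))).
  rewrite Rintegral_cst//= lebesgue_measure_itv/= lte_fin ltrDl ltr01.
  by rewrite -EFinB/= addrAC subrr add0r mulr1.
have ic : locint (cst (c ^+ 2) : R -> R).
  by apply: continuous_locint => r; exact: cst_continuous.
by apply: le_Rintegral.
Qed.

Definition wd x : R -> V := L2_repr (H1_deriv x).

Lemma wd_sqint x : wd x \in @sqint R n. Proof. exact: sqfun_valP. Qed.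

Lemma H1_vcont x : vcont x.
Proof.
move=> i t; apply: (@continuous_comp _ _ _ (H1_fun x) (fun M : V => M i 0)).
  exact: H1_continuous.
exact: coord_continuous.
Qed.

Lemma H1_prim x i : prim (fun t => x t i 0) (fun t => wd x t i 0).
Proof.
apply: weak_scalar_prim; first exact: H1_vcont.
  by apply: Lfun2_locint; exact: (sqintP _ (wd_sqint x)).
by move=> phi tphi; exact: H1_weak_deriv.
Qed.

Lemma H1_pointwise x t : enorm (x t) <= energy x t (t + 1) + energy (wd x) t (t + 1).
Proof.
have [vw dw] := sqint_sqloc (wd_sqint x).
by apply: sobolev_pointwise => //; [exact: H1_vcont|exact: H1_prim].
Qed.

Lemma energy_l2norm f s t : f \in @sqint R n -> energy f s t <= l2norm f.
Proof.
move=> hf; rewrite -(ler_pXn2r (ltn0Sn 1)) ?nnegrE ?energy_ge0 ?l2norm_ge0//.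
rewrite sqr_energy sqr_l2norm// integral_le_T//; first exact: sqint_dot_integrable.
by move=> r; exact: dotvv_ge0.
Qed.

Lemma l2norm_le_H1 x : l2norm x <= `|x|.
Proof.
rewrite H1_normE /H1_norm -[leLHS]ger0_norm ?l2norm_ge0// -sqrtr_sqr.
by rewrite ler_sqrt ?lerDl ?addr_ge0 ?sqr_ge0.
Qed.

Lemma wd_le_H1 x : l2norm (wd x) <= `|x|.
Proof.
rewrite H1_normE /H1_norm -[leLHS]ger0_norm ?l2norm_ge0// -sqrtr_sqr.
by rewrite ler_sqrt ?lerDr ?addr_ge0 ?sqr_ge0.
Qed.

Lemma H1_sup x t : enorm (x t) <= 2 * `|x|.
Proof.
rewrite mulrDl mul1r (le_trans (H1_pointwise x t))// lerD//.
  exact: le_trans (energy_l2norm _ _ (H1_sqint x)) (l2norm_le_H1 x).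
exact: le_trans (energy_l2norm _ _ (wd_sqint x)) (wd_le_H1 x).
Qed.

Lemma energy_tail f e : f \in @sqint R n -> 0 < e ->
  exists K : R, forall a b, a <= b -> K <= a \/ b <= - K -> energy f a b <= e.
Proof.
move=> hf e0; have [K hK] := @integral_tail _ (fun t => dot (f t) (f t)) (e ^+ 2)
  (sqint_dot_integrable hf hf) (fun t => dotvv_ge0 (f t)) (exprn_gt0 2 e0).
exists K => a b ab h; rewrite -(ler_pXn2r (ltn0Sn 1)) ?nnegrE ?energy_ge0 ?(ltW e0)//.
by rewrite sqr_energy hK.
Qed.

Lemma H1_decay x e : 0 < e -> exists K : R, forall t, K <= `|t| -> enorm (x t) <= e.
Proof.
move=> e0; have e2 : 0 < e / 2 by rewrite divr_gt0.
have [K1 h1] := energy_tail (H1_sqint x) e2.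
have [K2 h2] := energy_tail (wd_sqint x) e2.
have t1 t : t <= t + 1 by rewrite lerDl.
exists (Num.max K1 K2 + 1) => t hm.
have sides (K : R) : K <= Num.max K1 K2 -> K <= t \/ t + 1 <= - K.
  move=> Km; case: (lerP 0 t) => t0; move: hm.
    by rewrite ger0_norm// => hm; left; lra.
  by rewrite ltr0_norm// => hm; right; lra.
rewrite (le_trans (H1_pointwise x t))// [leRHS]splitr lerD//.
  apply: h1; first exact: t1.
  by apply: sides; rewrite le_max lexx.
apply: h2; first exact: t1.
by apply: sides; rewrite le_max lexx orbT.
Qed.

Lemma L2_repr_of f : f \in @sqint R n -> {ae mu, forall t, L2_repr (L2_of f) t = f t}.
Proof.
move=> hf; have -> : f = sqfun_val (SqFun hf) by [].
by apply/L2_classP; rewrite L2_reprK /L2_of valKd.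
Qed.

Lemma L2_ext (g h : L2 R n) : {ae mu, forall t, L2_repr g t = L2_repr h t} -> g = h.
Proof. by move=> /L2_classP; rewrite !L2_reprK. Qed.

Lemma L2_reprD (g h : L2 R n) :
  {ae mu, forall t, L2_repr (g + h) t = L2_repr g t + L2_repr h t}.
Proof.
by apply: (@L2_classP _ _ _ (L2_repr g + L2_repr h)).1; rewrite L2_classD !L2_reprK.
Qed.

Lemma L2_reprZ a (g : L2 R n) :
  {ae mu, forall t, L2_repr (a *: g) t = a *: L2_repr g t}.
Proof.
by apply: (@L2_classP _ _ _ (a *: L2_repr g)).1; rewrite L2_classZ !L2_reprK.
Qed.

Lemma L2_repr0 : {ae mu, forall t, L2_repr (0 : L2 R n) t = 0}.
Proof.
apply: (@L2_classP _ _ _ 0).1; rewrite L2_reprK.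
exact: (esym (raddf0 \pi_(L2 R n)%qT)).
Qed.

Lemma sqint_mulmx A al u : 0 <= al -> (forall t, mnorm (A t) <= al) -> mcont A ->
  u \in @sqint R n -> (fun t => A t *m u t) \in @sqint R n.
Proof.
move=> al0 bA cA hu; have mA i j : measurable_fun setT (fun t => A t i j).
  exact: continuous_measurable_fun.
have mAu i : measurable_fun setT (fun t => (A t *m u t) i 0).
  under eq_fun do rewrite mxE; apply: measurable_sum => j.
  by apply: measurable_funM => //; exact: measurable_coord.
apply: sqintI => //.
have ia : mu.-integrable setT (EFin \o (fun t => al ^+ 2 * dot (u t) (u t))).
  rewrite (_ : _ \o _ = (fun t => (al ^+ 2)%:E * (dot (u t) (u t))%:E)%E)//.
  by apply: integrableZl => //; exact: sqint_dot_integrable.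
apply: le_integrable ia => //.
  apply/measurable_EFinP; rewrite (_ : (fun t => _) =
    fun t => \sum_j (A t *m u t) j 0 * (A t *m u t) j 0).
    by apply: measurable_sum => j; apply: measurable_funM; exact: mAu.
  by apply/funext => t; rewrite dotE.
move=> t _; rewrite lee_fin !ger0_norm ?mulr_ge0 ?sqr_ge0 ?dotvv_ge0//.
rewrite !dotvv -exprMn ler_sqr ?nnegrE ?mulr_ge0 ?enorm_ge0//.
by rewrite (le_trans (enorm_mul _ _))// ler_wpM2r ?enorm_ge0.
Qed.

End Sobolev.

Section SobolevSolutions.
Variables (R : realType) (n : nat) (J : 'M[R]_n).
Hypotheses (JT : J^T = - J) (JJ : J *m J = - 1%:M).
Local Notation mu := (@lebesgue_measure R).
Local Notation V := ('cV[R]_n).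
Variables (A : R -> 'M[R]_n) (al : R).
Hypotheses (al0 : 0 <= al) (bA : forall t, mnorm (A t) <= al) (cA : mcont A).

Lemma sol_rhs_vloc (u f : R -> V) : vcont u -> vloc f ->
  vloc (fun t => - (J *m (A t *m u t + f t))).
Proof.
move=> cu vf; apply: vlocN; apply: vloc_mulmx; apply: vlocD => //.
by apply: vcont_vloc; exact: vcont_mulmx.
Qed.

(** The weak derivative of a Sobolev function is the derivative of its continuous
representative in the integrated sense. *)
Lemma H1_sol (x : H1 R n) (f : R -> V) : f \in @sqint R n ->
    {ae mu, forall t, J *m wd x t - A t *m x t = f t} ->
  sol J A x f.
Proof.
move=> hf hx; split=> [|i]; first exact: H1_vcont.
have vf := (sqint_sqloc hf).1; have vw := (sqint_sqloc (wd_sqint x)).1.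
have vg := sol_rhs_vloc (@H1_vcont _ _ x) vf.
move=> a b ab; rewrite (H1_prim x i ab).
apply: ae_Rintegral => //; [exact: vw|exact: vg|].
by apply: leb_aeS hx => t <-; rewrite addrC subrK (JK JJ) opprK.
Qed.

(** For bounded coefficients the derivative of a square integrable solution is
square integrable. *)
Lemma sol_H1 (u f : R -> V) : u \in @sqint R n -> f \in @sqint R n -> sol J A u f ->
  exists2 x : H1 R n, H1_fun x = u &
    {ae mu, forall t, J *m wd x t - A t *m x t = f t}.
Proof.
move=> hu hf [cu pu]; pose g t := - (J *m (A t *m u t + f t)).
have hJ : mnorm J >= 0 by exact: mnorm_ge0.
have hg : g \in @sqint R n.
  have h : (fun t => (- J) *m (A t *m u t + f t)) \in @sqint R n.
    apply: (@sqint_mulmx _ _ (fun=> - J) (mnorm (- J))) => //; first exact: mnorm_ge0.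
      exact: mcont_cst.
    have := rpredD (sqint_mulmx al0 bA cA hu) hf.
    by [].
  by rewrite (_ : g = fun t => (- J) *m (A t *m u t + f t))//; apply/funext => t; rewrite mulNmx.
have hd := L2_repr_of hg.
have cu' : continuous u.
  by move=> t; apply: cvg_mx => i j; rewrite (ord1 j); exact: cu.
have hp : (u, L2_of g) \in @h1_pred R n.
  rewrite inE; split => //=.
  apply: (@weak_deriv_ae _ _ u g) => //; first exact: sqfun_valP.
    by apply: leb_aeS hd => t ->.
  move=> phi tphi i; apply: prim_test => //.
  by apply: Lfun2_locint; exact: (sqintP _ hg).
exists (MkH1 hp) => //; apply: leb_aeS hd => t; rewrite /wd /H1_deriv /= => ->.
by rewrite /g mulmxN (JK JJ) opprK addrC addKr.
Qed.

End SobolevSolutions.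

(** * Solutions on the whole line *)

Section HalfIntegrals.
Variables (R : realType) (n : nat).
Local Notation mu := (@lebesgue_measure R).
Implicit Types (g : R -> R) (v f : R -> 'cV[R]_n).

(** Extension by zero from the positive half-line, which turns half-line integrals
into integrals over the line. *)
Definition cut v : R -> 'cV[R]_n := fun t => (0 <= t)%R%:R *: v t.

Lemma measurable_cut (g : R -> R) : measurable_fun setT g ->
  measurable_fun setT (fun t : R => (0 <= t)%R%:R * g t).
Proof.
move=> mg; apply: measurable_funM => //.
rewrite (_ : (fun t : R => _) = \1_(`[0, +oo[%classic : set R)).
  exact: measurable_indic.
by apply/funext => t; rewrite indicE mem_setE in_itv/= andbT.
Qed.

Lemma cut_sqint v B : vcont v ->
    (forall t, 0 <= t -> \int[mu]_(r in `[0, t]) dot (v r) (v r) <= B) ->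
  cut v \in @sqint R n.
Proof.
move=> cv hB; have mv i : measurable_fun setT (fun t => v t i 0).
  exact: continuous_measurable_fun (cv i).
have mc i : measurable_fun setT (fun t => cut v t i 0).
  by under eq_fun do rewrite mxE; exact: measurable_cut.
have cd := continuous_dot cv cv.
have de (t : R) : dot (cut v t) (cut v t) = (0 <= t)%R%:R * dot (v t) (v t).
  by rewrite dotZl dotZr mulrA; case: (0 <= t); rewrite ?mul1r ?mul0r.
have dE : (fun t => dot (cut v t) (cut v t)) = fun t : R => (0 <= t)%R%:R * dot (v t) (v t).
  by apply/funext => t.
have lc : locint (fun t => dot (cut v t) (cut v t)).
  move=> a b; apply: (le_integrable _ _ _ (continuous_locint cd a b)) => //.
    apply/measurable_EFinP; rewrite dE; apply: measurable_funTS; apply: measurable_cut.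
    exact: continuous_measurable_fun cd.
  move=> t _; rewrite lee_fin de normrM ler_piMl//.
  by case: (0 <= t); rewrite ?normr1 ?normr0.
apply: sqintI => //; apply: (@bounded_integrable _ _ B) => //.
- rewrite dE; apply: measurable_cut; exact: continuous_measurable_fun cd.
- by move=> t; exact: dotvv_ge0.
- move=> k; have k0 : (0 : R) <= k%:R by exact: ler0n.
  rewrite (Rintegral_itv_cat lc _ k0) ?oppr_le0//.
  rewrite -(@Rintegral_itv_bndo_bndc _ (BLeft (- k%:R)) 0).
    rewrite (@eq_Rintegral _ _ _ mu _ (fun=> 0)); last first.
      by move=> t; rewrite inE/= in_itv/= de => /andP[_]; rewrite leNgt => ->; rewrite mul0r.
    rewrite Rintegral_cst//= mul0r add0r.
    rewrite (@eq_Rintegral _ _ _ mu _ (fun t => dot (v t) (v t))); first exact: hB.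
    by move=> t; rewrite inE/= in_itv/= de => /andP[-> _]; rewrite mul1r.
  by apply: integrableS (lc (- k%:R) 0) => //; exact: subset_itv_co_cc.
Qed.

Lemma Rintegral_cut v f t : 0 <= t ->
  \int[mu]_(r in `[0, t]) dot (cut v r) (f r) = \int[mu]_(r in `[0, t]) dot (v r) (f r).
Proof.
move=> t0; apply: eq_Rintegral => r; rewrite inE/= in_itv/= => /andP[r0 _].
by rewrite /cut r0 scale1r.
Qed.

Lemma half_integral_cvg g e : mu.-integrable setT (EFin \o g) ->
    (forall t, t < 0 -> g t = 0) -> 0 < e ->
  exists t0 : R, 0 <= t0 /\ forall t, t0 <= t ->
    `|\int[mu]_t g t - \int[mu]_(t in `[0, t]) g t| <= e.
Proof.
move=> ig g0 e0; have lg := integrable_locint ig.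
have e2 : 0 < e / 2 by rewrite divr_gt0.
have iab : mu.-integrable setT (EFin \o (fun t => `|g t|)) by exact: integrable_norm.
have [K hK] := integral_tail iab (fun t => normr_ge0 (g t)) e2.
have := cvg_Rintegral_sym ig => /cvgrPdist_le/(_ _ e2)[k1 _ hk1].
pose k := maxn k1 (Num.bound `|K|).
have k0 : (0 : R) <= k%:R by exact: ler0n.
have Kk : K <= k%:R.
  rewrite (le_trans (ler_norm _))// (le_trans (ltW (archi_boundP (normr_ge0 _))))//.
  by rewrite ler_nat leq_maxr.
exists k%:R; split => // t kt.
have gk : \int[mu]_(r in `[- k%:R, k%:R]) g r = \int[mu]_(r in `[0, k%:R]) g r.
  rewrite (Rintegral_itv_cat lg _ k0) ?oppr_le0//.
  rewrite -(@Rintegral_itv_bndo_bndc _ (BLeft (- k%:R)) 0).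
    rewrite (@eq_Rintegral _ _ _ mu _ (fun=> 0)); last first.
      by move=> r; rewrite inE/= in_itv/= => /andP[_]; exact: g0.
    by rewrite Rintegral_cst//= mul0r add0r.
  by apply: integrableS (lg (- k%:R) 0) => //; exact: subset_itv_co_cc.
have := hk1 k (leq_maxl _ _); rewrite /= gk => h1.
have h2 := hK k%:R t kt (or_introl Kk).
rewrite (Rintegral_itv_cat lg k0 kt) opprD addrA [leRHS]splitr.
rewrite (le_trans (ler_normB _ _))// lerD// (le_trans _ h2)//.
by apply: le_normr_Rintegral.
Qed.

End HalfIntegrals.

Section HalfLineData.
Variables (R : realType) (n : nat) (J : 'M[R]_n).
Hypotheses (JT : J^T = - J) (JJ : J *m J = - 1%:M).
Local Notation mu := (@lebesgue_measure R).
Local Notation V := ('cV[R]_n).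
Variables (A X : R -> 'M[R]_n).
Hypotheses (sA : forall t, (A t)^T = A t) (cA : mcont A) (fX : flow_of J A X).

(** The form in which the asymptotics of the coefficients at one end of the line
enter: the only obstruction to square integrability of a solution is its pairing
with the decaying homogeneous solutions. *)
Definition dichotomy := forall u f : R -> V, f \in @sqint R n -> sol J A u f ->
  (forall a, stable X a -> pairing_vanishes J X u a) ->
  exists B, forall t, 0 <= t -> \int[mu]_(r in `[0, t]) dot (u r) (u r) <= B.

Hypothesis dich : dichotomy.

Definition orb (a : V) : R -> V := fun t => X t *m a.

Lemma orb_vcont a : vcont (orb a). Proof. exact: hsol_vcont (flow_hsol fX a). Qed.

Lemma orb0 a : orb a 0 = a. Proof. by rewrite /orb fX.1 mul1mx. Qed.

Lemma orb_lin c a b t : orb (c *: a + b) t = c *: orb a t + orb b t.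
Proof. by rewrite /orb mulmxDr -scalemxAr. Qed.

Lemma bounded_pairing (u : R -> V) c a : (forall t, enorm (u t) <= c) ->
  stable X a -> pairing_vanishes J X u a.
Proof.
move=> uc ha e e0; have c1 : 0 < `|c| + 1 by rewrite ltr_wpDl.
have [t0 ht] := ha (e / (`|c| + 1)) (divr_gt0 e0 c1).
exists t0 => t tt; rewrite (le_trans (dot_cs _ _))// (enormJ JT JJ).
rewrite -[leRHS](divfK (lt0r_neq0 c1)) ler_pM ?enorm_ge0 ?ht//.
by rewrite (le_trans (uc t))// (le_trans (ler_norm c))// lerDl.
Qed.

Lemma stable_cut_sqint a : stable X a -> cut (orb a) \in @sqint R n.
Proof.
move=> ha; have c0 : vcont (orb a) by exact: orb_vcont.
have s0 : (fun=> 0 : V) \in @sqint R n by exact: (rpred0 (@sqint R n)).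
have [|B hB] := dich s0 (hsol_sol cA (flow_hsol fX a)); last exact: cut_sqint hB.
move=> b hb e e0; pose d := Num.min 1 e; have d0 : 0 < d by rewrite lt_min ltr01.
have [d1 de] : d <= 1 /\ d <= e by split; rewrite ge_min lexx ?orbT.
have [t1 h1] := ha d d0; have [t2 h2] := hb d d0.
exists (Num.max t1 t2) => t; rewrite ge_max => /andP[tt1 tt2].
rewrite (le_trans (dot_cs _ _))// (enormJ JT JJ).
by rewrite (le_trans (ler_pM _ _ (h2 _ tt2) (h1 _ tt1))) ?enorm_ge0// (le_trans _ de)// ler_piMl// ltW.
Qed.

Variable f : R -> V.
Hypothesis hf : f \in @sqint R n.

Definition half_pairing a : R := \int[mu]_t dot (cut (orb a) t) (f t).

Lemma half_pairing_lin c a b : stable X a -> stable X b ->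
  half_pairing (c *: a + b) = c * half_pairing a + half_pairing b.
Proof.
move=> ha hb; have ia := sqint_dot_integrable (stable_cut_sqint ha) hf.
have ib := sqint_dot_integrable (stable_cut_sqint hb) hf.
rewrite /half_pairing -RintegralZl// -RintegralD//.
  apply: eq_Rintegral => t _.
  by rewrite /cut orb_lin scalerDr dotDl !dotZl; ring.
rewrite (_ : EFin \o _ = (fun t => c%:E * (dot (cut (orb a) t) (f t))%:E)%E)//.
exact: integrableZl.
Qed.

Lemma half_pairing_limit a e : stable X a -> 0 < e ->
  exists t0 : R, 0 <= t0 /\ forall t, t0 <= t ->
    `|half_pairing a - \int[mu]_(r in `[0, t]) dot (orb a r) (f r)| <= e.
Proof.
move=> ha e0.
have [|t0 [t00 h]] := @half_integral_cvg _ (fun t => dot (cut (orb a) t) (f t)) e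
  (sqint_dot_integrable (stable_cut_sqint ha) hf) _ e0.
  by move=> t; rewrite /cut leNgt => ->; rewrite scale0r dot0l.
exists t0; split => // t tt; rewrite -Rintegral_cut ?(le_trans t00 tt)//; exact: h.
Qed.

(** By Green's identity the pairing at time [t] is its initial value plus the
integral up to [t]; the prescribed initial value cancels the limit. *)
Lemma pairing_from_initial u a : sol J A u f -> stable X a ->
  dot a (J *m u 0) = - half_pairing a -> pairing_vanishes J X u a.
Proof.
move=> hu ha e0 e e_gt0; have [t0 [t00 h]] := half_pairing_limit ha e_gt0.
exists t0 => t tt; have t1 := le_trans t00 tt.
have vf := (sqint_sqloc hf).1.
have := green JT JJ sA cA vf (flow_hsol fX a) hu t1.
rewrite /= fX.1 mul1mx e0 opprK => hg.
rewrite -[dot _ _](addrK (half_pairing a)) hg distrC; exact: h.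
Qed.

End HalfLineData.

(** * Fredholm alternative on the line *)

Section FunctionalExtension.
Variables (R : realType) (n : nat).
Local Notation V := ('cV[R]_n).

(** Solvability of [M w = c] is the vanishing of [y c] for all [y] with
[y M = 0]; for generators of two subspaces such a [y] is a coincidence between
the two subspaces, where the functionals agree. *)
Lemma common_extension (S1 S2 : V -> Prop) (al1 al2 : V -> R) :
    S1 0 -> (forall c a b, S1 a -> S1 b -> S1 (c *: a + b)) ->
    S2 0 -> (forall c a b, S2 a -> S2 b -> S2 (c *: a + b)) ->
    (forall c a b, S1 a -> S1 b -> al1 (c *: a + b) = c * al1 a + al1 b) ->
    (forall c a b, S2 a -> S2 b -> al2 (c *: a + b) = c * al2 a + al2 b) ->
    (forall a, S1 a -> S2 a -> al1 a = al2 a) ->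
  exists w : V, (forall a, S1 a -> dot a w = al1 a) /\
                (forall b, S2 b -> dot b w = al2 b).
Proof.
move=> S10 S1l S20 S2l l1 l2 agree.
have [E1 h1] := subspace_matrix S10 S1l; have [E2 h2] := subspace_matrix S20 S2l.
have comb (S : V -> Prop) (al : V -> R) (E : 'M[R]_n) : S 0 ->
    (forall c a b, S a -> S b -> S (c *: a + b)) ->
    (forall c a b, S a -> S b -> al (c *: a + b) = c * al a + al b) ->
    (forall x, S x <-> (x^T <= E)%MS) -> forall y : 'rV_n,
    S (y *m E)^T /\ al (y *m E)^T = (y *m (\col_i al (row i E)^T)) 0 0.
  move=> S0 Sl lin hE y.
  have al0 : al 0 = 0.
    have := lin 1 0 0 S0 S0; rewrite scaler0 addr0 mul1r => /eqP.
    by rewrite -subr_eq0 opprD addrA subrr sub0r oppr_eq0 => /eqP.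
  have Srow i : S (row i E)^T by apply/hE; rewrite trmxK row_sub.
  have -> : (y *m E)^T = \sum_i y 0 i *: (row i E)^T.
    rewrite mulmx_sum_row linear_sum; apply: eq_bigr => i _.
    by rewrite linearZ.
  rewrite [in RHS]mxE; elim: (index_enum _) => [|i r [Sr er]]; first by rewrite !big_nil.
  by rewrite !big_cons lin// er; split; [exact: Sl|rewrite mxE].
pose c1 : V := \col_i al1 (row i E1)^T; pose c2 : V := \col_i al2 (row i E2)^T.
pose M := col_mx E1 E2; pose c := col_mx c1 c2.
have /submxP[w wE] : (c^T <= M^T)%MS.
  rewrite submxE; apply/eqP/trmx_inj; rewrite trmx_mul trmxK trmx0.
  apply/row_matrixP => i; rewrite row_mul row0; set y := row i _.
  have : y *m M = 0.
    by rewrite /y -row_mul -[X in _ *m X]trmxK -trmx_mul mulmx_coker trmx0 row0.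
  rewrite -[y]hsubmxK /M mul_row_col => /eqP; rewrite addr_eq0 => /eqP yE.
  have [Sa ea] := comb _ _ _ S10 S1l l1 h1 (lsubmx y).
  have [Sb eb] := comb _ _ _ S20 S2l l2 h2 (- rsubmx y).
  have e12 : lsubmx y *m E1 = - rsubmx y *m E2 by rewrite mulNmx.
  rewrite /c mul_row_col; apply/rowP => k; rewrite (ord1 k) !mxE.
  have := agree _ Sa; rewrite {1}e12 => /(_ Sb); rewrite ea e12 eb mulNmx !mxE => ->.
  by rewrite addNr.
have {}wE : M *m w^T = c by rewrite -[c]trmxK wE trmx_mul trmxK.
have [w1 w2] : E1 *m w^T = c1 /\ E2 *m w^T = c2.
  by move: wE; rewrite /M mul_col_mx => /eq_col_mx.
exists w^T; split=> a Sa.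
  have /submxP[y ya] : (a^T <= E1)%MS by apply/h1.
  have [_ ] := comb _ _ _ S10 S1l l1 h1 y.
  by rewrite -ya trmxK => ->; rewrite /dot ya -mulmxA w1.
have /submxP[y ya] : (a^T <= E2)%MS by apply/h2.
have [_ ] := comb _ _ _ S20 S2l l2 h2 y.
by rewrite -ya trmxK => ->; rewrite /dot ya -mulmxA w2.
Qed.

End FunctionalExtension.

Section WholeLine.
Variables (R : realType) (n : nat) (J : 'M[R]_n).
Hypotheses (JT : J^T = - J) (JJ : J *m J = - 1%:M).
Local Notation mu := (@lebesgue_measure R).
Local Notation V := ('cV[R]_n).
Variables (A X : R -> 'M[R]_n) (al : R).
Hypotheses (al0 : 0 <= al) (bA : forall t, mnorm (A t) <= al).
Hypotheses (sA : forall t, (A t)^T = A t) (cA : mcont A) (fX : flow_of J A X).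

Let JT' : (- J)^T = - (- J). Proof. by rewrite -[in RHS]JT; apply/matrixP => i j; rewrite !mxE. Qed.
Let JJ' : - J *m - J = - 1%:M. Proof. by rewrite mulNmx mulmxN opprK. Qed.

Local Notation A' := (fun t => A (- t)).
Local Notation X' := (fun t => X (- t)).
Let sA' t : (A' t)^T = A' t. Proof. exact: sA. Qed.
Let cA' : mcont A' := mcont_opp cA.
Let fX' : flow_of (- J) A' X' := flow_opp fX.

Hypotheses (dp : dichotomy J A X) (dm : dichotomy (- J) A' X').

(** Variation of constants, where the symplectic relation gives the inverse of the
flow without differentiating it. *)
Lemma sol_with_initial (xi : V) (f : R -> V) : vloc f ->
  exists2 u, sol J A u f & u 0 = xi.
Proof.
move=> vf; have cX : mcont X by exact: flow_mcont fX.
pose g t := - (J *m ((X t)^T *m f t)).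
have vg : vloc g.
  apply: vlocN; apply: vloc_mulmx => i.
  rewrite (_ : (fun t => _) = fun t => \sum_j f t j 0 * X t j i).
    by apply: locint_sum => j _; apply: locintM; [exact: vf|exact: cX].
  by apply/funext => t; rewrite mxE; apply: eq_bigr => j _; rewrite mxE mulrC.
pose w t : V := \col_i (xi i 0 + antider (fun s => g s i 0) t).
have pw i : prim (fun t => w t i 0) (fun t => g t i 0).
  move=> a b ab; rewrite !mxE opprD addrACA subrr add0r.
  exact: (antider_prim (vg i) ab).
have XJX t : X t *m J *m (X t)^T = J.
  have := flow_Kinv JT JJ sA cA fX t; rewrite /flow_inv mulmxN => /(congr1 (mulmx^~ (- J))).
  rewrite mul1mx mulNmx mulmxN opprK -!mulmxA JJ !mulmxN mulmx1 => h.
  by apply: oppr_inj; rewrite -h !mulmxA.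
exists (fun t => X t *m w t); last first.
  by rewrite fX.1 mul1mx; apply/colP => i; rewrite mxE antider0 addr0.
have cw : vcont w by move=> i; exact: prim_continuous (vg i) (pw i).
split; first exact: vcont_mulmx.
move=> i; pose X1 t := - (J *m (A t *m X t)).
have colX (M : 'M[R]_n) j : (M *m delta_mx j 0 : V) i 0 = M i j by rewrite -colE mxE.
have cX1 j : continuous (fun t => X1 t i j).
  have -> : (fun t => X1 t i j) = fun t => (- (J *m (A t *m (X t *m delta_mx j 0 : V)))) i 0.
    by apply/funext => t; rewrite -(colX (X1 t)) /X1 mulNmx !mulmxA.
  have hv : vcont (fun t => - (J *m (A t *m (X t *m delta_mx j 0 : V)))).
    apply: vcont_rhs => //; exact: hsol_vcont (flow_hsol fX (delta_mx j 0)).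
  exact: (hv i).
have h j := prim_mul (vg j) (pw j) (cX1 j) (fun t => fX.2 t i j).
have lh j : locint (fun t => g t j 0 * X t i j + w t j 0 * X1 t i j).
  apply: locintD; first by apply: locintM; [exact: vg|exact: cX].
  by apply: continuous_locint => t; apply: cvgM; [exact: cw|exact: cX1].
have := @prim_sum _ _ (index_enum 'I_n) _ _ lh h.
rewrite (_ : (fun t => \sum_j _) = fun t => (X t *m w t) i 0); last first.
  by apply/funext => t; rewrite mxE; apply: eq_bigr => j _; rewrite mulrC.
congr prim; apply/funext => t.
rewrite big_split/=.
have -> : \sum_j g t j 0 * X t i j = (X t *m g t) i 0.
  by rewrite [RHS]mxE; apply: eq_bigr => j _; rewrite mulrC.
have -> : \sum_j w t j 0 * X1 t i j = (X1 t *m w t) i 0.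
  by rewrite [RHS]mxE; apply: eq_bigr => j _; rewrite mulrC.
rewrite /g /X1 mulmxN !mulmxA XJX mulmxDr opprD [in RHS]mxE addrC -!mulmxA.
by rewrite mulNmx !mulmxA.
Qed.

Lemma two_sided_sqint (u : R -> V) Bp Bm : vcont u ->
    (forall t, 0 <= t -> \int[mu]_(r in `[0, t]) dot (u r) (u r) <= Bp) ->
    (forall t, 0 <= t -> \int[mu]_(r in `[0, t]) dot (u (- r)) (u (- r)) <= Bm) ->
  u \in @sqint R n.
Proof.
move=> cu hp hm; have cd := continuous_dot cu cu; have lu := continuous_locint cd.
apply: sqintI => [i|]; first exact: continuous_measurable_fun (cu i).
apply: (@bounded_integrable _ _ (Bm + Bp)) => //.
- exact: continuous_measurable_fun cd.
- by move=> t; exact: dotvv_ge0.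
- move=> k; have k0 : (0 : R) <= k%:R by exact: ler0n.
  have mk0 : - k%:R <= 0 :> R by rewrite oppr_le0.
  rewrite (Rintegral_itv_cat lu mk0 k0); apply: lerD; last exact: hp.
  have := Rintegral_opp 0 k%:R lu; rewrite oppr0 => <-; exact: hm.
Qed.

(** With [X] the flow, this is the kernel of the linear operator in terms of initial
values. *)
Definition bistable a := stable X a /\ stable X' a.

Lemma bistable_decay a e : bistable a -> 0 < e ->
  exists t0 : R, forall t, t0 <= `|t| -> enorm (orb X a t) <= e.
Proof.
move=> [hp hm] e0; have [t1 h1] := hp e e0; have [t2 h2] := hm e e0.
exists (Num.max t1 t2) => t; rewrite ge_max; case: (lerP 0 t) => t0.
  by rewrite ger0_norm// => /andP[/h1].
by rewrite ltr0_norm// => /andP[_ /h2]; rewrite /orb opprK.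
Qed.

Lemma bistable_bounded a : bistable a -> exists c : R, forall t, enorm (orb X a t) <= c.
Proof.
move=> ha; have [t0 h] := bistable_decay ha ltr01.
have hb t : enorm (orb X a t) <= expR (al * `|t|) * enorm a.
  have := @hsol_bound _ _ _ JT JJ A al (orb X a) 0 t bA (flow_hsol fX a).
  by rewrite (orb0 fX) subr0.
exists (Num.max 1 (expR (al * t0) * enorm a)) => t.
rewrite le_max; case: (lerP t0 `|t|) => [/h ->//|tt]; apply/orP; right.
rewrite (le_trans (hb t))// ler_wpM2r ?enorm_ge0// ler_expR ler_wpM2l//.
exact: ltW.
Qed.

Let s0 : (fun=> 0 : V) \in @sqint R n. Proof. exact: (rpred0 (@sqint R n)). Qed.

Lemma bistable_sqint a : bistable a -> orb X a \in @sqint R n.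
Proof.
move=> ha; have [c hc] := bistable_bounded ha.
have [|Bp hp] := dp s0 (hsol_sol cA (flow_hsol fX a)).
  by move=> b hb; exact: (bounded_pairing JT JJ hc hb).
have [|Bm hm] := dm s0 (hsol_sol cA' (flow_hsol fX' a)).
  by move=> b hb; apply: (@bounded_pairing _ _ _ JT' JJ' _ _ c _ _ hb) => t; exact: (hc (- t)).
by apply: two_sided_sqint hp hm; exact: orb_vcont fX a.
Qed.

Lemma three_thirds (b1 b2 b3 a1 a2 e : R) : `|b1 - a1| <= e / 3 -> `|b2 - a2| <= e / 3 ->
  `|b3 - (a2 + a1)| <= e / 3 -> `|b1 + b2 - b3| <= e.
Proof. by rewrite !ler_norml => /andP[? ?] /andP[? ?] /andP[? ?]; apply/andP; split; lra. Qed.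

Lemma half_pairings_add a f : bistable a -> f \in @sqint R n ->
  half_pairing X f a + half_pairing X' (fun t => f (- t)) a =
  \int[mu]_t dot (orb X a t) (f t).
Proof.
move=> ha hf; have hf' := sqint_opp hf.
have ig := sqint_dot_integrable (bistable_sqint ha) hf; have lg := integrable_locint ig.
apply/eqP; rewrite -subr_eq0 -normr_le0; apply/ler_addgt0Pr => e e0; rewrite add0r.
have e3 : 0 < e / 3 by rewrite divr_gt0.
have [t1 [_ h1]] := half_pairing_limit JT JJ cA fX dp hf ha.1 e3.
have [t2 [_ h2]] := half_pairing_limit JT' JJ' cA' fX' dm hf' ha.2 e3.
have := cvg_Rintegral_sym ig => /cvgrPdist_le/(_ _ e3)[k0 _ hk].
pose k := maxn k0 (maxn (Num.bound `|t1|) (Num.bound `|t2|)).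
have kk : (0 : R) <= k%:R by exact: ler0n.
have le_k (t : R) m : (Num.bound `|t| <= m)%N -> t <= m%:R.
  move=> tm; rewrite (le_trans (ler_norm _))// (le_trans (ltW (archi_boundP (normr_ge0 _))))//.
  by rewrite ler_nat.
have {}h1 := h1 k%:R (le_k _ _ (leq_trans (leq_maxl _ _) (leq_maxr _ _))).
have {}h2 := h2 k%:R (le_k _ _ (leq_trans (leq_maxr _ _) (leq_maxr _ _))).
have := hk k (leq_maxl _ _); rewrite /= (Rintegral_itv_cat lg _ kk) ?oppr_le0//.
have := Rintegral_opp 0 k%:R lg; rewrite oppr0 => <-.
exact: three_thirds h1 h2.
Qed.

(** The initial value is chosen so that the pairings with the solutions decaying
at either end tend to zero; orthogonality makes the two requirements compatible
on the intersection. *)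
Lemma solvable f : f \in @sqint R n ->
    (forall a, bistable a -> \int[mu]_t dot (orb X a t) (f t) = 0) ->
  exists2 u, u \in @sqint R n & sol J A u f.
Proof.
move=> hf orth; have hf' := sqint_opp hf; have vf := (sqint_sqloc hf).1.
have [] := @common_extension _ _ (stable X) (stable X')
  (fun a => - half_pairing X f a) (half_pairing X' (fun t => f (- t))).
- exact: stable0.
- by move=> *; exact: stable_lin.
- exact: stable0.
- by move=> *; exact: stable_lin.
- by move=> c a b ha hb; rewrite (half_pairing_lin JT JJ cA fX dp hf c ha hb); ring.
- by move=> c a b ha hb; rewrite (half_pairing_lin JT' JJ' cA' fX' dm hf' c ha hb).
- move=> a ha hb; have := half_pairings_add (conj ha hb) hf.
  by rewrite orth// => /eqP; rewrite addrC addr_eq0 => /eqP ->.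
move=> w [wp wm]; have [u hu u0] := sol_with_initial (- (J *m w)) vf.
have Ju0 : J *m u 0 = w by rewrite u0 mulmxN (JK JJ) opprK.
have [|Bp hp] := dp hf hu.
  by move=> a ha; apply: (pairing_from_initial JT JJ sA cA fX dp hf hu ha); rewrite Ju0 wp.
have hu' := sol_opp cA vf hu.
have [|Bm hm] := dm hf' hu'.
  move=> a ha; apply: (pairing_from_initial JT' JJ' sA' cA' fX' dm hf' hu' ha).
  by rewrite oppr0 mulNmx Ju0 dotNr wm.
by exists u => //; exact: two_sided_sqint hu.1 hp hm.
Qed.

(** Green's identity on [[-k, k]]: the boundary terms tend to zero because one
factor decays and the other is bounded. *)
Lemma range_orthogonal (x : H1 R n) f a : f \in @sqint R n -> sol J A x f ->
  bistable a -> \int[mu]_t dot (orb X a t) (f t) = 0.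
Proof.
move=> hf hx ha; have ig := sqint_dot_integrable (bistable_sqint ha) hf.
have vf := (sqint_sqloc hf).1.
apply/eqP; rewrite -normr_le0; apply/ler_addgt0Pr => e e0; rewrite add0r.
have c0 : 0 < 4 * `|x| + 1 by rewrite ltr_wpDl ?mulr_ge0.
have e2 : 0 < e / 2 by rewrite divr_gt0.
have [t0 ht] := bistable_decay ha (divr_gt0 e2 c0).
have := cvg_Rintegral_sym ig => /cvgrPdist_le/(_ _ e2)[k0 _ hk].
pose k := maxn k0 (Num.bound `|t0|).
have kk : (0 : R) <= k%:R by exact: ler0n.
have tk : t0 <= k%:R.
  rewrite (le_trans (ler_norm _))// (le_trans (ltW (archi_boundP (normr_ge0 _))))//.
  by rewrite ler_nat leq_maxr.
have kmk : - k%:R <= k%:R :> R by rewrite (le_trans _ kk)// oppr_le0.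
have := hk k (leq_maxl _ _); rewrite /=.
have hg := green JT JJ sA cA vf (flow_hsol fX a) hx.
rewrite -(hg _ _ kmk) => h.
have bd t : t0 <= `|t| -> `|dot (X t *m a) (J *m x t)| <= e / 2 / (4 * `|x| + 1) * (2 * `|x|).
  move=> /ht h1; rewrite (le_trans (dot_cs _ _))// (enormJ JT JJ) ler_pM ?enorm_ge0//.
  exact: H1_sup.
have b1 : `|dot (X k%:R *m a) (J *m x k%:R)| <= _ := bd _ _.
have {}b1 := b1 ltac:(by rewrite ger0_norm).
have b2 : `|dot (X (- k%:R) *m a) (J *m x (- k%:R))| <= _ := bd _ _.
have {}b2 := b2 ltac:(by rewrite normrN ger0_norm).
have hq : e / 2 / (4 * `|x| + 1) * (2 * `|x|) <= e / 4.
  have -> : e / 4 = e / 2 / (4 * `|x| + 1) * ((4 * `|x| + 1) / 2).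
    by rewrite mulrA divfK ?lt0r_neq0//; field.
  by rewrite ler_wpM2l ?divr_ge0 ?(ltW c0) ?(ltW e2)//; lra.
rewrite -[\int[mu]_t _](subrK (dot (X k%:R *m a) (J *m x k%:R) -
  dot (X (- k%:R) *m a) (J *m x (- k%:R)))).
rewrite (le_trans (ler_normD _ _))// [leRHS]splitr lerD//.
rewrite (le_trans (ler_normB _ _))// (le_trans (lerD b1 b2))//.
rewrite (le_trans (lerD hq hq))//.
by rewrite le_eqVlt; apply/orP; left; apply/eqP; field.
Qed.

End WholeLine.

Section FredholmAlternative.
Variables (R : realType) (n : nat) (J : 'M[R]_n).
Hypotheses (JT : J^T = - J) (JJ : J *m J = - 1%:M).
Local Notation mu := (@lebesgue_measure R).
Local Notation V := ('cV[R]_n).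

Lemma subspace_basis (S : V -> Prop) : S 0 ->
    (forall c a b, S a -> S b -> S (c *: a + b)) ->
  exists m, exists e : 'I_m -> V, [/\ forall i, S (e i),
    forall c : 'I_m -> R, \sum_i c i *: e i = 0 -> forall i, c i = 0 &
    forall a, S a -> exists c : 'I_m -> R, a = \sum_i c i *: e i].
Proof.
move=> S0 Sl; have [E hE] := subspace_matrix S0 Sl.
pose B := row_base E; exists (\rank E), (fun i => (row i B)^T).
have combE (c : 'I_(\rank E) -> R) : \sum_i c i *: (row i B)^T = ((\row_i c i) *m B)^T.
  by rewrite mulmx_sum_row linear_sum; apply: eq_bigr => i _; rewrite linearZ mxE.
split=> [i|c|a /hE].
- by apply/hE; rewrite trmxK (submx_trans (row_sub _ _))// eq_row_base.
- rewrite combE => /(congr1 trmx); rewrite trmxK trmx0.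
  move/(congr1 (mulmx^~ (pinvmx B))); rewrite (mulmxKp (row_base_free E)).
  rewrite mul0mx => /rowP h i; by have := h i; rewrite !mxE.
- rewrite -(eq_row_base E) => /submxP[y ya]; exists (fun i => y 0 i).
  rewrite combE -[a]trmxK ya; congr (_ *m _)^T; apply/rowP => i; by rewrite mxE.
Qed.

Variables (A X : R -> 'M[R]_n) (al : R).
Hypotheses (al0 : 0 <= al) (bA : forall t, mnorm (A t) <= al).
Hypotheses (sA : forall t, (A t)^T = A t) (cA : mcont A) (fX : flow_of J A X).
Hypotheses (dp : dichotomy J A X)
  (dm : dichotomy (- J) (fun t => A (- t)) (fun t => X (- t))).
Variable T : {linear H1 R n -> L2 R n}.
Hypotheses (cT : continuous T)
  (hT : forall x, {ae mu, forall t, J *m wd x t - A t *m x t = L2_repr (T x) t}).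

Let K := bistable X.

Let orb_sq a : K a -> orb X a \in @sqint R n.
Proof. exact: (bistable_sqint JT JJ al0 bA cA fX dp dm). Qed.

Let K0 : K 0. Proof. by split; exact: stable0. Qed.

Let Kl c a b : K a -> K b -> K (c *: a + b).
Proof. by move=> [? ?] [? ?]; split; exact: stable_lin. Qed.

Let T_sol (x : H1 R n) : sol J A x (L2_repr (T x)).
Proof. by apply: (H1_sol JJ cA) (hT x); exact: sqfun_valP. Qed.

Lemma sol_ae (u f g : R -> V) : f \in @sqint R n -> g \in @sqint R n ->
  {ae mu, forall t, f t = g t} -> sol J A u f -> sol J A u g.
Proof.
move=> hf hg fg [cu hu]; split => // i a b ab; rewrite (hu i a b ab).
have vf := sol_rhs_vloc J cA cu (sqint_sqloc hf).1.
have vg := sol_rhs_vloc J cA cu (sqint_sqloc hg).1.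
by apply: ae_Rintegral => //; [exact: vf|exact: vg|apply: leb_aeS fg => t ->].
Qed.

Lemma kernel_sol (x : H1 R n) : T x = 0 -> sol J A x (fun=> 0).
Proof.
move=> Tx; apply: sol_ae (T_sol x); first exact: sqfun_valP.
  exact: (rpred0 (@sqint R n)).
by rewrite Tx; exact: L2_repr0.
Qed.

Lemma kernel_orbit (x : H1 R n) : T x = 0 -> K (x 0) /\ H1_fun x = orb X (x 0).
Proof.
move=> Tx; have xE := sol_flow JT JJ sA cA fX (kernel_sol Tx); split => //.
split=> e e0; have [t0 ht] := H1_decay x e0; exists (Num.max 0 t0) => t;
  rewrite ge_max => /andP[t1 tt].
  have -> : X t *m x 0 = x t by rewrite [in RHS]xE.
  by apply: ht; rewrite ger0_norm.
have -> : X (- t) *m x 0 = x (- t) by rewrite [in RHS]xE.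
by apply: ht; rewrite normrN ger0_norm.
Qed.

Lemma H1_eqT (x y : H1 R n) : T x = T y -> H1_fun x = H1_fun y -> x = y.
Proof.
move=> Txy xy; apply: val_inj => /=; rewrite [LHS]surjective_pairing [RHS]surjective_pairing.
congr (_, _) => //; apply: L2_ext.
have h := hT x; rewrite Txy in h; apply: leb_aeS2 h (hT y) => t <-.
rewrite xy => /addIr /(congr1 (mulmx J)); rewrite !(JK JJ) => /oppr_inj e.
exact: esym e.
Qed.

Lemma kernel_element a : K a -> exists2 x : H1 R n, H1_fun x = orb X a & T x = 0.
Proof.
move=> ha; have s0 : (fun=> 0 : V) \in @sqint R n by exact: (rpred0 (@sqint R n)).
have [x xE hx] := sol_H1 JJ al0 bA cA (orb_sq ha) s0 (hsol_sol cA (flow_hsol fX a)).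
exists x => //; apply: L2_ext.
have h : {ae mu, forall t, L2_repr (T x) t = 0} by apply: leb_aeS2 hx (hT x) => t -> <-.
by apply: leb_aeS2 h (L2_repr0 R n) => t -> ->.
Qed.

Lemma kernelE : [set u | exists2 x : H1 R n, H1_fun x = u & T x = 0] =
  [set u | K (u 0) /\ u = orb X (u 0)].
Proof.
apply/seteqP; split=> u /= => [[x <- Tx]|[hu ->]].
  by have [? ?] := kernel_orbit Tx; split.
by have [x xE Tx] := kernel_element hu; exists x.
Qed.

(** The functionals on [L2] whose common kernel is the range. *)
Definition obstruction a (g : L2 R n) : R := \int[mu]_t dot (orb X a t) (L2_repr g t).

Lemma obstruction_ae a f (g : L2 R n) : K a -> f \in @sqint R n ->
  {ae mu, forall t, L2_repr g t = f t} ->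
  obstruction a g = \int[mu]_t dot (orb X a t) (f t).
Proof.
move=> ha hf gf; apply: ae_Rintegral => //.
- by apply: sqint_dot_integrable; [exact: orb_sq|exact: sqfun_valP].
- by apply: sqint_dot_integrable => //; exact: orb_sq.
- by apply: leb_aeS gf => t ->.
Qed.

Lemma obstruction_lin a c g h : K a ->
  obstruction a (c *: g + h) = c * obstruction a g + obstruction a h.
Proof.
move=> ha; have sg := sqfun_valP (L2_repr g); have sh := sqfun_valP (L2_repr h).
rewrite (@obstruction_ae _ (c *: (L2_repr g : R -> V) + (L2_repr h : R -> V)))//; last 2 first.
- by rewrite rpredD// rpredZ.
- apply: leb_aeS2 (L2_reprD (c *: g) h) (L2_reprZ c g) => t -> ->.
  by [].
have ig := sqint_dot_integrable (orb_sq ha) sg; have ih := sqint_dot_integrable (orb_sq ha) sh.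
rewrite /obstruction -RintegralZl// -RintegralD//.
  by apply: eq_Rintegral => t _; rewrite dotDr dotZr.
rewrite (_ : EFin \o _ = (fun t => c%:E * (dot (orb X a t) (L2_repr g t))%:E)%E)//.
exact: integrableZl.
Qed.

Lemma obstruction_le a g : K a -> `|obstruction a g| <= l2norm (orb X a) * `|g|.
Proof.
move=> ha; have sg := sqfun_valP (L2_repr g); have so := orb_sq ha.
rewrite -(ler_pXn2r (ltn0Sn 1)) ?nnegrE ?mulr_ge0 ?l2norm_ge0//.
rewrite real_normK ?num_real// exprMn L2_normE !sqr_l2norm//.
by apply: Rintegral_cs => //; exact: sqint_dot_integrable.
Qed.

Lemma rangeE : range T = [set g | forall a, K a -> obstruction a g = 0].
Proof.
apply/seteqP; split=> g /= => [[x _ <-] a ha|orth].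
  exact: (range_orthogonal JT JJ al0 bA sA cA fX dp dm (sqfun_valP _) (T_sol x) ha).
have hg := sqfun_valP (L2_repr g).
have [u hu su] := solvable JT JJ al0 bA sA cA fX dp dm hg orth.
have [x _ hx] := sol_H1 JJ al0 bA cA hu hg su.
by exists x => //; apply: L2_ext; apply: leb_aeS2 hx (hT x) => t -> <-.
Qed.

Lemma range_closed : closed (range T).
Proof.
rewrite rangeE => g cg a ha; apply/eqP; rewrite -normr_le0.
apply/ler_addgt0Pr => e e0; rewrite add0r.
have c0 : 0 < l2norm (orb X a) + 1 by rewrite ltr_wpDl ?l2norm_ge0.
have [h [hh gh]] := cg _ (nbhsx_ballx g _ (divr_gt0 e0 c0)).
have := obstruction_lin (- 1) h g ha; rewrite (hh a ha) mulr0 add0r => <-.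
rewrite (le_trans (obstruction_le _ ha))// scaleN1r addrC.
move: gh; rewrite -ball_normE /= => /ltW gh.
rewrite (le_trans (ler_wpM2l (l2norm_ge0 _) gh))// mulrCA ler_piMr ?(ltW e0)//.
by rewrite ler_pdivrMr// mul1r lerDl.
Qed.

Lemma orbit_self a : K a -> \int[mu]_t dot (orb X a t) (orb X a t) = 0 -> a = 0.
Proof.
move=> ha h; have so := orb_sq ha; have io := sqint_dot_integrable so so.
have co : vcont (orb X a) by exact: (orb_vcont fX).
have cd := continuous_dot co co.
have h1 : \int[mu]_(t in `[-1, 1]) dot (orb X a t) (orb X a t) = 0.
  apply/eqP; rewrite eq_le Rintegral_ge0 ?andbT//; last by move=> t _; exact: dotvv_ge0.
  by rewrite -h; apply: integral_le_T => // t; exact: dotvv_ge0.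
have := integral_continuous_eq0 cd (fun t => dotvv_ge0 (orb X a t)) h1.
by move=> /(_ 0); rewrite ltrN10 ltr01 => /(_ isT)/dotvv_eq0; rewrite (orb0 fX).
Qed.

Lemma orb_sum m (k : 'I_m -> V) (c : 'I_m -> R) t :
  orb X (\sum_i c i *: k i) t = \sum_i c i *: orb X (k i) t.
Proof. by rewrite /orb mulmx_sumr; apply: eq_bigr => i _; rewrite scalemxAr. Qed.

Lemma orbit_pairing_sum m (k : 'I_m -> V) (f : R -> V) : f \in @sqint R n ->
    (forall i, K (k i)) -> forall c : 'I_m -> R,
  \int[mu]_t dot (orb X (\sum_i c i *: k i) t) (f t) =
  \sum_i c i * \int[mu]_t dot (orb X (k i) t) (f t).
Proof.
move=> hf hk c; have ik i := sqint_dot_integrable (orb_sq (hk i)) hf.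
suff [_ ->] : K (\sum_i c i *: k i) /\
  \int[mu]_t dot (orb X (\sum_i c i *: k i) t) (f t) =
  \sum_i c i * \int[mu]_t dot (orb X (k i) t) (f t) by [].
elim: (index_enum _) => [|i r [Kr er]].
  rewrite !big_nil; split=> //; rewrite (@eq_Rintegral _ _ _ mu _ (fun=> 0)).
    by rewrite /Rintegral integral0.
  by move=> t _; rewrite /orb mulmx0 dot0l.
rewrite !big_cons -er; split; first exact: Kl.
have ir := sqint_dot_integrable (orb_sq Kr) hf.
rewrite -RintegralZl// -RintegralD//.
  by apply: eq_Rintegral => t _; rewrite orb_lin dotDl dotZl.
rewrite (_ : EFin \o _ = (fun t => (c i)%:E * (dot (orb X (k i) t) (f t))%:E)%E)//.
by apply: integrableZl => //; exact: ik.
Qed.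

(** The solutions decaying in both directions span the kernel and, through their
classes, a complement of the range. *)
Theorem fredholm_alternative : Phi0 T.
Proof.
have [m [k [hk kfree kspan]]] := subspace_basis K0 Kl.
have Ksum c : K (\sum_i c i *: k i).
  elim: (index_enum _) => [|i r ih]; first by rewrite big_nil.
  by rewrite big_cons; exact: Kl.
split; [exact: cT|exact: range_closed|exists m].
pose e i := L2_of (orb X (k i)).
have [x hx] : exists x : 'I_m -> H1 R n, forall i, H1_fun (x i) = orb X (k i) /\ T (x i) = 0.
  have : forall i, exists y : H1 R n, H1_fun y = orb X (k i) /\ T y = 0.
    by move=> i; have [y ? ?] := kernel_element (hk i); exists y.
  by case/choice => x hx; exists x.
have xsum (c : 'I_m -> R) : H1_fun (\sum_i c i *: x i) = orb X (\sum_i c i *: k i).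
  apply/funext => t; rewrite orb_sum.
  elim: (index_enum _) => [|i r ih]; first by rewrite !big_nil.
  by rewrite !big_cons -ih -(hx i).1.
have Txsum (c : 'I_m -> R) : T (\sum_i c i *: x i) = 0.
  rewrite linear_sum big1// => i _; rewrite linearZ/= (hx i).2; exact: scaler0.
split.
  exists x; split.
    move=> c /= c0; apply: kfree.
    by rewrite -(orb0 fX (\sum_i _)) -xsum c0.
  apply/seteqP; split=> y /= => [Ty|[c _ <-]]; last exact: Txsum.
  have [Ky yE] := kernel_orbit Ty; have [c hc] := kspan _ Ky.
  by exists c => //; apply: H1_eqT; rewrite ?Ty// xsum -hc.
have esum (c : 'I_m -> R) : {ae mu, forall t,
    L2_repr (\sum_i c i *: e i) t = orb X (\sum_i c i *: k i) t}.
  elim: (index_enum _) => [|i r ih].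
    by rewrite !big_nil; apply: leb_aeS (L2_repr0 R n) => t ->; rewrite /orb mulmx0.
  have h1 : {ae mu, forall t, L2_repr (c i *: e i) t = c i *: orb X (k i) t}.
    by apply: leb_aeS2 (L2_reprZ (c i) (e i)) (L2_repr_of (orb_sq (hk i))) => t -> ->.
  rewrite !big_cons; set g := \sum_(j <- r) _ in ih *; set a := \sum_(j <- r) _ in ih *.
  have h2 : {ae mu, forall t, L2_repr (c i *: e i + g) t = L2_repr (c i *: e i) t + orb X a t}.
    by apply: leb_aeS2 (L2_reprD (c i *: e i) g) ih => t -> ->.
  by apply: leb_aeS2 h1 h2 => t e1 ->; rewrite e1 orb_lin.
exists e; split=> [c|v].
  rewrite rangeE => /= hc; apply: kfree; apply: orbit_self (Ksum c) _.
  by rewrite -(obstruction_ae (Ksum c) (orb_sq (Ksum c)) (esum c)) hc.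
pose B a b := \int[mu]_t dot (orb X a t) (orb X b t).
have BC a b : B a b = B b a by apply: eq_Rintegral => t _; rewrite dotC.
have BD (c : 'I_m -> R) b : K b -> B (\sum_i c i *: k i) b = \sum_i c i * B (k i) b.
  by move=> hb; exact: orbit_pairing_sum (orb_sq hb) hk c.
pose G : 'M[R]_m := \matrix_(i, j) B (k i) (k j).
have GE (c : 'I_m -> R) j : ((\row_i c i) *m G) 0 j = B (\sum_i c i *: k i) (k j).
  by rewrite mxE BD//; apply: eq_bigr => i _; rewrite !mxE.
have uG : G \in unitmx.
  rewrite -row_free_unit -kermx_eq0; apply/eqP/row_matrixP => i; rewrite row0.
  pose c j := kermx G i j; have cE : row i (kermx G) = \row_j c j.
    by apply/rowP => j; rewrite !mxE.
  have c0 j : B (\sum_i c i *: k i) (k j) = 0.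
    by rewrite -GE -cE -row_mul mulmx_ker row0 mxE.
  rewrite cE; apply/rowP => j; rewrite !mxE; apply: kfree.
  apply: orbit_self (Ksum c) _; rewrite -[LHS]/(B _ _) BD// big1// => l _.
  by rewrite BC c0 mulr0.
pose b : 'rV[R]_m := \row_j obstruction (k j) v.
pose c i := (b *m invmx G) 0 i; exists c.
rewrite rangeE => /= a ha; have [d ->] := kspan a ha.
have sv := sqfun_valP (L2_repr (v - \sum_i c i *: e i)).
rewrite /obstruction orbit_pairing_sum// big1// => j _.
rewrite -[X in d j * X]/(obstruction (k j) _) addrC -scaleN1r.
rewrite obstruction_lin// (obstruction_ae (hk j) (orb_sq (Ksum c)) (esum c)).
rewrite -[X in -1 * X]/(B (k j) (\sum_i c i *: k i)) BC -GE.
have -> : \row_i c i = b *m invmx G by apply/rowP => i; rewrite mxE.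
by rewrite mulmxKV// mxE mulN1r addNr mulr0.
Qed.

End FredholmAlternative.

(** * Monodromy at the two ends *)

Section Monodromy.
Variables (R : realType) (n : nat) (J : 'M[R]_n).
Hypotheses (JT : J^T = - J) (JJ : J *m J = - 1%:M).
Implicit Types (A X : R -> 'M[R]_n).

Lemma flow_fundamental A X : flow_of J A X -> fundamental_matrix J A X.
Proof.
move=> [X0 dX]; have dX1 t : derivable X t 1.
  by apply/derivable_mxP => i j; have [] := dX t i j.
split => // t; rewrite derive1E derive_mx//.
have -> : \matrix_(i, j) 'D_1 (fun t => X t i j) t = - (J *m (A t *m X t)).
  by apply/matrixP => i j; rewrite mxE; have [] := dX t i j.
by rewrite mulmxN (mulmxA J J) JJ mulNmx mul1mx opprK subrr.
Qed.

Lemma multiplier_flow A X T z : flow_of J A X ->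
  eigenvalue (map_mx (real_complex R) (X T)) z -> characteristic_multiplier J A T z.
Proof. by move=> fX hz; exists X => //; exact: flow_fundamental. Qed.

Lemma eigenvalue_inv (M M' : 'M[R]_n) z : M *m M' = 1%:M ->
    eigenvalue (map_mx (real_complex R) M) z ->
  z != 0 /\ eigenvalue (map_mx (real_complex R) M') z^-1.
Proof.
move=> MM /eigenvalueP[v vM v0].
have e : v = z *: (v *m map_mx (real_complex R) M').
  by rewrite scalemxAl -vM -mulmxA -map_mxM MM map_mx1 mulmx1.
have z0 : z != 0 by apply: contra_neq v0 => z0; rewrite e z0 scale0r.
split => //; apply/eigenvalueP; exists v => //.
by rewrite {2}e scalerA mulVf// scale1r.
Qed.

(** The hypotheses of an asymptotically hyperbolic end, reduced to the single
consequence used on the line. *)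
Lemma dichotomy_at_end A X al Ap XP T : 0 <= al -> (forall t, mnorm (A t) <= al) ->
    (forall t, (A t)^T = A t) -> mcont A -> flow_of J A X ->
    (forall t, mnorm (Ap t) <= al) -> (forall t, (Ap t)^T = Ap t) -> mcont Ap ->
    flow_of J Ap XP -> 0 < T -> (forall t, Ap (t + T) = Ap t) ->
    (forall e, 0 < e -> exists t0, forall t, t0 <= t -> mnorm (A t - Ap t) <= e) ->
    (forall z, eigenvalue (map_mx (real_complex R) (XP T)) z -> `|z| != 1) ->
  dichotomy J A X.
Proof.
move=> al0 bA sA cA fX bp sp cp fP T0 per lim hyp.
have [tau [P [Q [k0 [C [tau0 PQ [rP rQ] C0 grow]]]]]] :=
  asymptotic_expanding JT JJ al0 bA sA cA bp sp cp fP T0 per lim hyp.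
move=> u f hf hu hpair.
exact: (half_line_bounded JT JJ al0 bA sA cA fX tau0 rP rQ C0 grow hf hu hpair).
Qed.

End Monodromy.

Section AsymptoticallyPeriodic.
Variables (R : realType) (n : nat) (J : 'M[R]_n).
Hypotheses (JT : J^T = - J) (JJ : J *m J = - 1%:M).
Variables (A Ap Am : R -> 'M[R]_n) (al Tp Tm : R).
Hypotheses (al0 : 0 <= al) (bA : forall t, mnorm (A t) <= al)
  (bp : forall t, mnorm (Ap t) <= al) (bm : forall t, mnorm (Am t) <= al).
Hypotheses (sA : forall t, (A t)^T = A t) (sp : forall t, (Ap t)^T = Ap t)
  (sm : forall t, (Am t)^T = Am t).
Hypotheses (cA : mcont A) (cp : mcont Ap) (cm : mcont Am).
Hypotheses (Tp0 : 0 < Tp) (Tm0 : 0 < Tm)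
  (pp : forall t, Ap (t + Tp) = Ap t) (pm : forall t, Am (t + Tm) = Am t).
Hypotheses
  (limp : forall e, 0 < e -> exists t0, forall t, t0 <= t -> mnorm (A t - Ap t) <= e)
  (limm : forall e, 0 < e -> exists t0, forall t, t <= t0 -> mnorm (A t - Am t) <= e).
Hypotheses
  (hp : forall z, characteristic_multiplier J Ap Tp z -> `|z| != 1)
  (hm : forall z, characteristic_multiplier J Am Tm z -> `|z| != 1).

Lemma dichotomy_forward X : flow_of J A X -> dichotomy J A X.
Proof.
move=> fX; have [XP fP] := flow_ex J cp.
apply: (dichotomy_at_end JT JJ al0 bA sA cA fX bp sp cp fP Tp0 pp limp).
by move=> z hz; apply: hp; exact: (multiplier_flow JJ fP hz).
Qed.

(** Reversing time replaces the monodromy matrix by its inverse. *)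
Lemma dichotomy_backward X : flow_of J A X ->
  dichotomy (- J) (fun t => A (- t)) (fun t => X (- t)).
Proof.
move=> fX; have [XM fM] := flow_ex J cm.
have JT' : (- J)^T = - (- J) by rewrite -[in RHS]JT; apply/matrixP => i j; rewrite !mxE.
have JJ' : - J *m - J = - 1%:M by rewrite mulNmx mulmxN opprK.
have per t : Am (- (t + Tm)) = Am (- t).
  by rewrite -(pm (- (t + Tm))) opprD subrK.
have lim e : 0 < e -> exists t0, forall t, t0 <= t -> mnorm (A (- t) - Am (- t)) <= e.
  by move=> /limm[t0 ht]; exists (- t0) => t tt; apply: ht; rewrite lerNl.
apply: (dichotomy_at_end JT' JJ' al0 (fun t => bA (- t)) (fun t => sA (- t))
  (mcont_opp cA) (flow_opp fX) (fun t => bm (- t)) (fun t => sm (- t))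
  (mcont_opp cm) (flow_opp fM) Tm0 per lim) => z /=.
have MM : XM (- Tm) *m XM Tm = 1%:M.
  have := flow_periodic JT JJ sm cm fM pm 1 (- Tm).
  by rewrite mul1r addNr fM.1 expr1 => ->.
move=> /(eigenvalue_inv MM)[z0 hz].
have := hm (multiplier_flow JJ fM hz).
by rewrite normfV invr_eq1.
Qed.

Theorem hamiltonian_fredholm (T : {linear H1 R n -> L2 R n}) : continuous T ->
    (forall x, {ae @lebesgue_measure R,
       forall t, J *m wd x t - A t *m x t = L2_repr (T x) t}) ->
  exists2 X, flow_of J A X & Phi0 T /\
    [set u | exists2 x : H1 R n, H1_fun x = u & T x = 0] =
    [set u | bistable X (u 0) /\ u = orb X (u 0)].
Proof.
move=> cT hT; have [X fX] := flow_ex J cA; exists X => //.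
have dp := dichotomy_forward fX; have dm := dichotomy_backward fX.
split; first exact: (fredholm_alternative JT JJ al0 bA sA cA fX dp dm cT hT).
exact: (kernelE JT JJ al0 bA sA cA fX dp dm hT).
Qed.

End AsymptoticallyPeriodic.

(** * Partial derivatives *)

Section PartialDerivatives.
Variables (R : realType) (n : nat).
Local Notation V := ('cV[R]_n).
Implicit Types (f : V -> R) (a v x y : V).

Lemma is_derive_line f a v (s : R) : derivable f (a + s *: v) v ->
  is_derive s 1 (fun r => f (a + r *: v)) ('D_v f (a + s *: v)).
Proof.
move=> df.
have e : (fun h : R => h^-1 *: ((fun r => f (a + r *: v)) (h *: 1 + s) -
    (fun r => f (a + r *: v)) s)) =
    (fun h => h^-1 *: ((f \o shift (a + s *: v)) (h *: v) - f (a + s *: v))).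
  apply/funext => h /=; congr (_ *: (f _ - _)).
  by rewrite [h *: 1]mulr1 scalerDl addrCA.
by split; [rewrite /derivable|rewrite /derive]; rewrite e.
Qed.

Lemma mvt_segment f a v (h : R) : (forall y, derivable f y v) ->
  exists2 s, `|s| <= `|h| & f (a + h *: v) - f a = h * 'D_v f (a + s *: v).
Proof.
move=> df; have pos a' (k : R) : 0 < k ->
    exists2 s, 0 <= s <= k & f (a' + k *: v) - f a' = k * 'D_v f (a' + s *: v).
  move=> k0; have [||s] := @MVT R (fun r => f (a' + r *: v)) (fun r => 'D_v f (a' + r *: v)) 0 k k0.
  - by move=> r _; exact: is_derive_line.
  - apply: continuous_subspaceT => r; apply: differentiable_continuous.
    by apply/derivable1_diffP; have [] := is_derive_line (df (a' + r *: v)).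
  rewrite in_itv/= => /andP[s0 sk]; rewrite scale0r addr0 subr0 => e.
  by exists s; rewrite ?e ?(ltW s0) ?(ltW sk)// mulrC.
have [h0|h0|->] := ltgtP h 0.
- have [|s /andP[s0 sh] e] := pos (a + h *: v) (- h); first by rewrite oppr_gt0.
  exists (h + s).
    by rewrite !ler0_norm ?(ltW h0)//; lra.
  move: e; rewrite -addrA -scalerDl subrr scale0r addr0 -addrA -scalerDl => e.
  by rewrite -opprB e mulNr opprK.
- have [s /andP[s0 sh] e] := pos a h h0; exists s => //.
  by rewrite !ger0_norm// ltW.
- by exists 0; rewrite // scale0r addr0 subrr mul0r.
Qed.

Lemma halves (p q m e : R) : `|p - m| <= e / 2 -> `|q - m| <= e / 2 -> `|p - q| <= e.
Proof. by rewrite !ler_norml => /andP[? ?] /andP[? ?]; apply/andP; split; lra. Qed.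

(** Both iterated derivatives are limits of the same second difference quotient. *)
Lemma schwarz f x (u v : V) : (forall y, derivable f y u) -> (forall y, derivable f y v) ->
    (forall y, derivable ('D_u f) y v) -> (forall y, derivable ('D_v f) y u) ->
    continuous ('D_v ('D_u f)) -> continuous ('D_u ('D_v f)) ->
  'D_v ('D_u f) x = 'D_u ('D_v f) x.
Proof.
have second g (p q : V) (h : R) : (forall y, derivable g y p) ->
    (forall y, derivable ('D_p g) y q) -> 0 < h ->
    exists s r, [/\ `|s| <= h, `|r| <= h &
      g (x + h *: p + h *: q) - g (x + h *: p) - g (x + h *: q) + g x =
      h * h * 'D_q ('D_p g) (x + s *: p + r *: q)].
  move=> dg dgg h0.
  pose G y := g (y + h *: q) - g y.
  have dgq y : derivable (fun z => g (z + h *: q)) y p /\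
      'D_p (fun z => g (z + h *: q)) y = 'D_p g (y + h *: q).
    have e : (fun k : R => k^-1 *: (((fun z => g (z + h *: q)) \o shift y) (k *: p) -
        g (y + h *: q))) = (fun k : R => k^-1 *: ((g \o shift (y + h *: q)) (k *: p) -
        g (y + h *: q))) by apply/funext => k /=; rewrite addrA.
    by split; [rewrite /derivable e; exact: dg|rewrite /derive e].
  have dG y : derivable G y p by apply: derivableB; [case: (dgq y)|exact: dg].
  have [s sh e1] := mvt_segment x h dG.
  have [r rh e2] := mvt_segment (x + s *: p) h dgg.
  exists s, r; split; [by rewrite (le_trans sh)// gtr0_norm|by rewrite (le_trans rh)// gtr0_norm|].
  have -> : g (x + h *: p + h *: q) - g (x + h *: p) - g (x + h *: q) + g x =
    G (x + h *: p) - G x by rewrite /G; ring.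
  rewrite e1 -mulrA -e2; congr (_ * _).
  by rewrite (deriveB (dgq (x + s *: p)).1 (dg _)) (dgq _).2.
move=> du dv duv dvu c1 c2; apply/eqP; rewrite -subr_eq0 -normr_le0.
apply/ler_addgt0Pr => e e0; rewrite add0r; have e2 : 0 < e / 2 by rewrite divr_gt0.
have := c1 x => /cvgrPdist_le/(_ _ e2)/nbhs_ballP[d1 /= d10 h1].
have := c2 x => /cvgrPdist_le/(_ _ e2)/nbhs_ballP[d2 /= d20 h2].
pose N := `|u| + `|v| + 1; have N0 : 0 < N by rewrite ltr_wpDl ?addr_ge0.
pose d := Num.min d1 d2 / N / 2.
have d0 : 0 < d by rewrite !divr_gt0 ?lt_min ?d10.
have close (p q : V) (s r : R) : `|p| + `|q| <= N -> `|s| <= d -> `|r| <= d ->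
    `|x - (x + s *: p + r *: q)| < Num.min d1 d2.
  move=> pq sd rd; rewrite -addrA opprD addrA subrr sub0r normrN.
  rewrite (le_lt_trans (ler_normD _ _))// !normrZ.
  apply: (@le_lt_trans _ _ (d * (`|p| + `|q|))).
    by rewrite mulrDr lerD// ler_wpM2r.
  apply: (@le_lt_trans _ _ (d * N)); first by rewrite ler_wpM2l ?(ltW d0).
  rewrite /d mulrAC divfK ?lt0r_neq0// ltr_pdivrMr// mulr_natr mulr2n ltrDl.
  by rewrite lt_min d10.
have N1 : `|u| + `|v| <= N by rewrite /N lerDl.
have N2 : `|v| + `|u| <= N by rewrite addrC.
clearbody d N.
have [s [r [sd rd E1]]] := second f u v d du duv d0.
have [s' [r' [sd' rd' E2]]] := second f v u d dv dvu d0.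
have EE : 'D_v ('D_u f) (x + s *: u + r *: v) = 'D_u ('D_v f) (x + s' *: v + r' *: u).
  rewrite (addrAC x (d *: v)) [_ - _ - _]addrAC E1 in E2.
  by apply: (mulfI (lt0r_neq0 (mulr_gt0 d0 d0))).
have k1 : `|'D_v ('D_u f) x - 'D_v ('D_u f) (x + s *: u + r *: v)| <= e / 2.
  apply: h1; rewrite -ball_normE /=; apply: lt_le_trans (close u v s r N1 sd rd) _.
  by rewrite ge_min lexx.
have k2 : `|'D_u ('D_v f) x - 'D_u ('D_v f) (x + s' *: v + r' *: u)| <= e / 2.
  apply: h2; rewrite -ball_normE /=; apply: lt_le_trans (close v u s' r' N2 sd' rd') _.
  by rewrite ge_min lexx orbT.
rewrite -EE in k2; exact: halves k1 k2.
Qed.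

(** The increment is followed along the edges of a box. *)
Lemma coordinate_mean_value f (c : 'I_n -> R) e x : has_partials f -> 0 <= e ->
    (forall y, `|y| <= `|x| -> forall j, `|'D_(unitv R j) f y - c j| <= e) ->
  `|f x - f 0 - \sum_j x j 0 * c j| <= e * \sum_j `|x j 0|.
Proof.
move=> pf e0 hc.
pose y k : V := \col_j (if (j < k)%N then x j 0 else 0).
have y0 : y 0%N = 0 by apply/colP => j; rewrite !mxE.
have yn : y n = x by apply/colP => j; rewrite mxE ltn_ord.
have yle (z : V) : (forall j, `|z j 0| <= `|x j 0|) -> `|z| <= `|x|.
  move=> h; apply: mx_norm_le => // j i; rewrite (ord1 i) (le_trans (h j))//.
  exact: coord_le_norm.
have step (j : 'I_n) : `|f (y j.+1) - f (y j) - x j 0 * c j| <= e * `|x j 0|.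
  have -> : y j.+1 = y j + x j 0 *: unitv R j.
    apply/colP => i; rewrite !mxE eqxx andbT ltnS leq_eqVlt.
    have [ij|ij] := eqVneq (i : nat) j.
      by rewrite (val_inj ij) eqxx/= ltnn add0r mulr1.
    by rewrite -val_eqE/= (negbTE ij) mulr0 addr0.
  have [s sx ->] := mvt_segment (y j) (x j 0) (fun z => pf z j).
  rewrite -mulrBr normrM mulrC ler_wpM2r//; apply: hc; apply: yle => i.
  rewrite !mxE eqxx andbT; have [->|ij] := eqVneq i j.
    by rewrite ltnn add0r mulr1.
  by rewrite mulr0 addr0; case: ifP => _; rewrite // normr0.
have tel : f x - f 0 = \sum_(j < n) (f (y j.+1) - f (y j)).
  by rewrite -yn -y0 -(big_mkord xpredT (fun k => f (y k.+1) - f (y k))) telescope_sumr.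
rewrite tel -sumrB mulr_sumr (le_trans (ler_norm_sum _ _ _))//.
exact: ler_sum.
Qed.

End PartialDerivatives.

(** * The linearized Hamiltonian system *)

Section PeriodicLimits.
Variables (R : realType) (n : nat).
Implicit Types (g : R -> R) (A Ap : R -> 'M[R]_n).

Lemma mnorm_le_norm (M : 'M[R]_n) : mnorm M <= (n * n)%:R * `|M|.
Proof.
rewrite /mnorm (@le_trans _ _ (\sum_(i < n) \sum_(j < n) `|M|))//.
  by apply: ler_sum => i _; apply: ler_sum => j _; exact: coord_le_norm.
rewrite !sumr_const !card_ord -mulrnA -[leLHS]mulr_natl.
by [].
Qed.

Lemma coord_le_mnorm (M : 'M[R]_n) i j : `|M i j| <= mnorm M.
Proof.
rewrite /mnorm (bigD1 i)//= (bigD1 j)//= -addrA lerDl addr_ge0//.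
  by rewrite sumr_ge0.
by apply: sumr_ge0 => k _; rewrite sumr_ge0.
Qed.

Lemma mnormB (M N : 'M[R]_n) : mnorm M <= mnorm (M - N) + mnorm N.
Proof.
rewrite /mnorm -big_split/=; apply: ler_sum => i _; rewrite -big_split/=.
apply: ler_sum => j _; rewrite !mxE -[X in `|X| <= _](subrK (N i j)).
exact: ler_normD.
Qed.

Lemma segment_bounded g a b : continuous g -> exists M, forall t, a <= t <= b -> `|g t| <= M.
Proof.
move=> cg; have [ab|ab] := lerP a b; last first.
  by exists 0 => t /andP[at_ tb]; have := le_lt_trans (le_trans at_ tb) ab; rewrite ltxx.
have [|c _ hc] := @EVT_max R (fun t => `|g t|) a b ab.
  by apply: continuous_subspaceT => t; apply: cvg_norm; exact: cg.
by exists `|g c| => t tab; apply: hc; rewrite in_itv.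
Qed.

Lemma periodic_iter g T k t : (forall t, g (t + T) = g t) -> g (t + k%:R * T) = g t.
Proof.
move=> per; elim: k => [|k ih]; first by rewrite mul0r addr0.
by rewrite -natr1 mulrDl mul1r addrA per.
Qed.

Lemma periodic_bounded g T : continuous g -> 0 < T -> (forall t, g (t + T) = g t) ->
  exists M, forall t, `|g t| <= M.
Proof.
move=> cg T0 per; have [M hM] := segment_bounded 0 T cg; exists M.
have up k t : 0 <= t <= k.+1%:R * T -> `|g t| <= M.
  elim: k t => [|k ih] t /andP[t0 tk]; first by apply: hM; rewrite t0 -[T]mul1r.
  have [tT|tT] := lerP t T; first by apply: hM; rewrite t0.
  rewrite -[t](subrK T) per; apply: ih; rewrite subr_ge0 ltW//=.
  by rewrite lerBlDr -[X in _ + X]mul1r -mulrDl natr1.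
have pos t : 0 <= t -> `|g t| <= M.
  move=> t0; apply: (up (Num.bound (t / T))); rewrite t0/= -ler_pdivrMr//.
  rewrite (le_trans (ltW (archi_boundP _)))// ?divr_ge0 ?(ltW T0)//.
  by rewrite ler_nat.
move=> t; rewrite -(periodic_iter (Num.bound (`|t| / T)) t per); apply: pos.
have h : `|t| / T < (Num.bound (`|t| / T))%:R by rewrite archi_boundP// divr_ge0// ltW.
have := ler_norm (- t); rewrite normrN ltr_pdivrMr// in h * => h'.
by rewrite -lerBlDl sub0r (le_trans h')// ltW.
Qed.

Lemma periodic_limit0 g T : 0 < T -> (forall t, g (t + T) = g t) ->
    (forall e, 0 < e -> exists t0, forall t, t0 <= t -> `|g t| <= e) ->
  forall t, g t = 0.
Proof.
move=> T0 per lim t; apply/eqP; rewrite -normr_le0; apply/ler_addgt0Pr => e e0; rewrite add0r.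
have [t0 ht] := lim e e0.
rewrite -(periodic_iter (Num.bound (`|t0 - t| / T)) t per); apply: ht.
rewrite -lerBlDl (le_trans (ler_norm _))// -ler_pdivrMr// ltW// archi_boundP//.
by rewrite divr_ge0// ltW.
Qed.

Lemma mnorm_continuous A : mcont A -> continuous (fun t => mnorm (A t)).
Proof.
move=> cA; apply: continuous_rsum => i; apply: continuous_rsum => j t.
by apply: cvg_norm; exact: cA.
Qed.

Lemma end_bounded A Ap T : mcont A -> mcont Ap -> 0 < T -> (forall t, Ap (t + T) = Ap t) ->
    (forall e, 0 < e -> exists t0, forall t, t0 <= t -> mnorm (A t - Ap t) <= e) ->
  exists M, forall t, mnorm (Ap t) <= M /\ (0 <= t -> mnorm (A t) <= M).
Proof.
move=> cA cp T0 per lim.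
have [|M1 h1] := @periodic_bounded (fun t => mnorm (Ap t)) T (mnorm_continuous cp) T0.
  by move=> t; rewrite per.
have [t0 ht] := lim 1 ltr01.
have [M2 h2] := segment_bounded 0 t0 (mnorm_continuous cA).
exists (Num.max (1 + M1) M2) => t; split.
  by rewrite le_max (le_trans (le_trans (ler_norm _) (h1 t)))// lerDr.
move=> tp; rewrite le_max; have [tt|tt] := lerP t0 t.
  by rewrite (le_trans (mnormB _ (Ap t)))// lerD// ?ht// (le_trans (ler_norm _) (h1 t)).
by rewrite (le_trans (ler_norm _) (h2 t _)) ?orbT// tp ltW.
Qed.

(** The antisymmetric part is periodic and tends to zero. *)
Lemma end_symmetric A Ap T : (forall t, (A t)^T = A t) ->
    0 < T -> (forall t, Ap (t + T) = Ap t) ->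
    (forall e, 0 < e -> exists t0, forall t, t0 <= t -> mnorm (A t - Ap t) <= e) ->
  forall t, (Ap t)^T = Ap t.
Proof.
move=> sA T0 per lim t; apply/matrixP => i j; rewrite mxE; apply/eqP.
rewrite -subr_eq0; apply/eqP.
apply: (@periodic_limit0 (fun s => Ap s j i - Ap s i j) T) => // [s|e e0]; first by rewrite per.
have [t0 ht] := lim (e / 2) (divr_gt0 e0 (ltr0n _ 2)); exists t0 => s /ht h.
have h1 := le_trans (coord_le_mnorm _ i j) h; have h2 := le_trans (coord_le_mnorm _ j i) h.
apply: (@halves _ _ _ (A s i j)); last by move: h1; rewrite !mxE distrC.
have -> : A s i j = A s j i by rewrite -{1}[A s]sA mxE.
by move: h2; rewrite !mxE distrC.
Qed.

Lemma ends_bounded A Ap Am Tp Tm : mcont A -> mcont Ap -> mcont Am ->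
    0 < Tp -> 0 < Tm -> (forall t, Ap (t + Tp) = Ap t) -> (forall t, Am (t + Tm) = Am t) ->
    (forall e, 0 < e -> exists t0, forall t, t0 <= t -> mnorm (A t - Ap t) <= e) ->
    (forall e, 0 < e -> exists t0, forall t, t <= t0 -> mnorm (A t - Am t) <= e) ->
  exists al, [/\ 0 <= al, forall t, mnorm (A t) <= al, forall t, mnorm (Ap t) <= al &
    forall t, mnorm (Am t) <= al].
Proof.
move=> cA cp cm Tp0 Tm0 pp pm lp lm.
have [M1 h1] := end_bounded cA cp Tp0 pp lp.
have per t : Am (- (t + Tm)) = Am (- t) by rewrite -(pm (- (t + Tm))) opprD subrK.
have [|M2 h2] := @end_bounded (fun t => A (- t)) (fun t => Am (- t)) Tm
  (mcont_opp cA) (mcont_opp cm) Tm0 per.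
  by move=> e /lm[t0 ht]; exists (- t0) => t tt; apply: ht; rewrite lerNl.
exists (Num.max M1 M2); split => [|t|t|t]; rewrite le_max.
- by rewrite (le_trans (mnorm_ge0 _) (h1 0).1).
- have [t0|t0] := lerP 0 t; first by rewrite (h1 t).2.
  by have := (h2 (- t)).2; rewrite opprK oppr_ge0 => -> //; rewrite ?orbT// ltW.
- by rewrite (h1 t).1.
- by have := (h2 (- t)).1; rewrite opprK => ->; rewrite orbT.
Qed.

End PeriodicLimits.

Section Coefficients.
Variables (R : realType) (n : nat).
Local Notation V := ('cV[R]_n).
Variables (H : R -> V -> R -> R).
Hypotheses (H1 : hypH1 H) (H2 : hypH2 H).

Lemma derive_coord (g : V -> V) x j i : has_partials g ->
  derivable (fun y => g y i 0) x (unitv R j) /\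
  ('D_(unitv R j) g x) i 0 = 'D_(unitv R j) (fun y => g y i 0) x.
Proof.
by move=> pg; split; [exact: (derivable_mxP g x (unitv R j)).1 (pg x j) i 0|rewrite derive_mx// mxE].
Qed.

Lemma D2xHE t x l i j :
  D2xH H t x l i j = 'D_(unitv R j) (fun y => DxH H t y l i 0) x.
Proof. by case: H2 => _ [h _] _ _ _; rewrite mxE (derive_coord x j i (h t l)).2. Qed.

Lemma lin_coef_mcont l : mcont (lin_coef H l).
Proof.
move=> i j t; case: H2 => _ [_ h] _ _ _.
have hp : (fun s : R => (s, 0 : V, l)) @ t --> (t, 0 : V, l).
  apply: (@cvg_pair _ _ _ (nbhs t) (nbhs (t, 0 : V)) (nbhs l)); last exact: cvg_cst.
  by apply: (@cvg_pair _ _ _ (nbhs t) (nbhs t) (nbhs (0 : V))); [exact: cvg_id|exact: cvg_cst].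
have h1 := cvg_comp _ _ hp (h (t, 0, l)).
exact: (cvg_comp _ _ h1 (@coord_continuous _ _ _ i j (D2xH H t 0 l))).
Qed.

Lemma lin_coef_sym l t : (lin_coef H l t)^T = lin_coef H l t.
Proof.
apply/matrixP => i j; rewrite mxE !D2xHE.
case: H1 => _ /(_ t l)[_ [pf ck]] _.
have e k : (fun y => DxH H t y l k 0) = 'D_(unitv R k) (fun y => H t y l).
  by apply/funext => y; rewrite mxE.
rewrite !e; have [_ [pi ci]] := ck i; have [_ [pj cj]] := ck j.
exact: (@schwarz _ _ _ 0 (unitv R j) (unitv R i) (fun y => pf y j) (fun y => pf y i)
  (fun y => pj y i) (fun y => pi y j) (cj i).1 (ci j).1).
Qed.

Variables (g : R -> V -> R -> V) (T : R -> R) (l : R).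

Lemma asymptotic_coef (G : set_system R) {FG : Filter G} : asymptotic H G g T ->
  [/\ mcont (lim_coef g l), 0 < T l, forall t, lim_coef g l (t + T l) = lim_coef g l t &
      forall e, 0 < e -> \forall t \near G, mnorm (lin_coef H l t - lim_coef g l t) <= e].
Proof.
move=> /(_ l)[hb _ hu T0 per]; split; [|exact: T0| |].
- move=> i j t; have [_ [dg]] := hb i => /(_ j)[[cg _] _].
  have pg s : has_partials (fun y => g s y l).
    by move=> y k; apply/derivable_mxP => a b; rewrite (ord1 b); have [_ [+ _]] := hb a; apply.
  have -> : (fun s => lim_coef g l s i j) = fun s => 'D_(unitv R j) (fun y => g s y l i 0) 0.
    by apply/funext => s; rewrite mxE (derive_coord 0 j i (pg s)).2.
  have hp : (fun s : R => (s, 0 : V)) @ t --> (t, 0 : V).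
    by apply: (@cvg_pair _ _ _ (nbhs t) (nbhs t) (nbhs (0 : V))); [exact: cvg_id|exact: cvg_cst].
  exact: (cvg_comp _ _ hp (cg (t, 0))).
- move=> t; rewrite /lim_coef; have -> : (fun y => g (t + T l) y l) = fun y => g t y l.
    by apply/funext => y; exact: per.
  by [].
- move=> e e0; have c0 : 0 < e / ((n * n)%:R + 1) by rewrite divr_gt0// ltr_wpDl.
  have hB : bounded_set [set 0 : V] by apply: compact_bounded; exact: compact_set1.
  have := hu _ hB.
  move=> h.
  have : \forall t \near G, `|D2xH H t 0 l - jac (fun y => g t y l) 0| <= e / ((n * n)%:R + 1).
    apply: (h [set k | `|k 0| <= e / ((n * n)%:R + 1)]).
    apply/uniform_nbhs; exists [set p | `|p.1 - p.2| < e / ((n * n)%:R + 1)]; split.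
      rewrite -entourage_ballE; exists (e / ((n * n)%:R + 1)) => //= -[p q] /=.
      by rewrite -ball_normE.
    by move=> k /(_ 0 erefl) /=; rewrite sub0r normrN => /ltW.
  apply: filterS => t ht; rewrite (le_trans (mnorm_le_norm _))//.
  rewrite (le_trans (ler_wpM2l (ler0n _ _) ht))// mulrCA ler_piMr ?(ltW e0)//.
  by rewrite ler_pdivrMr ?mul1r ?lerDl// ltr_wpDl.
Qed.

End Coefficients.

(** * Decaying solutions and the derivative at the trivial solution *)

Section DecayingSolutions.
Variables (R : realType) (n : nat) (J : 'M[R]_n).
Hypotheses (JT : J^T = - J) (JJ : J *m J = - 1%:M).
Local Notation V := ('cV[R]_n).
Variables (H : R -> V -> R -> R) (l : R) (X : R -> 'M[R]_n).
Local Notation A := (lin_coef H l).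
Hypotheses (sA : forall t, (A t)^T = A t) (cA : mcont A) (fX : flow_of J A X).

Lemma cvg0_enorm (G : set_system R) {FG : Filter G} (u : R -> V) :
  u t @[t --> G] --> (0 : V) <-> (forall e, 0 < e -> \forall t \near G, enorm (u t) <= e).
Proof.
split=> [/cvgrPdist_le h e e0|h].
  have c0 : 0 < e / (n%:R + 1) by rewrite divr_gt0// ltr_wpDl.
  move: (h _ c0); apply: filterS => t; rewrite sub0r normrN => ht.
  have c1 : 0 <= e / (n%:R + 1) by exact: ltW.
  rewrite (le_trans (enorm_le_coord c1 _))//.
    by move=> i; exact: le_trans (coord_le_norm _ _ _) ht.
  by rewrite mulrCA ler_piMr ?(ltW e0)// ler_pdivrMr ?mul1r ?lerDl// ltr_wpDl.
apply/cvgrPdist_le => e e0; move: (h _ e0); apply: filterS => t ht.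
rewrite sub0r normrN mx_norm_le ?(ltW e0)// => i j.
by rewrite (ord1 j); exact: le_trans (coord_le_enorm _ _) ht.
Qed.

Lemma decaying_solutionsE :
  decaying_solutions J H l = [set u | bistable X (u 0) /\ u = orb X (u 0)].
Proof.
apply/seteqP; split=> u /=.
  move=> [du _ eu up um].
  have hu : hsol J A u.
    move=> t i; have dti := (derivable_mxP u t 1).1 (du t) i 0.
    suff -> : (- (J *m (A t *m u t))) i 0 = 'D_1 (fun s => u s i 0) t.
      by apply: DeriveDef.
    have /eqP := eu t; rewrite subr_eq0 => /eqP <-.
    by rewrite (JK JJ) opprK derive1E derive_mx// mxE.
  have uE := sol_flow JT JJ sA cA fX (hsol_sol cA hu); split => //; split=> e e0.
    have [M [_ hM]] := (cvg0_enorm u).1 up e e0.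
    by exists (M + 1) => t tM; rewrite -[X t *m _]/((fun s => X s *m u 0) t) -uE hM// (lt_le_trans _ tM)// ltrDl.
  have [M [_ hM]] := (cvg0_enorm u).1 um e e0.
  exists (- M + 1) => t tM; rewrite -[X (- t) *m _]/((fun s => X s *m u 0) (- t)) -uE hM//.
  by rewrite ltrNl (lt_le_trans _ tM)// ltrDl.
move=> [[hp hm] uE]; have uE' s : u s = X s *m u 0 by rewrite {1}uE.
have hu : hsol J A u by rewrite uE; exact: (flow_hsol fX).
have du t : derivable u t 1.
  by apply/derivable_mxP => i j; rewrite (ord1 j); have [] := hu t i.
have d1 : derive1 u = fun t => - (J *m (A t *m u t)).
  apply/funext => t; rewrite derive1E derive_mx//; apply/colP => i; rewrite mxE.
  by have [] := hu t i.
split.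
- exact: du.
- have hv : vcont (fun t => - (J *m (A t *m u t))).
    by apply: vcont_rhs => //; exact: hsol_vcont hu.
  by rewrite d1 => t; apply: cvg_mx => i j; rewrite (ord1 j); exact: hv.
- by move=> t; rewrite d1 mulmxN (JK JJ) opprK subrr.
- apply/cvg0_enorm => e e0; have [t0 ht] := hp e e0.
  exists t0; split; first exact: num_real.
  by move=> t /ltW /ht; rewrite (uE' t).
- apply/cvg0_enorm => e e0; have [t0 ht] := hm e e0.
  exists (- t0); split; first exact: num_real.
  by move=> t tt; rewrite (uE' t) -[t]opprK; apply: ht; rewrite lerNr ltW.
Qed.

End DecayingSolutions.

Section Linearization.
Variables (R : realType) (n : nat) (J : 'M[R]_n).
Hypotheses (JT : J^T = - J) (JJ : J *m J = - 1%:M).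
Local Notation mu := (@lebesgue_measure R).
Local Notation V := ('cV[R]_n).
Variables (H : R -> V -> R -> R) (l : R).
Hypotheses (hH1 : hypH1 H) (hH2 : hypH2 H)
  (hH3 : forall i, bundle 1 (fun t x => DxH H t x l i 0)).
Local Notation A := (lin_coef H l).

(** Equicontinuity at the origin of the second derivatives makes the
linearization error small relative to the argument, uniformly in time. *)
Lemma linearization_error e : 0 < e -> exists2 d, 0 < d &
  forall t (xi : V), enorm xi <= d -> enorm (DxH H t xi l - A t *m xi) <= e * enorm xi.
Proof.
move=> e0; pose e' := e / ((n * n)%:R + 1).
have e'0 : 0 < e' by rewrite divr_gt0// ltr_wpDl.
have near0 i j : \forall y \near (0 : V), forall t,
    `|'D_(unitv R j) (fun x => DxH H t x l i 0) y - A t i j| <= e'.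
  have [_ [_ /(_ j)[[_ eq] _]]] := hH3 i.
  have : entourage [set p : R * R | `|p.1 - p.2| < e'].
    by rewrite -entourage_ballE; exists e' => //= -[p q] /=; rewrite -ball_normE.
  move=> /(eq 0); apply: filterS => y hy t.
  by rewrite /lin_coef D2xHE// distrC; exact: ltW (hy t I).
have : \forall y \near (0 : V), forall i j t,
    `|'D_(unitv R j) (fun x => DxH H t x l i 0) y - A t i j| <= e'.
  exact: (@filter_forall _ _ _ (nbhs (0 : V)) _
    (fun i => @filter_forall _ _ _ (nbhs (0 : V)) _ (near0 i))).
move=> /nbhs_ballP[r /= r0 hr]; exists (r / 2); first by rewrite divr_gt0.
move=> t xi xr.
have coord i : `|(DxH H t xi l - A t *m xi) i 0| <= e' * (n%:R * enorm xi).
  have [_ [pf _]] := hH3 i.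
  have -> : (DxH H t xi l - A t *m xi) i 0 =
      DxH H t xi l i 0 - DxH H t 0 l i 0 - \sum_j xi j 0 * A t i j.
    have [_ _ h0] := hH1; rewrite h0 !mxE subr0; congr (_ - _).
    by apply: eq_bigr => j _; rewrite mulrC.
  apply: le_trans (coordinate_mean_value (pf t) (ltW e'0) _) _.
    move=> y yx j; apply: hr; rewrite -ball_normE /= sub0r normrN.
    rewrite (le_lt_trans yx)//; apply: (@le_lt_trans _ _ (r / 2)).
      rewrite (le_trans _ xr)// mx_norm_le ?enorm_ge0// => i' j'.
      by rewrite (ord1 j') coord_le_enorm.
    by rewrite ltr_pdivrMr// mulr_natr mulr2n ltrDl.
  rewrite ler_wpM2l ?(ltW e'0)//.
  rewrite (le_trans (ler_sum _ (fun j _ => coord_le_enorm xi j)))//.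
  by rewrite sumr_const card_ord -[leLHS]mulr_natl.
have c0 : 0 <= e' * (n%:R * enorm xi) by apply: mulr_ge0; [exact: ltW|rewrite mulr_ge0 ?enorm_ge0].
rewrite (le_trans (enorm_le_coord c0 coord))//.
have -> : n%:R * (e' * (n%:R * enorm xi)) = e' * (n * n)%:R * enorm xi.
  by rewrite natrM; ring.
rewrite ler_wpM2r ?enorm_ge0// /e' mulrAC ler_pdivrMr ?ltr_wpDl//.
by rewrite ler_wpM2l ?(ltW e0)// lerDl.
Qed.

Lemma l2norm_le_pointwise (f g : R -> V) c : f \in @sqint R n -> g \in @sqint R n ->
  0 <= c -> (forall t, enorm (f t) <= c * enorm (g t)) -> l2norm f <= c * l2norm g.
Proof.
move=> hf hg c0 fg; rewrite -(ler_pXn2r (ltn0Sn 1)) ?nnegrE ?mulr_ge0 ?l2norm_ge0//.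
rewrite exprMn !sqr_l2norm//.
have ig := sqint_dot_integrable hg hg.
rewrite -RintegralZl//; apply: le_Rintegral => //; first exact: sqint_dot_integrable.
  rewrite (_ : EFin \o _ = (fun t => (c ^+ 2)%:E * (dot (g t) (g t))%:E)%E)//.
  exact: integrableZl.
move=> t _; rewrite !dotvv -exprMn ler_sqr ?nnegrE ?mulr_ge0 ?enorm_ge0//.
Qed.

Variable al : R.
Hypotheses (al0 : 0 <= al) (bA : forall t, mnorm (A t) <= al) (cA : mcont A).

Definition lin_fun (x : H1 R n) : R -> V := fun t => J *m wd x t - A t *m x t.

Lemma sqint_J (f : R -> V) : f \in @sqint R n -> (fun t => J *m f t) \in @sqint R n.
Proof.
move=> hf; apply: (@sqint_mulmx _ _ (fun=> J) (mnorm J)) => //; first exact: mnorm_ge0.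
exact: mcont_cst.
Qed.

Lemma sqintB (f g : R -> V) : f \in @sqint R n -> g \in @sqint R n ->
  (fun t => f t - g t) \in @sqint R n.
Proof. by move=> hf hg; have := rpredB hf hg. Qed.

Lemma lin_fun_sqint x : lin_fun x \in @sqint R n.
Proof.
apply: sqintB; first by apply: sqint_J; exact: wd_sqint.
by apply: sqint_mulmx al0 bA cA _; exact: H1_sqint.
Qed.

Definition lin_op (x : H1 R n) : L2 R n := L2_of (lin_fun x).

Lemma lin_op_repr x : {ae mu, forall t, J *m wd x t - A t *m x t = L2_repr (lin_op x) t}.
Proof. by apply: leb_aeS (L2_repr_of (lin_fun_sqint x)) => t ->. Qed.

Lemma lin_op_linear : linear lin_op.
Proof.
move=> c x y; apply: L2_ext.
have hw : {ae mu, forall t, wd (c *: x + y) t = c *: wd x t + wd y t}.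
  have h := L2_reprD (c *: H1_deriv x) (H1_deriv y).
  apply: leb_aeS2 h (L2_reprZ c (H1_deriv x)) => t e1 e2.
  by rewrite -[LHS]/(L2_repr (c *: H1_deriv x + H1_deriv y) t) e1 e2.
have h1 := leb_aeS2 (fun t => @conj _ _) (L2_repr_of (lin_fun_sqint (c *: x + y))) hw.
have h2 := leb_aeS2 (fun t => @conj _ _) (L2_repr_of (lin_fun_sqint x)) (L2_repr_of (lin_fun_sqint y)).
have h3 := leb_aeS2 (fun t => @conj _ _) (L2_reprD (c *: lin_op x) (lin_op y)) (L2_reprZ c (lin_op x)).
apply: leb_aeS2 (leb_aeS2 (fun t => @conj _ _) h1 h2) h3 => t [[e1 e2] [e3 e4]] [e5 e6].
rewrite /lin_op e1 e5 e6 e3 e4 /lin_fun e2.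
rewrite -[H1_fun (c *: x + y) t]/(c *: x t + y t).
by rewrite !mulmxDr -!scalemxAr scalerBr opprD addrACA.
Qed.

Lemma lin_op_map : exists T : {linear H1 R n -> L2 R n}, T = lin_op :> (H1 R n -> L2 R n).
Proof.
pose m := GRing.isLinear.Build R (H1 R n) (L2 R n) *:%R lin_op lin_op_linear.
pose T : {linear H1 R n -> L2 R n} := HB.pack lin_op m.
by exists T.
Qed.

Lemma L2_of_norm (f : R -> V) : f \in @sqint R n -> `|L2_of f| = l2norm f.
Proof.
move=> hf; have -> : f = sqfun_val (SqFun hf) by [].
by rewrite /L2_of valKd; exact: L2_norm_class.
Qed.

Lemma lin_op_bound x : `|lin_op x| <= (1 + al) * `|x|.
Proof.
rewrite L2_of_norm ?lin_fun_sqint//.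
have h1 := sqint_J (wd_sqint x); have h2 := sqint_mulmx al0 bA cA (H1_sqint x).
have h3 : (- 1 : R) *: (fun t => A t *m x t) \in @sqint R n by exact: rpredZ.
have -> : lin_fun x = (fun t => J *m wd x t) + (- 1) *: (fun t => A t *m x t).
  by apply/funext => t; rewrite /lin_fun -[RHS]/(_ + (- 1) *: _) scaleN1r.
rewrite (le_trans (l2normD h1 h3))// l2normZ// normrN1 mul1r mulrDl mul1r lerD//.
  rewrite (le_trans _ (wd_le_H1 x))// -[leRHS]mul1r.
  by apply: l2norm_le_pointwise => // [|t]; [exact: wd_sqint|rewrite (enormJ JT JJ) mul1r].
rewrite (le_trans _ (ler_wpM2l al0 (l2norm_le_H1 x)))//.
apply: l2norm_le_pointwise => // [|t]; first exact: H1_sqint.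
by rewrite (le_trans (enorm_mul _ _))// ler_wpM2r ?enorm_ge0.
Qed.

Lemma lin_op_continuous : continuous lin_op.
Proof.
have [T TE] := lin_op_map; rewrite -TE.
apply: bounded_linear_continuous; apply/linear_boundedP.
exists (1 + al); split; first exact: num_real.
move=> c cc x; rewrite TE (le_trans (lin_op_bound x))// ler_wpM2r//; exact: ltW.
Qed.

Lemma hamF0 : hamF J H l 0 = 0.
Proof.
have [_ _ h0] := hH1; apply: L2_ext.
have e0 : (fun t => J *m L2_repr (H1_deriv (0 : H1 R n)) t - DxH H t ((0 : H1 R n) t) l) =
    fun t => J *m wd (0 : H1 R n) t.
  by apply/funext => t; rewrite -[H1_fun 0 t]/(0 : V) h0 subr0.
have h1 := L2_repr_of (sqint_J (wd_sqint (0 : H1 R n))).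
have h2 : {ae mu, forall t, wd (0 : H1 R n) t = 0} := L2_repr0 R n.
rewrite /hamF e0.
have h3 : {ae mu, forall t, L2_repr (L2_of (fun t => J *m wd (0 : H1 R n) t)) t = 0}.
  by apply: leb_aeS2 h1 h2 => t -> ->; rewrite mulmx0.
by apply: leb_aeS2 h3 (L2_repr0 R n) => t -> ->.
Qed.

Lemma DxH_along_vcont (x : H1 R n) : vcont (fun t => DxH H t (x t) l).
Proof.
move=> i t; have [[_ h] _ _ _ _] := hH2.
have hp : (fun s : R => (s, x s, l)) @ t --> (t, x t, l).
  apply: (@cvg_pair _ _ _ (nbhs t) (nbhs (t, x t)) (nbhs l)); last exact: cvg_cst.
  apply: (@cvg_pair _ _ _ (nbhs t) (nbhs t) (nbhs (x t))); first exact: cvg_id.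
  exact: H1_continuous.
have h1 := cvg_comp _ _ hp (h (t, x t, l)).
exact: (cvg_comp _ _ h1 (@coord_continuous _ _ _ i 0 (DxH H t (x t) l))).
Qed.

(** Small functions in the Sobolev norm are uniformly small, so the linearization
error applies at every time and integrates to a small multiple of the norm. *)
Lemma hamF_expansion e : 0 < e -> exists2 d, 0 < d &
  forall x, `|x| <= d -> `|hamF J H l x - lin_op x| <= e * `|x|.
Proof.
move=> e0; have [d d0 hd] := linearization_error e0.
exists (d / 2) => [|x xd]; first by rewrite divr_gt0.
have xs t : enorm (x t) <= d.
  by rewrite (le_trans (H1_sup x t))// mulrC -ler_pdivlMr.
pose r t := DxH H t (x t) l - A t *m x t.
have rle t : enorm (r t) <= e * enorm (x t) by exact: hd.
have hx := H1_sqint x.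
have cr : vcont r.
  rewrite /r (_ : (fun t => _) = fun t => DxH H t (x t) l + (- 1)%:M *m (A t *m x t)).
    apply: vcontD; first exact: DxH_along_vcont.
    apply: vcont_mulmx; first exact: mcont_cst.
    by apply: vcont_mulmx => //; exact: H1_vcont.
  by apply/funext => t; rewrite mul_scalar_mx scaleN1r.
have sr : r \in @sqint R n.
  apply: sqintI => [i|]; first exact: continuous_measurable_fun (cr i).
  have ix : mu.-integrable setT (EFin \o (fun t => e ^+ 2 * dot (x t) (x t))).
    rewrite (_ : _ \o _ = (fun t => (e ^+ 2)%:E * (dot (x t) (x t))%:E)%E)//.
    by apply: integrableZl => //; exact: sqint_dot_integrable.
  apply: le_integrable ix => //.
    apply/measurable_EFinP; exact: continuous_measurable_fun (continuous_dot cr cr).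
  move=> t _; rewrite lee_fin !ger0_norm ?mulr_ge0 ?sqr_ge0 ?dotvv_ge0 ?(ltW e0)//.
  by rewrite !dotvv -exprMn ler_sqr ?nnegrE ?mulr_ge0 ?enorm_ge0 ?(ltW e0).
have hF : (fun t => J *m L2_repr (H1_deriv x) t - DxH H t (x t) l) \in @sqint R n.
  rewrite (_ : (fun t => _) = fun t => lin_fun x t - r t); last first.
    by apply/funext => t; rewrite /lin_fun /r opprB addrA subrK.
  exact: sqintB (lin_fun_sqint x) sr.
have s1 : (fun t => - r t) \in @sqint R n by have := rpredZ (- 1) sr; rewrite scaleN1r.
have -> : hamF J H l x - lin_op x = L2_of (fun t => - r t).
  apply: L2_ext; have k1 := leb_aeS2 (fun t => @conj _ _) (L2_repr_of hF) (lin_op_repr x).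
  have k2 := leb_aeS2 (fun t => @conj _ _) (L2_reprD (hamF J H l x) ((- 1) *: lin_op x))
    (L2_reprZ (- 1) (lin_op x)).
  rewrite scaleN1r in k2.
  apply: leb_aeS2 (leb_aeS2 (fun t => @conj _ _) k1 k2) (L2_repr_of s1).
  have vid (a b c : V) : a - b - (a - c) = - (b - c) by rewrite !opprB addrC subrKA.
  move=> t [[f1 f2] [f3 f4]] ->; rewrite f3 f4 f1 -f2 scaleN1r.
  exact: vid.
rewrite L2_of_norm// (le_trans _ (ler_wpM2l (ltW e0) (l2norm_le_H1 x)))//.
apply: l2norm_le_pointwise => // [|t]; first exact: ltW.
by rewrite enormN.
Qed.

Lemma hamF_differentiable :
  differentiable (hamF J H l) (0 : H1 R n) /\
  'd (hamF J H l) (0 : H1 R n) = lin_op :> (H1 R n -> L2 R n).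
Proof.
have [T TE] := lin_op_map; have cT := lin_op_continuous; rewrite -TE in cT *.
have ex : hamF J H l \o shift (0 : H1 R n) = cst (hamF J H l 0) + T +o_ (0 : H1 R n) id.
  apply/eqaddoP => e e0; have [d d0 hd] := hamF_expansion e0.
  have nb : \forall x \near (0 : H1 R n), `|x| <= d.
    by apply/nbhs_norm0P; exists d => //= x /ltW.
  apply: filterS nb => x xd.
  rewrite -[X in `|X|]/((hamF J H l \o shift 0) x - (hamF J H l 0 + T x)) /= addr0.
  rewrite hamF0 add0r TE; apply: hd.
  exact: xd.
have dT := diff_unique cT ex; split => //.
by apply/diff_locallyP; rewrite dT.
Qed.

End Linearization.

(** * Fredholm property and kernel *)

Theorem theorem5p1 (R : realType) (N : nat) (J : 'M[R]_(2 * N))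
  (H : R -> 'cV[R]_(2 * N) -> R -> R)
  (gp gm : R -> 'cV[R]_(2 * N) -> R -> 'cV[R]_(2 * N)) (Tp Tm : R -> R)
  (lam : R) :
  (1 <= N)%N ->
  J \in unitmx -> J^T = invmx J -> invmx J = - J ->
  hypH1 H -> hypH2 H -> hypH3 H -> hypH4 H -> hypHinf H gp gm Tp Tm ->
  (forall z, characteristic_multiplier J (lim_coef gp lam) (Tp lam) z ->
    `|z| != 1) ->
  (forall z, characteristic_multiplier J (lim_coef gm lam) (Tm lam) z ->
    `|z| != 1) ->
  [/\ differentiable (hamF J H lam) (0 : H1 R (2 * N)),
      Phi0 ('d (hamF J H lam) (0 : H1 R (2 * N))) &
      [set u | exists2 x : H1 R (2 * N),
         H1_fun x = u & 'd (hamF J H lam) (0 : H1 R (2 * N)) x = 0] =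
      decaying_solutions J H lam].
Proof.
move=> _ uJ JTi iJ hH1 hH2 [hH3 _] _ [hp hm] mp mm.
have JT : J^T = - J by rewrite JTi.
have JJ : J *m J = - 1%:M by rewrite -(mulmxV uJ) iJ mulmxN opprK.
have sA := lin_coef_sym hH1 hH2 lam.
have cA : mcont (lin_coef H lam) by exact: lin_coef_mcont.
have [cp Tp0 pp lp] := asymptotic_coef lam hp.
have [cm Tm0 pm lm] := asymptotic_coef lam hm.
pose A := lin_coef H lam; pose Ap := lim_coef gp lam; pose Am := lim_coef gm lam.
have limp e : 0 < e -> exists t0, forall t, t0 <= t -> mnorm (A t - Ap t) <= e.
  move=> /lp[M [_ hM]]; exists (M + 1) => t tM; apply: hM.
  by rewrite (lt_le_trans _ tM)// ltrDl.
have limm e : 0 < e -> exists t0, forall t, t <= t0 -> mnorm (A t - Am t) <= e.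
  move=> /lm[M [_ hM]]; exists (M - 1) => t tM; apply: hM.
  by rewrite (le_lt_trans tM)// gtrBl.
have sp := end_symmetric sA Tp0 pp limp.
have sm t : (Am t)^T = Am t.
  have per s : Am (- (s + Tm lam)) = Am (- s) by rewrite /Am -(pm (- (s + Tm lam))) opprD subrK.
  have := @end_symmetric _ _ (fun s => A (- s)) (fun s => Am (- s)) (Tm lam)
    (fun s => sA (- s)) Tm0 per.
  move=> /(_ _ (- t)); rewrite opprK; apply=> e /limm[t0 ht].
  by exists (- t0) => s st; apply: ht; rewrite lerNl.
have [al [al0 bA bp bm]] := ends_bounded cA cp cm Tp0 Tm0 pp pm limp limm.
have [dF dE] := hamF_differentiable JT JJ hH1 hH2 (hH3 lam) al0 bA cA.
have cT := diff_continuous dF.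
have hT x : {ae @lebesgue_measure R, forall t, J *m wd x t - A t *m x t =
    L2_repr ('d (hamF J H lam) (0 : H1 R (2 * N)) x) t}.
  by rewrite dE; exact: lin_op_repr al0 bA cA x.
have [X fX [F K]] := hamiltonian_fredholm JT JJ al0 bA bp bm sA sp sm cA cp cm Tp0 Tm0
  pp pm limp limm mp mm cT hT.
by split => //; rewrite K (decaying_solutionsE JT JJ sA cA fX).
Qed.
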